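(* Let $u \in \mathcal{A}(\Omega) \cap \mathcal{T}(\mathbb{R}^{n})$ be a weak solution to $\mathcal{L}u=0$ in $\Omega$ under assumptions (A1)–(A4) of the context. Then there exists an exponent $\gamma \in (0,1)$, depending only on $n,s,t,p,\nu,L,\alpha,[b]_{\alpha}$, such that $u \in C^{0,\gamma}_{\mathrm{loc}}(\Omega)$. Moreover, for any ball $B_{r}=B_r(x_0) \Subset \Omega$ with $r\le R_{0}$, we have $$[u]_{C^{0,\gamma}(B_{r/2})} \le c\,r^{-\gamma}\left[\left(\frac{1}{|B_r|}\int_{B_{r}}|u|^{p}\,dx\right)^{1/p} + g_{B_{r}}^{-1}\big(T(u;x_0,r/2,r)\big)\right]$$ for a constant $c>0$ depending only on $n,s,t,p,\nu,L,\alpha,[b]_{\alpha}$.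
   Context: Setting. $\Omega\subset\mathbb{R}^n$ is a bounded domain. All of $K_{sp},K_{tp},a,b:\mathbb{R}^n\times\mathbb{R}^n\to\mathbb{R}$ are measurable and symmetric ($F(x,y)=F(y,x)$), and $a,b\ge 0$. (A1) $0<s<t<1<p<\infty$. (A2) There are constants $0<\nu\le 1\le L<\infty$ with $\frac{\nu}{|x-y|^{n+sp}}\le K_{sp}(x,y)\le\frac{L}{|x-y|^{n+sp}}$ and $\frac{\nu}{|x-y|^{n+tp}}\le K_{tp}(x,y)\le\frac{L}{|x-y|^{n+tp}}$ for a.e. $x\ne y$. (A3) $\nu\le a(x,y)+b(x,y)\le L$ for a.e. $x,y\in\mathbb{R}^n$. (A4) There are $[b]_\alpha\ge 0$ and $\alpha\in(0,1]$ with $|b(x_1,y_1)-b(x_2,y_2)|\le [b]_\alpha(|x_1-x_2|+|y_1-y_2|)^\alpha$ for all $(x_1,y_1),(x_2,y_2)\in\mathbb{R}^n\times\mathbb{R}^n$, and $(t-s)p\le\alpha$. $R_0\in(0,1)$ is a fixed small radius, depending only on $\nu,\alpha,[b]_\alpha$, satisfying $[b]_\alpha(2R_0)^\alpha\le\nu/8$. Operator: $\mathcal{L}u(x)=\mathrm{P.V.}\int_{\mathbb{R}^n}|u(x)-u(y)|^{p-2}(u(x)-u(y))\,[a(x,y)K_{sp}(x,y)+b(x,y)K_{tp}(x,y)]\,dy$. Let $\mathcal{C}_\Omega=(\mathbb{R}^n\times\mathbb{R}^n)\setminus((\mathbb{R}^n\setminus\Omega)\times(\mathbb{R}^n\setminus\Omega))$.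 A function $f:\mathbb{R}^n\to\mathbb{R}$ belongs to $\mathcal{A}(\Omega)$ iff $f|_\Omega\in L^p(\Omega)$ and $\iint_{\mathcal{C}_\Omega}\big(a(x,y)\frac{|f(x)-f(y)|^p}{|x-y|^{n+sp}}+b(x,y)\frac{|f(x)-f(y)|^p}{|x-y|^{n+tp}}\big)\,dx\,dy<\infty$. $u\in\mathcal{A}(\Omega)$ is a weak solution to $\mathcal{L}u=0$ in $\Omega$ if $$\iint_{\mathcal{C}_\Omega}|u(x)-u(y)|^{p-2}(u(x)-u(y))(\varphi(x)-\varphi(y))\,[a(x,y)K_{sp}(x,y)+b(x,y)K_{tp}(x,y)]\,dx\,dy=0$$ for every $\varphi\in\mathcal{A}(\Omega)$ with $\varphi=0$ a.e. in $\mathbb{R}^n\setminus\Omega$. Nonlocal tail: for $x_0\in\mathbb{R}^n$, $r,\rho>0$, $$T(f;x_0,r,\rho)=\sup_{x\in B_\rho(x_0)}\int_{\mathbb{R}^n\setminus B_r(x_0)}\Big(a(x,y)\frac{|f(y)|^{p-1}}{|y-x_0|^{n+sp}}+b(x,y)\frac{|f(y)|^{p-1}}{|y-x_0|^{n+tp}}\Big)\,dy,$$ and $\mathcal{T}(\mathbb{R}^n)$ is the set of $f\in L^{p-1}_{\mathrm{loc}}(\mathbb{R}^n)$ with $T(f;x_0,r,\rho)<\infty$ for all $x_0\in\mathbb{R}^n$, $r,\rho>0$. For a ball $B_r$ of radius $r$ and $\tau\ge0$: $G_{B_r}(\tau)=\sup_{x,y\in B_r}\big(a(x,y)\frac{\tau^p}{r^{sp}}+b(x,y)\frac{\tau^p}{r^{tp}}\big)$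 and $g_{B_r}(\tau)=G_{B_r}(\tau)/\tau$ (so $g_{B_r}(\tau)=G_{B_r}(1)\tau^{p-1}$); $g_{B_r}^{-1}$ is its inverse on $[0,\infty)$. Notation: $B_r(x_0)$ is the open ball, balls of different radii are concentric; $[u]_{C^{0,\gamma}(U)}$ is the usual Hölder seminorm.
   Formalization: The suprema in the tail T and in G over B_r are taken as essential suprema, since a is controlled only almost everywhere by (A3) and a pointwise sup could be infinite or arbitrarily large because of values on a null set. *)

(* Defs.v *)
From HB Require Import structures.
From mathcomp Require Import all_boot all_order all_algebra.
From mathcomp Require Import all_classical all_reals all_analysis.
From mathcomp Require Import measurable_realfun ess_sup_inf.

Set Implicit Arguments.
Unset Strict Implicit.
Unset Printing Implicit Defensive.

Import Order.TTheory GRing.Theory Num.Theory.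
Import numFieldNormedType.Exports.

Local Open Scope classical_set_scope.
Local Open Scope ring_scope.

(* The sigma-algebra generated by the coordinates, as the library does for
   n.-tuple; it is the Borel sigma-algebra of 'rV[R]_n. *)
Definition rV_display : measure_display. Proof. exact. Qed.

Section measurable_rV.
Context (R : realType) (n : nat).

Let coors (i : 'I_n) (x : 'rV[R]_n) : R := x ord0 i.

Let rV_set0 : g_sigma_preimage coors set0.
Proof. exact: sigma_algebra0. Qed.

Let rV_setC A : g_sigma_preimage coors A -> g_sigma_preimage coors (~` A).
Proof. exact: sigma_algebraC. Qed.

Let rV_bigcup (F : _^nat) : (forall i, g_sigma_preimage coors (F i)) ->
  g_sigma_preimage coors (\bigcup_i (F i)).
Proof. exact: sigma_algebra_bigcup. Qed.

HB.instance Definition _ := @isMeasurable.Build rV_display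
  'rV[R]_n (g_sigma_preimage coors) rV_set0 rV_setC rV_bigcup.

Lemma measurable_coor (i : 'I_n) :
  measurable_fun [set: 'rV[R]_n] (fun x : 'rV[R]_n => x ord0 i).
Proof.
move=> _ Y mY; rewrite setTI; apply: sub_sigma_algebra => /=.
rewrite -bigcup_seq/=; exists i => /=; first by rewrite mem_index_enum.
by exists Y => //; rewrite setTI.
Qed.

Lemma measurable_fun_rV d (T : measurableType d) (f : T -> 'rV[R]_n) :
  (forall i, measurable_fun [set: T] (fun x => f x ord0 i)) ->
  measurable_fun [set: T] f.
Proof.
move=> mf; apply: (@measurability _ _ _ _ _ _
  (\big[setU/set0]_(i < n) preimage_set_system setT (coors i) measurable)) => //.
move=> _ [C + <-].
rewrite -bigcup_seq => -[i _ [A mA <-]].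
by rewrite setTI; apply: mf.
Qed.

End measurable_rV.

Section lebesgue_step.
Context (R : realType) (n : nat).
Variable m : {sigma_finite_measure set 'rV[R]_n -> \bar R}.

Definition rV_cons (z : R * 'rV[R]_n) : 'rV[R]_n.+1 :=
  row_mx (const_mx z.1 : 'rV[R]_1) z.2.

Definition rV_uncons (x : 'rV[R]_n.+1) : R * 'rV[R]_n :=
  (x ord0 ord0, rsubmx (x : 'rV[R]_(1 + n))).

Lemma rV_cons0 z : rV_cons z ord0 ord0 = z.1.
Proof.
rewrite /rV_cons (_ : ord0 = lshift n (ord0 : 'I_1)); last exact: val_inj.
by rewrite (@row_mxEl _ 1 1 n) mxE.
Qed.

Lemma rV_consS z (i : 'I_n) : rV_cons z ord0 (lift ord0 i) = z.2 ord0 i.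
Proof.
rewrite /rV_cons (_ : lift ord0 i = rshift 1 i); last exact: val_inj.
by rewrite (@row_mxEr _ 1 1 n).
Qed.

Lemma rV_consK : cancel rV_cons rV_uncons.
Proof.
move=> [x v]; rewrite /rV_uncons rV_cons0; congr pair => /=.
exact: (@row_mxKr _ 1 1 n).
Qed.

Lemma measurable_rV_cons :
  measurable_fun [set: measurableTypeR R * 'rV[R]_n] rV_cons.
Proof.
apply: measurable_fun_rV => i.
have [j|] := unliftP ord0 i.
  move=> ->; under eq_fun do rewrite rV_consS.
  exact: (measurableT_comp (measurable_coor j) measurable_snd).
by move=> ->; under eq_fun do rewrite rV_cons0; exact: measurable_fst.
Qed.

Lemma measurable_rV_uncons :
  measurable_fun [set: 'rV[R]_n.+1]
    (rV_uncons : _ -> measurableTypeR R * 'rV[R]_n).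
Proof.
apply: (@measurable_fun_pair _ _ _ _ (measurableTypeR R)).
  exact: measurable_coor.
apply: measurable_fun_rV => i /=.
under eq_fun do rewrite /= mxE; exact: measurable_coor.
Qed.

Definition lebesgue_step : set 'rV[R]_n.+1 -> \bar R :=
  pushforward (@lebesgue_measure R \x m)%E
    (rV_cons : measurableTypeR R * 'rV[R]_n -> _).

Let measurable_preimage_cons (A : set 'rV[R]_n.+1) : measurable A ->
  measurable ((rV_cons : measurableTypeR R * 'rV[R]_n -> _) @^-1` A).
Proof.
by move=> mA; rewrite -[X in measurable X]setTI; exact: measurable_rV_cons.
Qed.

Let lebesgue_step0 : lebesgue_step set0 = 0%E.
Proof. by rewrite /lebesgue_step /pushforward preimage_set0 measure0. Qed.

Let lebesgue_step_ge0 A : (0 <= lebesgue_step A)%E.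
Proof. by rewrite /lebesgue_step /pushforward measure_ge0. Qed.

Let lebesgue_step_sigma_additive : semi_sigma_additive lebesgue_step.
Proof.
move=> F mF tF mUF; rewrite /lebesgue_step /pushforward preimage_bigcup.
apply: measure_semi_sigma_additive.
- by move=> i; exact: measurable_preimage_cons.
- apply/trivIsetP => /= i j _ _ ij; rewrite -preimage_setI.
  by move/trivIsetP : tF => /(_ _ _ _ _ ij) ->//; rewrite preimage_set0.
- by rewrite -preimage_bigcup; exact: measurable_preimage_cons.
Qed.

HB.instance Definition _ := isMeasure.Build _ _ _ lebesgue_step
  lebesgue_step0 lebesgue_step_ge0 lebesgue_step_sigma_additive.

Let lebesgue_step_sigma_finite : sigma_finite setT lebesgue_step.
Proof.
have /sigma_finiteP[F [FT ndF Foo]] := sigma_finiteT (@lebesgue_measure R).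
have /sigma_finiteP[G [GT ndG Goo]] := sigma_finiteT m.
exists (fun k => (rV_uncons : _ -> measurableTypeR R * 'rV[R]_n) @^-1`
                 (F k `*` G k)).
  apply/esym; rewrite -subTset => x _.
  have : [set: measurableTypeR R] (rV_uncons x).1 by [].
  have : [set: 'rV[R]_n] (rV_uncons x).2 by [].
  rewrite FT GT => -[k _ Gk] [l _ Fl]; exists (maxn k l) => //; split => /=.
    by move: Fl; exact/subsetPset/ndF/leq_maxr.
  by move: Gk; exact/subsetPset/ndG/leq_maxl.
move=> k; have [mF Fk] := Foo k; have [mG Gk] := Goo k; split.
  rewrite -[X in measurable X]setTI; apply: measurable_rV_uncons => //.
  exact: measurableX.
rewrite /lebesgue_step /pushforward -comp_preimage.
rewrite (_ : _ \o _ = id) ?preimage_id; last first.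
  by apply/funext => z; exact: rV_consK.
by rewrite product_measure1E// lte_mul_pinfty// ge0_fin_numE.
Qed.

HB.instance Definition _ := Measure_isSigmaFinite.Build _ _ _ lebesgue_step
  lebesgue_step_sigma_finite.

End lebesgue_step.

Section lebesgue_rV.
Context (R : realType).

Fixpoint lebesgue_rV (n : nat) : {sigma_finite_measure set 'rV[R]_n -> \bar R} :=
  match n with
  | 0%N => [the {sigma_finite_measure set 'rV[R]_0 -> \bar R} of
             @dirac _ 'rV[R]_0 0 R]
  | k.+1 => [the {sigma_finite_measure set 'rV[R]_k.+1 -> \bar R} of
             lebesgue_step (lebesgue_rV k)]
  end.

Lemma lebesgue_rV_box (n : nat) (A : 'I_n -> set (measurableTypeR R)) :
  (forall i, measurable (A i)) ->
  lebesgue_rV n [set x | forall i, A i (x ord0 i)] =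
  (\prod_(i < n) lebesgue_measure (A i))%E.
Proof.
elim: n A => [|n IH] A mA /=.
  by rewrite big_ord0 diracE mem_set//= => -[].
have mB : measurable
    [set x : 'rV[R]_n | forall i, A (lift ord0 i) (x ord0 i)].
  suff -> : [set x : 'rV[R]_n | forall i, A (lift ord0 i) (x ord0 i)] =
      \bigcap_(i in [set: 'I_n]) [set x | A (lift ord0 i) (x ord0 i)].
    apply: fin_bigcap_measurable => // i _.
    rewrite -[X in measurable X]setTI.
    by apply: (measurable_coor i) => //; exact: mA.
  by apply/seteqP; split => [x Ax i _|x Ax i]; exact: Ax.
rewrite big_ord_recl -IH// /lebesgue_step /pushforward.
rewrite (_ : _ @^-1` _ = A ord0 `*`
    [set x : 'rV[R]_n | forall i, A (lift ord0 i) (x ord0 i)]).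
  by rewrite product_measure1E.
apply/seteqP; split => [z Az|z [Az1 Az2] i] /=.
  by split=> [|i]; [rewrite -rV_cons0|rewrite -rV_consS]; exact: Az.
by have [j|] := unliftP ord0 i => ->; rewrite ?rV_consS ?rV_cons0.
Qed.

End lebesgue_rV.

(* Measurability with respect to the completion of mu: for mu = lebesgue_rV n
   or mu = lebesgue_rV n \x lebesgue_rV n this is Lebesgue measurability. *)
Definition lebesgue_measurable_fun (R : realType) d (T : measurableType d)
    (mu : set T -> \bar R) (f : T -> R) : Prop :=
  measurable_fun [set: g_sigma_algebraType (completed_algebra_gen mu)] f.

(* The library norm of 'rV[R]_n is the sup norm, and ball its ball; the topology
   (open, closure, compact, connected, bounded_set) does not depend on this. *)
Section euclidean.
Context (R : realType) (n : nat).
Implicit Types (x y : 'rV[R]_n) (U V : set 'rV[R]_n).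

Definition enorm x : R := Num.sqrt (\sum_(i < n) x ord0 i ^+ 2).

Definition eball x (r : R) : set 'rV[R]_n := [set y | enorm (y - x) < r].

Definition bounded_domain U : Prop :=
  [/\ U !=set0, open U, connected U & bounded_set U].

Definition compactly_contained U V : Prop :=
  compact (closure U) /\ closure U `<=` V.

Definition holder_seminorm (gamma : R) U (f : 'rV[R]_n -> R) : \bar R :=
  ereal_sup [set h | exists x y, [/\ U x, U y, x != y &
    h = (`|f x - f y| / enorm (x - y) `^ gamma)%:E]].

(* No bound on sup |f| has to be added: it follows on compact sets. *)
Definition holder_loc (gamma : R) U (f : 'rV[R]_n -> R) : Prop :=
  forall K, compact K -> K `<=` U -> (holder_seminorm gamma K f < +oo)%E.

End euclidean.

(* Conventions of the library used below: 0 `^ q = 0 for q <> 0 and 0^-1 = 0, so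
   singular integrands take the value 0 on the (null) diagonal, and
   `|h| `^ (p - 2) * h = 0 at h = 0 for every p. *)
Section double_phase.
Context (R : realType) (n : nat).
Implicit Types (F a b Ksp Ktp : 'rV[R]_n -> 'rV[R]_n -> R).
Implicit Types (f u phi : 'rV[R]_n -> R) (Omega : set 'rV[R]_n).

Local Notation mu := (lebesgue_rV R n).
Local Notation mu2 := (lebesgue_rV R n \x lebesgue_rV R n)%E.

Definition measurable_symmetric F : Prop :=
  lebesgue_measurable_fun mu2 (fun z => F z.1 z.2) /\
  (forall x y, F x y = F y x).

Definition kernel_bounds (nu L sigma p : R) K : Prop :=
  {ae mu2, forall z, z.1 != z.2 ->
    nu / enorm (z.1 - z.2) `^ (n%:R + sigma * p) <= K z.1 z.2
      <= L / enorm (z.1 - z.2) `^ (n%:R + sigma * p)}.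

Definition sum_bounds (nu L : R) a b : Prop :=
  {ae mu2, forall z, nu <= a z.1 z.2 + b z.1 z.2 <= L}.

Definition holder_coefficient (alpha balpha : R) b : Prop :=
  forall x1 y1 x2 y2,
    `|b x1 y1 - b x2 y2| <= balpha * (enorm (x1 - x2) + enorm (y1 - y2)) `^ alpha.

Definition interaction_set Omega : set ('rV[R]_n * 'rV[R]_n) :=
  ~` (~` Omega `*` ~` Omega).

Definition energy_space a b (s t p : R) Omega f : Prop :=
  [/\ lebesgue_measurable_fun mu f,
      (\int[mu]_(x in Omega) (`|f x| `^ p)%:E < +oo)%E &
      (\int[mu2]_(z in interaction_set Omega)
         (a z.1 z.2 * (`|f z.1 - f z.2| `^ p
                         / enorm (z.1 - z.2) `^ (n%:R + s * p))
          + b z.1 z.2 * (`|f z.1 - f z.2| `^ p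
                         / enorm (z.1 - z.2) `^ (n%:R + t * p)))%:E < +oo)%E].

Definition weak_solution a b Ksp Ktp (s t p : R) Omega u : Prop :=
  energy_space a b s t p Omega u /\
  forall phi, energy_space a b s t p Omega phi ->
    {ae mu, forall x, ~ Omega x -> phi x = 0} ->
    (\int[mu2]_(z in interaction_set Omega)
       (`|u z.1 - u z.2| `^ (p - 2) * (u z.1 - u z.2) * (phi z.1 - phi z.2)
        * (a z.1 z.2 * Ksp z.1 z.2 + b z.1 z.2 * Ktp z.1 z.2))%:E = 0)%E.

(* The coefficients a, b are controlled only almost everywhere, so suprema of
   expressions in a, b (here and in G_ball) are essential suprema: pointwise ones
   would depend on values of a on null sets. Extending by 0 outside the ball is
   harmless, as the expression is nonnegative. *)
Definition tail a b (s t p : R) f (x0 : 'rV[R]_n) (r rho : R) : \bar R :=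
  ess_sup mu ((fun x => \int[mu]_(y in ~` eball x0 r)
      (a x y * (`|f y| `^ (p - 1) / enorm (y - x0) `^ (n%:R + s * p))
       + b x y * (`|f y| `^ (p - 1) / enorm (y - x0) `^ (n%:R + t * p)))%:E)%E
    \_ (eball x0 rho)).

Definition tail_space a b (s t p : R) f : Prop :=
  [/\ lebesgue_measurable_fun mu f,
      forall K, compact K -> (\int[mu]_(x in K) (`|f x| `^ (p - 1))%:E < +oo)%E &
      forall x0 r rho, 0 < r -> 0 < rho ->
        (tail a b s t p f x0 r rho < +oo)%E].

Definition G_ball a b (s t p : R) (x0 : 'rV[R]_n) (r tau : R) : R :=
  fine (ess_sup mu2
    ((fun z => (a z.1 z.2 * (tau `^ p / r `^ (s * p))
                + b z.1 z.2 * (tau `^ p / r `^ (t * p)))%:E)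
     \_ (eball x0 r `*` eball x0 r))).

Definition g_ball a b (s t p : R) (x0 : 'rV[R]_n) (r tau : R) : R :=
  G_ball a b s t p x0 r tau / tau.

Definition g_ball_inv a b (s t p : R) (x0 : 'rV[R]_n) (r : R) : R -> R :=
  'pinv_(fun=> 0) [set tau | 0 <= tau] (g_ball a b s t p x0 r).

End double_phase.

(* Main.v *)
(* De Giorgi's method, arranged so that neither a fractional Sobolev inequality nor a
   logarithmic estimate is needed. Testing the equation with (u - l)_+ eta^p gives an
   energy inequality whose left-hand side retains only the pairs u(y) <= l < u(x). On a
   ball B_r(z) the kernel is bounded below by H(z,r) r^sp |x-y|^-(n+sp) and above by
   H(z,r) r^tp |x-y|^-(n+tp), where H(z,r) = r^-sp + b(z,z) r^-tp: this is where the
   Hoelder continuity of b and (t-s)p <= alpha enter. Hence, as soon as {u <= l} fills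
   half of a small ball around x, the left-hand side controls the integral of (u-l)_+^p,
   which replaces the Sobolev embedding and yields local boundedness. The same cross
   term shows that if {u <= l} has positive density in a ball, then u stays away from its
   supremum on a smaller one; so the oscillation of u decays geometrically on the balls
   of radius 8^-j r, the growth of u on the larger scales being absorbed by the kernel
   when the exponent is small. The coefficients are controlled only almost everywhere and
   are replaced beforehand by Borel versions satisfying the bounds everywhere; the
   continuous representative maps z to the value around which u oscillates near z. *)

Require Import Defs.
From mathcomp Require Import all_boot all_order all_algebra.
From mathcomp Require Import all_classical all_reals all_analysis.
From mathcomp Require Import measurable_realfun ess_sup_inf ring lra.

Set Implicit Arguments.
Unset Strict Implicit.
Unset Printing Implicit Defensive.

Import Order.TTheory GRing.Theory Num.Theory.
Import numFieldNormedType.Exports.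

Local Open Scope classical_set_scope.
Local Open Scope ring_scope.

(** * Integrals of non-measurable integrands *)

(** The constants may depend neither on the solution nor on the coefficients. Each estimate
    therefore produces numbers valid for every [phase_kernel] with given [la], [La], [sg], [ta]; the
    size of the coefficients at a given place and scale is carried by [H], which cancels between the
    two sides. The mismatch between the exponents [sg] (below) and [ta] (above) costs only fixed
    powers of a scale ratio. In the De Giorgi iteration the low set is sought in balls whose radius
    [t] shrinks like a high power of 2^(-j). There the kernel yields a coefficient of order t^(-sg),
    and this gain beats all losses of the j-th step, so that a linear recursion of ratio [q] takes
    the place of the usual superlinear one. In the growth lemma the gain is different: the low set
    lies [om] below the supremum, while the excess is only [de * om], and the quotient leaves a
    factor de^(p-1). No finiteness of the integrals in the energy inequality is assumed: that the
    integral in the equation vanishes is itself what makes the positive and negative parts finite.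
    Statements on [u] hold almost everywhere, and constants are compared through common points of
    balls of positive measure. *)

Section completion.
Context d (T : measurableType d) (R : realType) (mu : {measure set T -> \bar R}).

Import HBNNSimple.

(* No measurability is needed: the integral of a nonnegative function is the
   supremum of the integrals of the simple functions below it. *)
Lemma ge0_ae_le_integral_gen (D : set T) (f g : T -> \bar R) :
  (forall x, D x -> 0 <= f x)%E -> (forall x, D x -> 0 <= g x)%E ->
  {ae mu, forall x, D x -> (f x <= g x)%E} ->
  (\int[mu]_(x in D) f x <= \int[mu]_(x in D) g x)%E.
Proof.
move=> f0 g0 [N [mN muN0 fgN]].
rewrite !ge0_integralE//; apply: ge_ereal_sup => _ [h /= hf <-].
have mNC : measurable (~` N) by exact: measurableC.
pose h' := [the {nnsfun T >-> R} of proj_nnsfun h mNC].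
have h'E x : h' x = h x * \1_(~` N) x by [].
apply: (@le_trans _ _ (sintegral mu h')).
  rewrite -!integralT_nnsfun.
  rewrite (ge0_negligible_integral mN measurableT _ _ muN0)//; first last.
  - by move=> x _; rewrite lee_fin.
  - exact/measurable_EFinP.
  rewrite [leRHS](ge0_negligible_integral mN measurableT _ _ muN0)//; first last.
  - by move=> x _; rewrite lee_fin.
  - exact/measurable_EFinP.
  rewrite le_eqVlt; apply/orP; left; apply/eqP; apply: eq_integral => x.
  by rewrite inE setTD => Nx; rewrite h'E indicE mem_set// mulr1.
apply: ereal_sup_ubound; exists h' => // x.
rewrite h'E indicE; case: (boolP (x \in ~` N)) => xN; last first.
  by rewrite mulr0 erestrict_ge0.
rewrite mulr1 (le_trans (hf x))// /patch; case: ifPn => // xD.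
move: xD xN; rewrite !inE => Dx Nx.
by apply: contrapT => fg; apply: Nx; apply: fgN => /(_ Dx).
Qed.

Lemma ge0_ae_eq_integral_gen (D : set T) (f g : T -> \bar R) :
  (forall x, D x -> 0 <= f x)%E -> (forall x, D x -> 0 <= g x)%E ->
  {ae mu, forall x, D x -> f x = g x} ->
  (\int[mu]_(x in D) f x = \int[mu]_(x in D) g x)%E.
Proof.
move=> f0 g0 fg; apply/eqP; rewrite eq_le; apply/andP; split;
  apply: ge0_ae_le_integral_gen => //; apply: filterS fg => x /[apply] -> //.
Qed.

Lemma measurable_lebesgue_measurable_fun (f : T -> R) :
  measurable_fun [set: T] f -> lebesgue_measurable_fun mu f.
Proof.
move=> mf _ Y mY; apply: sub_sigma_algebra => /=; exists (f @^-1` Y).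
  by rewrite -[X in measurable X]setTI; exact: mf.
by exists set0; [exact: negligible_set0|rewrite setU0 setTI].
Qed.

(** The sets that agree almost everywhere with a measurable set form a sigma-algebra, and the
    generators of the completed one belong to it. *)
Lemma completed_measurable_version (A : set T) :
  (completed_algebra_gen mu).-sigma.-measurable A ->
  exists2 B, measurable B & {ae mu, forall x, A x <-> B x}.
Proof.
apply: (@smallest_sub _ _ (completed_algebra_gen mu)
  [set A | exists2 B, measurable B & {ae mu, forall x, A x <-> B x}]); last first.
  move=> _ [B mB [N nN <-]]; exists B => //; apply: negligibleS nN => x /=.
  by apply: contra_notP => Nx; split => [[|]|]; [|move/Nx|left].
split => /=.
- by exists set0 => //; exact: aeW.
- move=> E [B mB EB]; exists (~` B); first exact: measurableC.
  by apply: filterS EB => x [EB BE]; split => /= [[_ NE] /BE|NB]; last by split => // /EB.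
- move=> F FB; have /choice[B BP] (i : nat) : exists B, measurable B /\
      {ae mu, forall x, F i x <-> B x}.
    by have [B] := FB i; exists B.
  exists (\bigcup_i B i); first by apply: bigcupT_measurable => i; case: (BP i).
  have /ae_foralln : forall i, {ae mu, forall x, F i x <-> B i x}.
    by move=> i; case: (BP i).
  apply: filterS => x FBx; split => -[i _ /FBx Hi]; by exists i.
Qed.

(** Superlevel sets at rational levels determine the function, so only countably many sets have to
    be replaced, and a single null set [Z] collects all exceptions. The version is [f] set to 0 on
    [Z]. *)
Lemma lebesgue_measurable_version (f : T -> R) : lebesgue_measurable_fun mu f ->
  exists2 g : T -> R, measurable_fun [set: T] g & {ae mu, forall x, f x = g x}.
Proof.
move=> mf.
have /choice[A A_] (q : rat) : exists A : set T, measurable A /\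
    {ae mu, forall x, (f @^-1` `]ratr q, +oo[) x <-> A x}.
  have := mf measurableT [set` `]ratr q, +oo[] (measurable_itv _).
  by rewrite setTI => /completed_measurable_version[A mA fA]; exists A.
have : {ae mu, forall x, forall q, (f @^-1` `]ratr q, +oo[) x <-> A q x}.
  have /ae_foralln : forall k : nat, {ae mu, forall x, if unpickle k is Some q then
      (f @^-1` `]ratr q, +oo[) x <-> A q x else True}.
    move=> k; case: unpickle => [q|]; first by case: (A_ q).
    exact: aeW.
  by apply: filterS => x fA q; have := fA (pickle q); rewrite pickleK.
move=> [Z [mZ Z0 fAZ]].
have {}fAZ x : ~ Z x -> forall q, (f @^-1` `]ratr q, +oo[) x <-> A q x.
  by move=> Zx; apply: contrapT => /fAZ.
exists (fun x => f x * \1_(~` Z) x).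
  apply: (measurability _ (RGenOInfty.measurableE R)) => //.
  move=> _ [_ [r ->] <-]; rewrite setTI.
  (* The new function is 0 on [Z], so [Z] lies in the superlevel set exactly when the level is
     negative. *)
  have -> : (fun x => f x * \1_(~` Z) x) @^-1` `]r, +oo[ =
    ((\bigcup_(q in [set q : rat | r < ratr q]) A q) `&` ~` Z) `|`
      (if (r < 0) then Z else set0).
    apply/seteqP; split => [x /=|x].
      rewrite in_itv/= andbT indicE; have [xZ|xZ] := pselect (Z x).
        rewrite memNset ?mulr0 => [->|]; [by right|exact].
      rewrite mem_set// mulr1 => rf; left; split => //.
      have [q] := rat_in_itvoo rf; rewrite in_itv/= => /andP[rq qf].
      exists q => //=; apply/(fAZ _ xZ).
      by rewrite /= in_itv/= andbT.
    move=> [[[q /= rq Ax] Zx]|] /=.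
      rewrite indicE mem_set// mulr1 in_itv/= andbT (lt_trans rq)//.
      by have /(fAZ _ Zx) := Ax; rewrite /= in_itv/= andbT.
    case: ifPn => // r0 Zx; rewrite in_itv/= andbT indicE memNset ?mulr0//.
  apply: measurableU; last by case: ifP.
  apply: measurableI; last exact: measurableC.
  rewrite bigcup_mkcond; apply: bigcupT_measurable_rat => q.
  by case: ifPn => // _; have [] := A_ q.
exists Z; split => // x /= /eqP; rewrite indicE.
have [//|xZ] := pselect (Z x).
by rewrite mem_set// mulr1 eqxx.
Qed.

End completion.

(** * Inequalities drawn from a vanishing integral *)

Section ereal_balance.
Context d (T : measurableType d) (R : realType) (mu : {measure set T -> \bar R}).

Local Open Scope ereal_scope.

(* As [+oo - +oo = -oo] in the library, a vanishing integral forces the integrals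
   of the positive and negative parts to be finite; no integrability of [f] has to
   be assumed. *)
Lemma integral0_le (D : set T) (f : T -> \bar R) (g h : T -> R) :
  measurable D -> measurable_fun D f -> measurable_fun D g -> measurable_fun D h ->
  (forall x, D x -> (0 <= g x)%R) -> (forall x, D x -> (0 <= h x)%R) ->
  \int[mu]_(x in D) f x = 0 ->
  {ae mu, forall x, D x -> (g x)%:E <= f x + (h x)%:E} ->
  \int[mu]_(x in D) (g x)%:E <= \int[mu]_(x in D) (h x)%:E.
Proof.
move=> mD mf mg mh g0 h0 int0 gfh.
have gE : measurable_fun D (EFin \o g) by exact/measurable_EFinP.
have hE : measurable_fun D (EFin \o h) by exact/measurable_EFinP.
(* With the negative part of [f] moved to the left, both integrands are nonnegative. The integrals
   of [f^\+] and [f^\-] turn out to be one finite number, which cancels. *)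
have : \int[mu]_(x in D) ((g x)%:E + f^\- x) <=
       \int[mu]_(x in D) (f^\+ x + (h x)%:E).
  apply: ge0_ae_le_integral_gen.
  - by move=> x Dx; rewrite adde_ge0// lee_fin g0.
  - by move=> x Dx; rewrite adde_ge0// lee_fin h0.
  - apply: filterS gfh => x /[apply].
    rewrite funeposE funenegE; case: (f x) => [r| |] /=.
    + rewrite -!EFin_max -!EFinD !lee_fin.
      by have [r0|r0] := lerP r 0; have [nr0|nr0] := lerP (- r) 0; lra.
    + by move=> _; rewrite (max_idPl (leey 0))// addye ?leey.
    + by rewrite addNye leeNy_eq.
rewrite ge0_integralD//; last exact: measurable_funeneg.
rewrite ge0_integralD//; last exact: measurable_funepos.
have : \int[mu]_(x in D) f^\+ x - \int[mu]_(x in D) f^\- x = 0.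
  by rewrite -integralE.
have : 0 <= \int[mu]_(x in D) f^\+ x by exact: integral_ge0.
have : 0 <= \int[mu]_(x in D) f^\- x by exact: integral_ge0.
move: (\int[mu]_(x in D) f^\+ x) (\int[mu]_(x in D) f^\- x) => [a| |] [b| |] //=.
move=> _ _ /eqP; rewrite -EFinB eqe subr_eq0 => /eqP ->.
by rewrite [leRHS]addeC leeD2rE.
Qed.

End ereal_balance.

(** * Euclidean balls *)

Section enorm_theory.
Context (R : realType) (n : nat).
Implicit Types (x y z : 'rV[R]_n) (r e : R).

Lemma enorm_ge0 x : 0 <= enorm x.
Proof. exact: sqrtr_ge0. Qed.

Lemma enormE x : enorm x ^+ 2 = \sum_(i < n) x ord0 i ^+ 2.
Proof. by rewrite sqr_sqrtr// sumr_ge0// => i _; exact: sqr_ge0. Qed.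

Lemma enorm0 : enorm (0 : 'rV[R]_n) = 0.
Proof. by rewrite /enorm big1 ?sqrtr0// => i _; rewrite mxE expr0n. Qed.

Lemma enormN x : enorm (- x) = enorm x.
Proof.
by rewrite /enorm; congr Num.sqrt; apply: eq_bigr => i _; rewrite mxE sqrrN.
Qed.

Lemma enormC x y : enorm (x - y) = enorm (y - x).
Proof. by rewrite -enormN opprB. Qed.

Lemma coord_le_enorm x i : `|x ord0 i| <= enorm x.
Proof.
rewrite -(@ler_pXn2r _ 2)// ?nnegrE ?enorm_ge0// enormE -normrX ger0_norm ?sqr_ge0//.
rewrite (bigD1 i)//= lerDl sumr_ge0// => j _; exact: sqr_ge0.
Qed.

Lemma enorm_eq0 x : enorm x = 0 -> x = 0.
Proof.
move=> x0; apply/rowP => i; rewrite mxE; apply/eqP.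
by rewrite -normr_le0 -x0 coord_le_enorm.
Qed.

Lemma enorm_gt0 x y : x != y -> 0 < enorm (x - y).
Proof.
move=> xy; rewrite lt0r enorm_ge0 andbT; apply: contra_neq xy => /enorm_eq0.
by move/eqP; rewrite subr_eq0 => /eqP.
Qed.

(** Expansion of the sum of the squares of |y| x_i - |x| y_i, divided by 2 |x| |y|; the vanishing
    norms are treated first. *)
Lemma cauchy_schwarz_rV x y :
  \sum_(i < n) x ord0 i * y ord0 i <= enorm x * enorm y.
Proof.
have [x0|x0] := eqVneq (enorm x) 0.
  rewrite x0 mul0r big1// => i _; move/enorm_eq0 : x0 => ->.
  by rewrite mxE mul0r.
have [y0|y0] := eqVneq (enorm y) 0.
  rewrite y0 mulr0 big1// => i _; move/enorm_eq0 : y0 => ->.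
  by rewrite mxE mulr0.
have AB0 : 0 < enorm x * enorm y by rewrite mulr_gt0// lt0r ?x0 ?y0 enorm_ge0.
rewrite -(ler_pM2l AB0).
have : 0 <= \sum_(i < n) (enorm y * x ord0 i - enorm x * y ord0 i) ^+ 2.
  by rewrite sumr_ge0// => i _; exact: sqr_ge0.
under eq_bigr do rewrite sqrrB !exprMn.
rewrite big_split/= big_split/= -mulr_sumr -mulr_sumr -!enormE.
under eq_bigr do rewrite -mulNrn -mulr_natl mulrACA mulrN.
rewrite sumrN -2!mulr_sumr; set S := \sum_(i < n) _; nra.
Qed.

Lemma ler_enormD x y : enorm (x + y) <= enorm x + enorm y.
Proof.
rewrite -(@ler_pXn2r _ 2)// ?nnegrE ?addr_ge0 ?enorm_ge0// enormE.
under eq_bigr do rewrite mxE sqrrD.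
rewrite big_split/= big_split/= -!enormE.
under eq_bigr do rewrite mulr2n.
rewrite big_split/=; have := cauchy_schwarz_rV x y; nra.
Qed.

Lemma ler_enormB x y z : enorm (x - z) <= enorm (x - y) + enorm (y - z).
Proof. by rewrite (le_trans _ (ler_enormD _ _))// addrA subrK. Qed.

Lemma enorm_le_coord x r : 0 <= r -> (forall i, `|x ord0 i| <= r) ->
  enorm x <= n%:R * r.
Proof.
move=> r0 xr.
rewrite -(@ler_pXn2r _ 2)// ?nnegrE ?mulr_ge0 ?enorm_ge0// enormE.
apply: (@le_trans _ _ (\sum_(i < n) r ^+ 2)).
  apply: ler_sum => i _; rewrite -[leLHS]ger0_norm ?sqr_ge0// normrX.
  by rewrite ler_pXn2r// nnegrE.
rewrite sumr_const card_ord -[leLHS]mulr_natl exprMn ler_wpM2r ?sqr_ge0//.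
by rewrite -natrX ler_nat; case: (n) => // m; rewrite leq_pmulr.
Qed.

Lemma measurable_enorm d (T : measurableType d) (f : T -> 'rV[R]_n) :
  measurable_fun setT f -> measurable_fun setT (fun t => enorm (f t)).
Proof.
move=> mf.
rewrite [X in measurable_fun _ X](_ : _ =
    fun t => (\sum_(i < n) f t ord0 i ^+ 2) `^ 2^-1); last first.
  apply/funext => t; rewrite powR12_sqrt ?sumr_ge0// => i _; exact: sqr_ge0.
apply: (measurableT_comp (measurable_powR _)).
apply: measurable_sum => i; apply: measurable_funX.
exact: (measurableT_comp (measurable_coor i)).
Qed.

Lemma measurable_fun_subrV d (T : measurableType d) (f g : T -> 'rV[R]_n) :
  measurable_fun setT f -> measurable_fun setT g ->
  measurable_fun setT (fun t => f t - g t).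
Proof.
move=> mf mg; apply: measurable_fun_rV => i.
under eq_fun do rewrite mxE mxE; apply: measurable_funB.
  exact: (measurableT_comp (measurable_coor i)).
exact: (measurableT_comp (measurable_coor i)).
Qed.

Lemma eball_center x r : 0 < r -> eball x r x.
Proof. by rewrite /eball/= subrr enorm0. Qed.

Lemma subset_eball x y r e : enorm (x - y) + r <= e -> eball x r `<=` eball y e.
Proof.
move=> xyr z; rewrite /eball/= => zx; apply: lt_le_trans xyr.
by rewrite (le_lt_trans (ler_enormB _ x _))// addrC ltrD2l.
Qed.

Lemma subset_eballr x r e : r <= e -> eball x r `<=` eball x e.
Proof. by move=> re; apply: subset_eball; rewrite subrr enorm0 add0r. Qed.

Lemma measurable_eball x r : measurable (eball x r).
Proof.
rewrite [eball x r](_ : _ = (fun y => enorm (y - x)) @^-1` `]-oo, r[); last first.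
  by apply/seteqP; split => y; rewrite /eball/= in_itv.
rewrite -[X in measurable X]setTI; apply: measurable_enorm => //.
exact: measurable_fun_subrV.
Qed.

End enorm_theory.

(** * Measurability of open sets *)

Section open_measurable.
Context (R : realType) (n : nat).

Let box (q : 'rV[rat]_n) (k : nat) : set 'rV[R]_n :=
  [set x | forall i, `|x ord0 i - ratr (q ord0 i)| < k.+1%:R^-1].

Let measurable_box q k : measurable (box q k).
Proof.
have -> : box q k = \bigcap_(i in [set: 'I_n])
    [set x | `|x ord0 i - ratr (q ord0 i)| < k.+1%:R^-1].
  by apply/seteqP; split => [x Bx i _|x Bx i]; exact: Bx.
apply: fin_bigcap_measurable => // i _.
rewrite [X in measurable X](_ : _ = (fun x : 'rV[R]_n =>
    `|x ord0 i - ratr (q ord0 i)|) @^-1` `]-oo, k.+1%:R^-1[); last first.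
  by apply/seteqP; split => x; rewrite /= in_itv.
rewrite -[X in measurable X]setTI.
apply: (measurableT_comp (@normr_measurable R setT)) => //.
by apply: measurable_funB => //; exact: measurable_coor.
Qed.

(** An open set is the countable union of the products of rational boxes that it contains. The
    statement is on pairs because it also has to apply to superlevel sets of the coefficient [b]. *)
Lemma box_open_measurable (S : set ('rV[R]_n * 'rV[R]_n)) :
  (forall z, S z -> exists2 e, 0 < e & forall w : 'rV[R]_n * 'rV[R]_n,
    (forall i, `|w.1 ord0 i - z.1 ord0 i| < e) ->
    (forall i, `|w.2 ord0 i - z.2 ord0 i| < e) -> S w) ->
  measurable S.
Proof.
move=> Sopen.
have -> : S = \bigcup_(c in [set: 'rV[rat]_n * 'rV[rat]_n * nat])
    (if `[< box c.1.1 c.2 `*` box c.1.2 c.2 `<=` S >]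
     then box c.1.1 c.2 `*` box c.1.2 c.2 else set0).
  apply/seteqP; split => [z Sz|z [c _]]; last by case: asboolP => // + Sz; exact.
  have [e e0 eS] := Sopen _ Sz.
  have [k ke] : exists k, k.+1%:R^-1 < e / 2 :> R.
    have e20 : 0 < e / 2 by rewrite divr_gt0.
    exists (Num.truncn (e / 2)^-1); rewrite invf_plt ?posrE//.
    by rewrite truncnS_gt.
  have near (x : 'rV[R]_n) : exists q, box q k x.
    have /choice[q qx] (i : 'I_n) : exists q : rat,
        `|x ord0 i - ratr q| < k.+1%:R^-1.
      have lt : x ord0 i < x ord0 i + k.+1%:R^-1 by rewrite ltrDl.
      have [q] := rat_in_itvoo lt; rewrite in_itv/= => /andP[xq qx].
      by exists q; rewrite distrC gtr0_norm ?subr_gt0// ltrBlDl.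
    by exists (\row_i q i) => i; rewrite mxE.
  have [q1 zq1] := near z.1; have [q2 zq2] := near z.2.
  exists (q1, q2, k) => //=; case: asboolP => // -[]; move=> w [/= w1 w2].
  apply: eS => i.
    have := w1 i; have := zq1 i; rewrite -/(k.+1) => {}zq1 {}w1.
    rewrite (le_lt_trans (ler_distD (ratr (q1 ord0 i)) _ _))//.
    by rewrite (distrC (ratr _)) (splitr e) ltrD// (lt_trans _ ke).
  have := w2 i; have := zq2 i => {}zq2 {}w2.
  rewrite (le_lt_trans (ler_distD (ratr (q2 ord0 i)) _ _))//.
  by rewrite (distrC (ratr _)) (splitr e) ltrD// (lt_trans _ ke).
apply: countable_bigcupT_measurable => // c.
by case: ifPn => // _; exact: measurableX.
Qed.

Lemma open_rV_measurable (U : set 'rV[R]_n) : open U -> measurable U.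
Proof.
move=> oU.
have -> : U = (fun x : 'rV[R]_n => (x, x)) @^-1` (U `*` setT).
  by apply/seteqP; split => [x //|x []].
rewrite -[X in measurable X]setTI.
apply: measurable_fun_pair => //.
apply: box_open_measurable => -[x y] [/= Ux _].
have /nbhs_ballP[e/= e0 eU] : nbhs x U by exact: open_nbhs_nbhs.
exists e => // -[w1 w2] /= w1x _; split => //; apply: eU.
split => // i j; rewrite (ord1 i) /ball/= distrC; exact: w1x.
Qed.

End open_measurable.

(** * Volumes of balls *)

Section volume.
Context (R : realType) (n : nat).
Hypothesis n0 : (0 < n)%N.
Local Notation mu := (lebesgue_rV R n).

Let cubeE (x : 'rV[R]_n) (h : R) : 0 <= h ->
  mu [set y | forall i, `]x ord0 i - h, x ord0 i + h[%classic (y ord0 i)] =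
  ((2 * h) ^+ n)%:E.
Proof.
move=> h0.
rewrite (@lebesgue_rV_box R n (fun i => `]x ord0 i - h, x ord0 i + h[%classic))//.
rewrite [LHS](_ : _ = (\prod_(i < n) (2 * h)%:E)%E); last first.
  apply: eq_bigr => i _; rewrite lebesgue_measure_itv/= lte_fin.
  case: ifPn => [_|]; first by rewrite -EFinB; congr EFin; ring.
  by rewrite -leNgt => h1; congr EFin; lra.
by rewrite prodEFin prodr_const card_ord.
Qed.

Let measurable_cube (x : 'rV[R]_n) (h : R) :
  measurable [set y : 'rV[R]_n | forall i, `]x ord0 i - h, x ord0 i + h[%classic (y ord0 i)].
Proof.
have -> : [set y : 'rV[R]_n | forall i, `]x ord0 i - h, x ord0 i + h[%classic (y ord0 i)] =
    \bigcap_(i in [set: 'I_n]) [set y | `]x ord0 i - h, x ord0 i + h[%classic (y ord0 i)].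
  by apply/seteqP; split => [y Ay i _|y Ay i]; exact: Ay.
apply: fin_bigcap_measurable => // i _.
by rewrite -[X in measurable X]setTI; apply: (measurable_coor i).
Qed.

Lemma eball_vol_le (x : 'rV[R]_n) (r : R) : 0 <= r ->
  (mu (eball x r) <= (2 ^+ n * r ^+ n)%:E)%E.
Proof.
move=> r0; rewrite -exprMn -(cubeE x r0); apply: le_measure.
- by rewrite inE; exact: measurable_eball.
- by rewrite inE; exact: measurable_cube.
move=> y; rewrite /eball/= => yx i.
rewrite in_itv/= -ltr_distlC distrC.
by have := coord_le_enorm (y - x) i; rewrite !mxE => /le_lt_trans; exact.
Qed.

(** The cube of half side r/(2n) lies in the ball. Half side r/n would only give
    [enorm (y - x) <= r], while the ball is open; hence the extra division by 2. *)
Lemma eball_vol_ge (x : 'rV[R]_n) (r : R) : 0 < r ->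
  (((2 / n%:R / 2) ^+ n * r ^+ n)%:E <= mu (eball x r))%E.
Proof.
move=> r0.
have nR : 0 < n%:R :> R by rewrite ltr0n.
have h0 : 0 <= r / n%:R / 2 by rewrite !divr_ge0// ltW.
have -> : (2 / n%:R / 2) ^+ n * r ^+ n = (2 * (r / n%:R / 2)) ^+ n.
  by rewrite -exprMn; congr (_ ^+ _); field; rewrite gt_eqF.
rewrite -(cubeE x h0); apply: le_measure.
- by rewrite inE; exact: measurable_cube.
- by rewrite inE; exact: measurable_eball.
move=> y; rewrite /eball/= => yx.
have : enorm (y - x) <= n%:R * (r / n%:R / 2).
  apply: enorm_le_coord => // i; rewrite !mxE ltW//.
  by have := yx i; rewrite in_itv/= -ltr_distlC distrC.
move=> /le_lt_trans; apply.
by rewrite [ltLHS](_ : _ = r / 2) ?midf_lt//; [rewrite ltr_pdivrMr//; lra|field; rewrite gt_eqF].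
Qed.

Lemma eball_vol_fin (x : 'rV[R]_n) (r : R) : (mu (eball x r) < +oo)%E.
Proof.
have [r0|r0] := leP 0 r; first by rewrite (le_lt_trans (eball_vol_le x r0))// ltry.
rewrite [eball x r](_ : _ = set0) ?measure0//.
apply/seteqP; split => // y; rewrite /eball/= => yr.
by have := le_lt_trans (enorm_ge0 _) yr; lra.
Qed.

Definition vol (A : set 'rV[R]_n) : R := fine (mu A).

Lemma eball_volE (x : 'rV[R]_n) (r : R) : mu (eball x r) = (vol (eball x r))%:E.
Proof. by rewrite /vol fineK// ge0_fin_numE ?eball_vol_fin. Qed.

End volume.

(** * Inequalities for integrals and powers *)

Section integral_bounds.
Context d (T : measurableType d) (R : realType) (mu : {measure set T -> \bar R}).
Local Open Scope ereal_scope.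

Lemma ge0_le_integral_gen (D : set T) (f g : T -> \bar R) :
  (forall x, D x -> 0 <= f x) -> (forall x, D x -> f x <= g x) ->
  \int[mu]_(x in D) f x <= \int[mu]_(x in D) g x.
Proof.
move=> f0 fg; apply: ge0_ae_le_integral_gen => //; last exact: aeW.
by move=> x Dx; rewrite (le_trans (f0 _ Dx))// fg.
Qed.

Lemma ge0_subset_integral_gen (A B : set T) (f g : T -> \bar R) :
  (forall x, A x -> 0 <= f x) -> (forall x, B x -> 0 <= g x) ->
  A `<=` B -> (forall x, A x -> f x <= g x) ->
  \int[mu]_(x in A) f x <= \int[mu]_(x in B) g x.
Proof.
move=> f0 g0 AB fg; rewrite [leLHS]integral_mkcond [leRHS]integral_mkcond.
apply: ge0_le_integral_gen => x _; first exact: erestrict_ge0.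
rewrite /patch; case: ifPn => [|xA]; last by case: ifPn => //; rewrite inE => /g0.
by rewrite inE => Ax; rewrite mem_set ?fg//; exact: AB.
Qed.

Lemma integral_ge_cst (D S : set T) (f : T -> \bar R) (c : R) :
  measurable S -> S `<=` D -> (forall x, D x -> 0 <= f x) ->
  (forall x, S x -> c%:E <= f x) -> (0 <= c)%R ->
  c%:E * mu S <= \int[mu]_(x in D) f x.
Proof.
move=> mS SD f0 cf c0; rewrite -integral_cst//.
by apply: ge0_subset_integral_gen => // x _; rewrite lee_fin.
Qed.

Lemma geometric_sum_le (K q : R) m : (0 <= K)%R -> (0 <= q < 1)%R ->
  (\sum_(0 <= i < m) K * q ^+ i <= K / (1 - q))%R.
Proof.
move=> K0 /andP[q0 q1]; rewrite -mulr_sumr ler_wpM2l//.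
rewrite -[leRHS]mul1r ler_pdivlMr ?subr_gt0// big_mkord.
have := subrX1 q m; have := exprn_ge0 m q0.
by set S := (\sum_(i < m) _)%R; nra.
Qed.

(** The function is dominated by the series of the [c i] times the indicators of the [E i]. The
    pieces may overlap, so balls can be used in place of annuli: each point only needs one index
    whose bound applies to it. *)
Lemma integral_dyadic_le (D : set T) (f : T -> \bar R) (E : nat -> set T)
    (c : nat -> R) (K q : R) :
  (forall i, measurable (E i)) -> (forall i, (0 <= c i)%R) ->
  (0 <= K)%R -> (0 <= q < 1)%R ->
  (forall i, (c i)%:E * mu (E i) <= (K * q ^+ i)%:E) ->
  (forall x, D x -> 0 <= f x) ->
  (forall x, D x -> f x = 0 \/ exists2 i, E i x & f x <= (c i)%:E) ->
  \int[mu]_(x in D) f x <= (K / (1 - q))%:E.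
Proof.
move=> mE c0 K0 q01 cE f0 fE.
pose F i x := (c i * \1_(E i) x)%:E.
have F0 i x : 0 <= F i x by rewrite lee_fin mulr_ge0.
have mF i : measurable_fun setT (F i).
  by apply/measurable_EFinP; apply: measurable_funM => //; exact: measurable_indic.
apply: (@le_trans _ _ (\int[mu]_x (\sum_(i <oo) F i x))).
  apply: ge0_subset_integral_gen => //.
    by move=> x _; exact: nneseries_ge0.
  move=> x Dx; have [->|[i Ei fi]] := fE _ Dx; first exact: nneseries_ge0.
  rewrite (le_trans fi)//.
  have -> : (c i)%:E = F i x by rewrite /F indicE mem_set// mulr1.
  rewrite (@nneseriesD1 _ (fun j => F j x) i xpredT)//.
  by rewrite leeDl// nneseries_ge0.
rewrite integral_nneseries//.
apply: lime_le; first by apply: is_cvg_nneseries => i _ _; exact: integral_ge0.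
apply: nearW => m; rewrite (@le_trans _ _ (\sum_(0 <= i < m) (K * q ^+ i)%:E))//.
  apply: lee_sum => i _; rewrite (le_trans _ (cE i))//.
  rewrite /F; under eq_integral do rewrite EFinM.
  rewrite ge0_integralZl//; last 2 first.
  - by apply/measurable_EFinP; exact: measurable_indic.
  - by rewrite lee_fin.
  by rewrite integral_indic// setIT.
by rewrite sumEFin lee_fin geometric_sum_le.
Qed.

Lemma ge0_chebyshev (D : set T) (f : T -> R) (e : R) : measurable D ->
  measurable_fun setT f -> (0 <= e)%R -> (forall x, (0 <= f x)%R) ->
  e%:E * mu (D `&` [set x | e <= f x]%R) <= \int[mu]_(x in D) (f x)%:E.
Proof.
move=> mD mf e0 f0; apply: integral_ge_cst => //.
- apply: measurableI => //.
  rewrite [X in measurable X](_ : _ = f @^-1` `[e, +oo[%classic).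
    by rewrite -[X in measurable X]setTI; exact: mf.
  by apply/seteqP; split => x; rewrite /= in_itv/= andbT.
- by move=> x _; rewrite lee_fin.
- by move=> x [_ /=]; rewrite lee_fin.
Qed.

Lemma integral_eq0_ae (D : set T) (f : T -> R) : measurable D ->
  measurable_fun setT f -> (forall x, (0 <= f x)%R) ->
  \int[mu]_(x in D) (f x)%:E = 0 -> {ae mu, forall x, D x -> f x = 0%R}.
Proof.
move=> mD mf f0 int0.
have mEf : measurable_fun D (EFin \o f).
  by apply/measurable_EFinP; exact: measurable_funTS.
have [+ _] := ae_eq_integral_abs mu mD mEf.
have -> : \int[mu]_(x in D) `|(EFin \o f) x| = \int[mu]_(x in D) (f x)%:E.
  by apply: eq_integral => x _ /=; rewrite ger0_norm.
by move=> /(_ int0); apply: filterS => x /= /[apply] -[].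
Qed.

Lemma ge0_integral_setU_le (A B C : set T) (f : T -> R) :
  measurable B -> measurable C -> measurable_fun setT f ->
  (forall x, (0 <= f x)%R) -> A `<=` B `|` C ->
  \int[mu]_(x in A) (f x)%:E <=
  \int[mu]_(x in B) (f x)%:E + \int[mu]_(x in C) (f x)%:E.
Proof.
move=> mB mC mf f0 ABC.
have mfE D : measurable D -> measurable_fun setT ((EFin \o f) \_ D).
  move=> mD; apply/measurable_restrict => //; rewrite setTI.
  by apply/measurable_EFinP; exact: measurable_funTS.
have f0E D x : 0 <= ((EFin \o f) \_ D) x.
  by apply: erestrict_ge0 => y _; rewrite lee_fin.
rewrite [leLHS]integral_mkcond [X in _ <= X + _]integral_mkcond.
rewrite [X in _ <= _ + X]integral_mkcond.
rewrite -ge0_integralD//; try exact: mfE; try by move=> x _; exact: f0E.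
apply: ge0_le_integral_gen => x _; first exact: f0E.
have := f0E B x; have := f0E C x; have := f0 x; rewrite /patch.
have [xA|] := boolP (x \in A); last first.
  by move=> _ _ /[swap] ?; exact: adde_ge0.
move: xA; rewrite inE => /ABC[|] xD; rewrite (mem_set xD) => _ ? ?.
  by rewrite leeDl.
by rewrite leeDr.
Qed.

Lemma integralZl_fin (D : set T) (f : T -> R) (c : R) : measurable D ->
  measurable_fun setT f -> (forall x, (0 <= f x)%R) -> (0 <= c)%R ->
  \int[mu]_(x in D) (c * f x)%:E = c%:E * \int[mu]_(x in D) (f x)%:E.
Proof.
move=> mD mf f0 c0; under eq_integral do rewrite EFinM.
rewrite ge0_integralZl_EFin//; last first.
  by apply/measurable_EFinP; exact: measurable_funTS.
by move=> x _; rewrite lee_fin.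
Qed.

Lemma measurable_set_le (f : T -> R) (c : R) : measurable_fun setT f ->
  measurable [set x | (f x <= c)%R].
Proof.
move=> mf; rewrite [X in measurable X](_ : _ = f @^-1` `]-oo, c]%classic).
  by rewrite -[X in measurable X]setTI; exact: mf.
by apply/seteqP; split => x; rewrite /= in_itv/=.
Qed.

Lemma measurable_set_gt (f : T -> R) (c : R) : measurable_fun setT f ->
  measurable [set x | (c < f x)%R].
Proof.
move=> mf; rewrite [X in measurable X](_ : _ = f @^-1` `]c, +oo[%classic).
  by rewrite -[X in measurable X]setTI; exact: mf.
by apply/seteqP; split => x; rewrite /= in_itv/= andbT.
Qed.

End integral_bounds.

Ltac pos_tac := lazymatch goal with
  | |- is_true (0 < _ * _) => apply: mulr_gt0; pos_tac
  | |- is_true (0 <= _ * _) => apply: mulr_ge0; pos_tac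
  | |- is_true (0 < _ ^+ _) => apply: exprn_gt0; pos_tac
  | |- is_true (0 <= _ ^+ _) => apply: exprn_ge0; pos_tac
  | |- is_true (0 < _ `^ _) => apply: powR_gt0; pos_tac
  | |- is_true (0 <= _ `^ _) => exact: powR_ge0
  | |- is_true (0 < _^-1) => rewrite invr_gt0; pos_tac
  | |- is_true (0 <= _^-1) => rewrite invr_ge0; pos_tac
  | |- is_true (0 < _ + _) => first [ assumption | apply: addr_gt0; pos_tac ]
  | |- is_true (0 <= _ + _) =>
      first [ assumption | apply: ltW; assumption | apply: addr_ge0; pos_tac ]
  | |- is_true (0 < _) => first [ assumption | done ]
  | |- is_true (0 <= _) => first [ assumption | apply: ltW; assumption | done ]
  end.

(** * Real powers and dyadic scales *)

Section powR_extra.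
Context {R : realType}.
Implicit Types x y a b l r e : R.

Lemma le0_powR_le x y a : 0 < x -> x <= y -> 0 <= a -> y `^ (- a) <= x `^ (- a).
Proof.
move=> x0 xy a0; rewrite !powRN lef_pV2 ?posrE ?powR_gt0 ?(lt_le_trans x0)//.
by rewrite ge0_ler_powR ?nnegrE// ?ltW// (lt_le_trans x0).
Qed.

Lemma powRDg x a b : 0 < x -> x `^ (a + b) = x `^ a * x `^ b.
Proof. by move=> x0; rewrite powRD// (gt_eqF x0) implybT. Qed.

Lemma powRNM x a : 0 < x -> x `^ (- a) * x `^ a = 1.
Proof. by move=> x0; rewrite -powRDg// addNr powRr0. Qed.

Lemma powR_geom x a (m : nat) : 0 <= x -> (x ^+ m) `^ a = (x `^ a) ^+ m.
Proof. by move=> x0; rewrite -(powR_mulrn _ x0) -(powR_mulrn _ (powR_ge0 x a)) powRAC. Qed.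

Lemma powRV x a : 0 <= x -> x^-1 `^ a = x `^ (- a).
Proof. by move=> x0; rewrite -powR_inv1// -powRrM mulN1r. Qed.

Lemma powR_div x y a : 0 <= x -> 0 <= y -> (x / y) `^ a = x `^ a / y `^ a.
Proof. by move=> x0 y0; rewrite powRM ?invr_ge0// powRV// powRN. Qed.

Lemma powR_gt1_lt1 a b : 1 < a -> b < 0 -> a `^ b < 1.
Proof.
move=> a1 b0; rewrite -[X in _ < X](powRr0 a) /powR gt_eqF; last by lra.
by rewrite ltr_expR mul0r nmulr_rlt0// ln_gt0.
Qed.

Lemma powR_ge1 a b : 1 <= a -> 0 <= b -> 1 <= a `^ b.
Proof. by move=> a1 b0; rewrite -[leLHS](powRr0 a) ler_powR. Qed.

(** Key to the power identities below: once every positive quantity is written as an exponential, an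
    identity between products of real powers becomes a polynomial identity between exponents, left
    to [ring]. *)
Lemma expR_ex x : 0 < x -> exists l, x = expR l.
Proof. by move=> x0; exists (ln x); rewrite lnK. Qed.

Lemma expR_powR l a : expR l `^ a = expR (l * a).
Proof. by rewrite /powR gt_eqF ?expR_gt0// expRK mulrC. Qed.

Lemma expR_exprn l (m : nat) : expR l ^+ m = expR (l * m%:R).
Proof. by rewrite expRM_natr. Qed.

Lemma expR_inv l : (expR l)^-1 = expR (- l).
Proof. by rewrite expRN. Qed.

Lemma dyadic_small r e : 0 < r -> 0 < e -> e < 2 * r ->
  exists i, r * 2^-1 ^+ i <= e < 2 * r * 2^-1 ^+ i.
Proof.
move=> r0 e0 e2r.
have ex : exists i, r * 2^-1 ^+ i <= e.
  exists (Num.truncn (r / e)); rewrite exprVn ler_pdivrMr ?exprn_gt0//.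
  rewrite mulrC -ler_pdivrMr//; apply/ltW/(lt_le_trans (truncnS_gt _)).
  by rewrite -natrX ler_nat; apply: ltn_expl.
exists (ex_minn ex); case: ex_minnP => -[|i] mi min; rewrite mi/=.
  by rewrite expr0 mulr1.
have := contraNnot (min i); rewrite -ltnNge leqnn => /(_ isT)/negP.
by rewrite -ltNge exprS => /lt_le_trans; apply; rewrite mulrACA divff// mul1r.
Qed.

Lemma dyadic_large r e : 0 < r -> r <= e ->
  exists i, 2 ^+ i * r <= e < 2 ^+ i.+1 * r.
Proof.
move=> r0 re.
have ex : exists i, e < 2 ^+ i.+1 * r.
  exists (Num.truncn (e / r)); rewrite -ltr_pdivrMr//.
  apply: (lt_le_trans (truncnS_gt _)).
  by rewrite -natrX ler_nat; apply: ltnW; apply: ltn_expl.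
exists (ex_minn ex); case: ex_minnP => -[|i] mi min; rewrite mi andbT.
  by rewrite expr0 mul1r.
have := contraNnot (min i); rewrite -ltnNge leqnn => /(_ isT)/negP.
by rewrite -leNgt.
Qed.

Lemma geometric_le0 (C q x : R) : 0 <= q -> q <= 2^-1 ->
  (forall j, x <= C * q ^+ j) -> x <= 0.
Proof.
move=> q0 q1 xC; rewrite leNgt; apply/negP => x0.
have C0 : 0 < C by have := xC 0%N; rewrite expr0 mulr1; apply: lt_le_trans.
have := xC (Num.truncn (C / x)); rewrite leNgt => /negP; apply.
apply: (@le_lt_trans _ _ (C * 2^-1 ^+ Num.truncn (C / x))).
  by rewrite ler_wpM2l ?(ltW C0)// lerXn2r ?nnegrE.
rewrite exprVn ltr_pdivrMr ?exprn_gt0// mulrC -ltr_pdivrMr//.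
apply: (lt_le_trans (truncnS_gt _)); rewrite -natrX ler_nat; exact: ltn_expl.
Qed.

(** Source of the small parameters chosen later. Dividing by [1 + C] and not by [C] covers the case
    [C = 0]. *)
Lemma exists_small_powR (C q e b : R) : 0 <= C -> 0 < q -> 0 < e -> 0 < b ->
  exists2 t, 0 < t <= b & C * t `^ e <= q.
Proof.
move=> C0 q0 e0 b0; have C1 : 0 < 1 + C by rewrite ltr_pwDl.
exists (Num.min b ((q / (1 + C)) `^ e^-1)).
  by rewrite lt_min b0 powR_gt0 ?divr_gt0//= ge_min lexx.
set t := Num.min _ _.
have t0 : 0 <= t by rewrite le_min ltW//= powR_ge0.
have : t <= (q / (1 + C)) `^ e^-1 by rewrite ge_min lexx orbT.
have : 0 <= q / (1 + C) by rewrite divr_ge0 ?ltW.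
have [Q QE] : exists x, x = q / (1 + C) by eexists.
rewrite -QE => Q0 tQ; have : t `^ e <= Q.
  rewrite -[leRHS]powRr1// -(mulVf (lt0r_neq0 e0)) powRrM.
  by apply: ge0_ler_powR; rewrite ?nnegrE ?powR_ge0 ?(ltW e0).
rewrite QE ler_pdivlMr// mulrDr mulr1 mulrC => tq.
by apply: le_trans tq; rewrite lerDr powR_ge0.
Qed.

Lemma powR_addle x y a : 0 <= x -> 0 <= y -> 0 <= a ->
  (x + y) `^ a <= 2 `^ a * (x `^ a + y `^ a).
Proof.
move=> x0 y0 a0; apply: (@le_trans _ _ ((2 * Num.max x y) `^ a)).
  rewrite ge0_ler_powR ?nnegrE ?addr_ge0 ?mulr_ge0// ?le_max ?x0//.
  by rewrite mulr_natl mulr2n lerD// le_max lexx ?orbT.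
rewrite powRM ?le_max ?x0// ler_wpM2l ?powR_ge0//.
by case: (leP x y) => _; rewrite ?lerDr ?lerDl powR_ge0.
Qed.

End powR_extra.

(** * Double phase kernels *)

Section kernel.
Context (R : realType) (n : nat).
Hypothesis n0 : (0 < n)%N.
Variables (sg ta p la La : R).
Hypotheses (sg0 : 0 < sg) (sgta : sg <= ta) (tap : ta < p) (p1 : 1 < p).
Hypotheses (la0 : 0 < la) (La0 : 0 < La).
Local Notation mu := (lebesgue_rV R n).
Variable (k : 'rV[R]_n -> 'rV[R]_n -> R) (H : 'rV[R]_n -> R -> R).

(* The only properties of a(x,y)/|x-y|^(n+sg) + b(x,y)/|x-y|^(n+ta) that the iteration
   uses, with H z r in the role of r^-sg + b(z,z) r^-ta. As [0 `^ (- q) = 0], the kernels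
   vanish on the diagonal. *)
Record phase_kernel : Prop := PhaseKernel {
  pk_meas : measurable_fun setT (fun z : 'rV[R]_n * 'rV[R]_n => k z.1 z.2) ;
  pk_ge0 : forall x y, 0 <= k x y ;
  pk_sym : forall x y, k x y = k y x ;
  pk_H0 : forall z r, 0 < r -> 0 < H z r ;
  pk_lb : forall z r x y, 0 < r -> r <= 1 -> eball z r x -> eball z r y ->
    la * H z r * r `^ sg * enorm (x - y) `^ (- (n%:R + sg)) <= k x y ;
  pk_ub : forall z r x y, 0 < r -> eball z r x -> eball z r y ->
    k x y <= La * H z r * r `^ ta * enorm (x - y) `^ (- (n%:R + ta)) ;
  pk_scale : forall z r c, 0 < r -> 1 <= c -> H z (c * r) <= c `^ (- sg) * H z r ;
  pk_scaleV : forall z r c, 0 < r -> 1 <= c -> H z r <= c `^ ta * H z (c * r) }.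

Hypothesis K : phase_kernel.

Let ta0 : 0 < ta. Proof. exact: lt_le_trans sgta. Qed.
Let p0 : 0 < p. Proof. exact: lt_trans p1. Qed.
Let pm1 : 0 <= p - 1. Proof. by rewrite subr_ge0 ltW. Qed.

Lemma measurable_kernelr x : measurable_fun setT (k x).
Proof. exact: (measurableT_comp (pk_meas K) (pair1_measurable x)). Qed.

(** Sum of a geometric series: on the ball of radius 2 r 2^(-i) around [x] the integrand |x - y|^p k
    contributes a multiple of 2^(-i (p - ta)), summable because [ta < p]. *)
Definition near_cst := La * 2 `^ p * 4 ^+ n / (1 - 2 `^ (ta - p)).

Lemma near_cst_ge0 : 0 <= near_cst.
Proof.
rewrite divr_ge0// ?mulr_ge0 ?exprn_ge0 ?powR_ge0 ?ltW//.
by rewrite subr_gt0 powR_gt1_lt1 ?ltr1n// subr_lt0.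
Qed.

Lemma near_integral_le (z : 'rV[R]_n) (r : R) x : 0 < r -> eball z r x ->
  (\int[mu]_(y in eball z r) (enorm (x - y) `^ p * k x y)%:E <=
   (near_cst * H z r * r `^ p)%:E)%E.
Proof.
move=> r0 zx.
pose E i := eball x (2 * r * 2^-1 ^+ i).
pose c i := La * H z r * r `^ ta * ((2 * r * 2^-1 ^+ i) `^ p
  * (r * 2^-1 ^+ i) `^ (- (n%:R + ta))).
have H0 := pk_H0 K z r0.
have h0 i : 0 < 2^-1 ^+ i :> R by rewrite exprn_gt0.
rewrite (_ : near_cst * H z r * r `^ p =
  (La * 2 `^ p * 4 ^+ n * H z r * r `^ p) / (1 - 2 `^ (ta - p))); last first.
  by rewrite /near_cst; ring.
apply: (@integral_dyadic_le _ _ _ _ _ _ E c).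
- by move=> i; exact: measurable_eball.
- by move=> i; rewrite /c !mulr_ge0 ?powR_ge0 ?ltW.
- by rewrite !mulr_ge0 ?powR_ge0 ?exprn_ge0 ?ltW.
- by rewrite powR_ge0/= powR_gt1_lt1 ?ltr1n// subr_lt0.
- move=> i; have ri0 : 0 < r * 2^-1 ^+ i by rewrite mulr_gt0.
  rewrite (le_trans (lee_wpmul2l _ (eball_vol_le _ _)))//.
  + by rewrite lee_fin /c !mulr_ge0 ?powR_ge0 ?ltW.
  + by rewrite !mulr_ge0 ?ltW.
  rewrite -EFinM lee_fin /c le_eqVlt; apply/orP; left; apply/eqP.
  rewrite (_ : 4 = 2 * 2); last by ring.
  have [lh ->] := expR_ex H0; have [lr ->] := expR_ex r0.
  have [lL ->] := expR_ex La0; have [l2 ->] := expR_ex (@ltr0n R 2).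
  rewrite ?(expR_inv, expR_exprn, expR_powR, =^~ expRD).
  by congr expR; ring.
- by move=> y _; rewrite lee_fin mulr_ge0 ?powR_ge0 ?pk_ge0.
- move=> y zy; have [->|xy] := eqVneq x y.
    by left; rewrite subrr enorm0 powR0 ?mul0r// gt_eqF.
  right; have d0 := enorm_gt0 xy.
  have d2 : enorm (x - y) < 2 * r.
    rewrite (le_lt_trans (ler_enormB _ z _))// (enormC z).
    by rewrite mulr_natl mulr2n ltrD.
  have [i /andP[di d2i]] := dyadic_small r0 d0 d2.
  exists i; first by rewrite /E /eball/= enormC.
  have ri0 : 0 < r * 2^-1 ^+ i by rewrite mulr_gt0.
  rewrite lee_fin mulrC (le_trans (ler_wpM2r (powR_ge0 _ _) (pk_ub K r0 zx zy)))//.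
  rewrite /c -[leLHS]mulrA; apply: ler_wpM2l.
    by rewrite !mulr_ge0 ?powR_ge0 ?ltW.
  rewrite mulrC; apply: ler_pM; rewrite ?powR_ge0//.
    by rewrite ge0_ler_powR ?nnegrE ?mulr_ge0 ?ltW.
  by rewrite le0_powR_le// addr_ge0// ltW.
Qed.

Definition far_cst := La * 8 `^ ta * 16 ^+ n / (1 - 2 `^ (- (sg / 2))).

Lemma far_cst_ge0 : 0 <= far_cst.
Proof.
rewrite divr_ge0// ?mulr_ge0 ?exprn_ge0 ?powR_ge0 ?ltW//.
by rewrite subr_gt0 powR_gt1_lt1// ?ltr1n// oppr_lt0 divr_gt0.
Qed.

(** On the ball of radius 2^(i+1) r the upper bound and [pk_scale] give a decay of order 2^(-i sg).
    Half of this exponent pays for the weight, the other half makes the series converge. The weight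
    will absorb the growth of [u] at larger scales. *)
Lemma far_integral_le (z : 'rV[R]_n) (r : R) x : 0 < r -> eball z (3 / 4 * r) x ->
  (\int[mu]_(y in ~` eball z r) (k x y * (enorm (y - z) / r) `^ (sg / 2))%:E <=
   (far_cst * H z r)%:E)%E.
Proof.
move=> r0 zx.
pose E i := eball z (2 ^+ i.+1 * r).
pose c i := La * ((2 ^+ i.+1) `^ (- sg) * H z r) * (2 ^+ i.+1 * r) `^ ta *
  (2 ^+ i * r / 4) `^ (- (n%:R + ta)) * (2 ^+ i.+1) `^ (sg / 2).
have H0 := pk_H0 K z r0.
have h0 i : 0 < 2 ^+ i :> R by rewrite exprn_gt0.
rewrite (_ : far_cst * H z r =
  (La * 8 `^ ta * 16 ^+ n * H z r) / (1 - 2 `^ (- (sg / 2)))); last first.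
  by rewrite /far_cst; ring.
apply: (@integral_dyadic_le _ _ _ _ _ _ E c).
- by move=> i; exact: measurable_eball.
- by move=> i; rewrite /c !mulr_ge0 ?powR_ge0 ?ltW.
- by rewrite !mulr_ge0 ?powR_ge0 ?exprn_ge0 ?ltW.
- by rewrite powR_ge0/= powR_gt1_lt1// ?ltr1n// oppr_lt0 divr_gt0.
- move=> i; have ri0 : 0 <= 2 ^+ i.+1 * r by rewrite mulr_ge0 ?ltW.
  rewrite (le_trans (lee_wpmul2l _ (eball_vol_le _ ri0)))//.
    by rewrite lee_fin /c !mulr_ge0 ?powR_ge0 ?ltW.
  rewrite -EFinM lee_fin /c.
  apply: (@le_trans _ _ (La * 8 `^ ta * 16 ^+ n * H z r * (2 `^ (- (sg / 2))) ^+ i.+1)).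
    rewrite le_eqVlt; apply/orP; left; apply/eqP.
    rewrite (_ : 8 = 2 * 2 * 2); last by ring.
    rewrite (_ : 16 = 2 * 2 * 2 * 2); last by ring.
    rewrite (_ : 4 = 2 * 2); last by ring.
    rewrite (_ : sg / 2 = sg * (1 / 2)); last by ring.
    have : (1 / 2 : R) + 1 / 2 = 1 by rewrite -splitr.
    move: (1 / 2 : R) => h hh.
    have [lh ->] := expR_ex H0; have [lr ->] := expR_ex r0.
    have [lL ->] := expR_ex La0; have [l2 ->] := expR_ex (@ltr0n R 2).
    rewrite ?(expR_inv, expR_exprn, expR_powR, =^~ expRD) -natr1.
    congr expR; have hE : h = 2^-1 by lra.
    by rewrite hE; field.
  rewrite exprS mulrCA ler_piMl ?mulr_ge0 ?exprn_ge0 ?powR_ge0 ?ltW//.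
  by rewrite powR_gt1_lt1// ?ltr1n// oppr_lt0 divr_gt0.
- by move=> y _; rewrite lee_fin mulr_ge0 ?powR_ge0 ?pk_ge0.
- move=> y; rewrite /setC/eball/= => /negP; rewrite -leNgt => zy; right.
  have [i /andP[di d2i]] := dyadic_large r0 zy.
  exists i => //.
  have i1 : 1 <= 2 ^+ i.+1 :> R by rewrite exprn_ege1// ler1n.
  have ri0 : 0 < 2 ^+ i.+1 * r by rewrite mulr_gt0.
  have xE : eball z (2 ^+ i.+1 * r) x.
    apply: subset_eballr zx; rewrite ler_wpM2r ?ltW//; lra.
  have q0 : 0 < 2 ^+ i * r / 4 by rewrite divr_gt0// mulr_gt0.
  (* Here [x] is within 3/4 r of the centre, while [y] is at distance at least 2^i r, and r is at
     most 2^i r. *)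
  have dxy : 2 ^+ i * r / 4 <= enorm (x - y).
    have := ler_enormB y x z; move: zx; rewrite /eball/= (enormC y x).
    have : r <= 2 ^+ i * r by rewrite ler_peMl ?exprn_ege1 ?ler1n// ltW.
    by move: di; set u := 2 ^+ i * r; lra.
  rewrite lee_fin; apply: ler_pM; rewrite ?pk_ge0 ?powR_ge0//.
    rewrite (le_trans (pk_ub K ri0 xE d2i))//; apply: ler_pM.
    + by rewrite !mulr_ge0 ?powR_ge0 ?(ltW La0)// ltW// pk_H0.
    + exact: powR_ge0.
    + rewrite ler_wpM2r ?powR_ge0// ler_wpM2l ?(ltW La0)//.
      by rewrite (pk_scale K).
    + by rewrite le0_powR_le// addr_ge0// ltW.
  rewrite ge0_ler_powR ?nnegrE ?divr_ge0 ?enorm_ge0 ?ltW//.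
  by rewrite ltr_pdivrMr.
Qed.

Definition posp (t : R) : R := Num.max t 0.

Lemma posp_ge0 t : 0 <= posp t. Proof. by rewrite /posp le_max lexx orbT. Qed.

Lemma posp_gt0 t : 0 < t -> posp t = t.
Proof. by move=> t0; rewrite /posp max_l// ltW. Qed.

Lemma posp_le0 t : t <= 0 -> posp t = 0.
Proof. by move=> t0; rewrite /posp max_r. Qed.

Lemma posp_ge t : t <= posp t. Proof. by rewrite /posp le_max lexx. Qed.

Lemma ler_posp t u : t <= u -> posp t <= posp u.
Proof. by move=> tu; rewrite /posp ge_max !le_max tu lexx orbT. Qed.

Lemma measurable_posp d (T : measurableType d) (v : T -> R) l :
  measurable_fun setT v -> measurable_fun setT (fun x => posp (v x - l)).
Proof. by move=> mv; apply: measurable_maxr => //; exact: measurable_funB. Qed.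

Lemma measurable_posp_powR d (T : measurableType d) (v : T -> R) l q :
  measurable_fun setT v -> measurable_fun setT (fun x => posp (v x - l) `^ q).
Proof.
move=> mv; apply: (measurableT_comp (measurable_powR _)).
exact: measurable_posp.
Qed.

Variable CE : R.
Hypothesis CE0 : 0 < CE.

(** The three radii: the cutoff is 1 inside [r1] and vanishes outside [r2], and [r3] separates the
    near from the far interactions. As a property of a function alone, it can be required of [v] and
    of [- v], and the iteration never returns to the equation. *)
Definition energy_ineq (v : 'rV[R]_n -> R) (z : 'rV[R]_n) (r3 : R) : Prop :=
  forall r1 r2 l, 0 < r1 -> r1 < r2 -> r2 < r3 ->
  (\int[mu]_(x in eball z r1) \int[mu]_(y in eball z r3)
     (if (v y <= l) && (l < v x) then
       (v x - v y) `^ (p - 1) * (v x - l) * k x y else 0)%:E <=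
   CE%:E * (\int[mu]_(x in eball z r3) ((posp (v x - l) `^ p)%:E *
        \int[mu]_(y in eball z r3) ((enorm (x - y) / (r2 - r1)) `^ p * k x y)%:E)
     + \int[mu]_(x in eball z r2) ((posp (v x - l))%:E *
        \int[mu]_(y in ~` eball z r3) (posp (v y - l) `^ (p - 1) * k x y)%:E)))%E.

Definition vlow : R := (2 / n%:R / 2) ^+ n.

Lemma vlow_gt0 : 0 < vlow.
Proof. by rewrite exprn_gt0// !divr_gt0// ltr0n. Qed.

(** Where the left side is nonzero, [t - l0] exceeds [l1 - l0]. Trading p - 1 of its powers for
    [l1 - l0] turns the linear excess of the tail term into the p-th power known at the previous
    level. *)
Lemma posp_truncation (l0 l1 : R) t : l0 < l1 ->
  posp (t - l1) <= posp (t - l0) `^ p * (l1 - l0) `^ (- (p - 1)).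
Proof.
move=> l01; have [tl1|tl1] := leP t l1.
  by rewrite posp_le0 ?subr_le0// mulr_ge0 ?powR_ge0.
rewrite !posp_gt0 ?subr_gt0//; last exact: lt_trans tl1.
have t0 : 0 < t - l0 by rewrite subr_gt0 (lt_trans l01).
have l0' : 0 < l1 - l0 by rewrite subr_gt0.
rewrite -(mulr_powRB1 (ltW t0) p0) -mulrA.
apply: (@le_trans _ _ ((t - l0) * 1)); first by rewrite mulr1 lerD2l lerN2 ltW.
rewrite ler_wpM2l ?(ltW t0)//.
rewrite powRN ler_pdivlMr ?powR_gt0// mul1r.
by apply: ge0_ler_powR; rewrite ?nnegrE ?(ltW t0) ?(ltW l0')// lerD2r ltW.
Qed.

Lemma level_vol_le (v : 'rV[R]_n -> R) (D : set 'rV[R]_n) (l0 l1 Y : R) :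
  measurable_fun setT v -> measurable D -> l0 < l1 ->
  (\int[mu]_(x in D) (posp (v x - l0) `^ p)%:E <= Y%:E)%E ->
  (mu (D `&` [set x | (l1 < v x)%R]) <= (Y * (l1 - l0) `^ (- p))%:E)%E.
Proof.
move=> mv mD l01 vY; have l0' : 0 < l1 - l0 by rewrite subr_gt0.
have := ge0_chebyshev mu mD (measurable_posp_powR l0 p mv)
  (powR_ge0 (l1 - l0) p) (fun x => powR_ge0 _ _).
move=> /le_trans/(_ vY) cheb.
rewrite EFinM powRN lee_pdivlMr ?powR_gt0// muleC (le_trans _ cheb)//.
rewrite lee_wpmul2l ?lee_fin ?powR_ge0// le_measure ?inE//.
- by apply: measurableI => //; exact: measurable_set_gt.
- apply: measurableI => //; rewrite -[X in measurable X]setTI.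
  apply: (measurable_fun_ler (measurable_cst _) (measurable_posp_powR _ _ mv)
   measurableT) => //.
move=> x [Dx /= l1v]; split => //=.
rewrite ge0_ler_powR ?nnegrE ?posp_ge0 ?ltW// (lt_le_trans _ (posp_ge _))//.
by rewrite ltrD2r.
Qed.

(** By Chebyshev the smallness of [Y] makes {v > l1} fill at most half of the guaranteed volume
    [vlow * t ^+ n] of the ball of radius [t] around [x]. On the rest v x - v y >= v x - l1 and the
    kernel is at least its value at distance [t]; this gives the inverted factor. The two summands
    multiplied by [CE] bound the near and the far term of the energy inequality. *)
Lemma de_giorgi_step (v : 'rV[R]_n -> R) (z : 'rV[R]_n)
    (rho r1 r2 r3 l0 l1 Y t Th : R) :
  measurable_fun setT v -> 0 < rho -> rho <= 1 ->
  0 < r1 -> r1 < r2 -> r2 < r3 -> r3 <= rho -> l0 < l1 -> 0 <= Y -> 0 <= Th ->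
  0 < t -> r1 + t <= r3 ->
  energy_ineq v z r3 ->
  (\int[mu]_(x in eball z r3) (posp (v x - l0) `^ p)%:E <= Y%:E)%E ->
  2 * (Y * (l1 - l0) `^ (- p)) <= vlow * t ^+ n ->
  {ae mu, forall x, eball z r2 x ->
    (\int[mu]_(y in ~` eball z r3) (posp (v y - l1) `^ (p - 1) * k x y)%:E
      <= Th%:E)%E} ->
  (\int[mu]_(x in eball z r1) (posp (v x - l1) `^ p)%:E <=
   ((la * H z rho * rho `^ sg * t `^ (- (n%:R + sg)) * (vlow * t ^+ n / 2))^-1 *
    (CE * (near_cst * H z rho * rho `^ p * (r2 - r1) `^ (- p) * Y +
           Th * (Y * (l1 - l0) `^ (- (p - 1))))))%:E)%E.
Proof.
move=> mv rho0 rho1 r10 r12 r23 r3rho l01 Y0 Th0 t0 r1t EI vY tY tail.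
have H0 := pk_H0 K z rho0.
have r30 : 0 < r3 by rewrite (lt_trans r10)// (lt_trans r12).
set cL := la * _ * _ * _ * _; set cR := CE * _.
have vl0 := vlow_gt0.
have nc0 := near_cst_ge0.
have cL0 : 0 < cL by rewrite /cL; pos_tac.
rewrite EFinM muleC lee_pdivlMr// muleC -integralZl_fin//; last 4 first.
- exact: measurable_eball.
- exact: measurable_posp_powR.
- by move=> x; exact: powR_ge0.
- exact: ltW.
have Fge0 x y : 0 <= (if (v y <= l1) && (l1 < v x) then
    (v x - v y) `^ (p - 1) * (v x - l1) * k x y else 0).
  case: ifPn => // /andP[vy vx].
  by rewrite !mulr_ge0 ?powR_ge0 ?pk_ge0// subr_ge0 ltW.
apply: (@le_trans _ _ (\int[mu]_(x in eball z r1) \int[mu]_(y in eball z r3)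
     (if (v y <= l1) && (l1 < v x) then
       (v x - v y) `^ (p - 1) * (v x - l1) * k x y else 0)%:E)%E).
  apply: ge0_le_integral_gen => x zx; first by rewrite lee_fin; pos_tac.
  have [vx|vx] := leP (v x) l1.
    rewrite posp_le0 ?subr_le0// powR0 ?gt_eqF// mulr0.
    by apply: integral_ge0 => y _; rewrite andbF.
  have vx0 : 0 < v x - l1 by rewrite subr_gt0.
  rewrite posp_gt0//.
  have xS : eball x t `<=` eball z r3.
    apply: subset_eball; rewrite (le_trans _ r1t)// lerD2r ltW//.
  have mS := measurable_set_le l1 mv; have mS' := measurable_set_gt l1 mv.
  have mB := measurable_eball x t.
  pose S := eball x t `&` [set y | v y <= l1].
  pose c := (v x - l1) `^ p * (la * H z rho * rho `^ sg * t `^ (- (n%:R + sg))).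
  have c0 : 0 <= c by rewrite /c; pos_tac.
  apply: (@le_trans _ _ (c%:E * mu S)%E); last first.
    apply: integral_ge_cst => //.
    - exact: measurableI.
    - by move=> y [/xS].
    - by move=> y _; have := Fge0 x y; rewrite vx andbT lee_fin.
    move=> y [xy /= vy]; rewrite vy lee_fin /c.
    rewrite -(mulr_powRB1 (ltW vx0) p0) [(v x - l1) * _]mulrC.
    apply: ler_pM; [pos_tac|pos_tac| |].
      rewrite ler_wpM2r ?(ltW vx0)//; apply: ge0_ler_powR; rewrite ?nnegrE//; lra.
    have zx' : eball z rho x by apply: subset_eballr zx; lra.
    have zy' : eball z rho y by apply: subset_eballr (xS _ xy).
    apply: le_trans (pk_lb K rho0 rho1 zx' zy').
    rewrite ler_wpM2l//; first by pos_tac.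
    have [xey|xney] := eqVneq x y; first by move: vy; rewrite -xey leNgt vx.
    apply: le0_powR_le; [exact: enorm_gt0| |pos_tac].
    by rewrite enormC ltW.
  rewrite (_ : cL * _ = c * (vlow * t ^+ n / 2)); last by rewrite /cL /c; ring.
  rewrite EFinM lee_wpmul2l ?lee_fin//.
  have muB := eball_vol_ge n0 x t0.
  have BE : eball x t = S `|` (eball x t `&` [set y | l1 < v y]).
    rewrite -setIUr -[LHS]setIT; congr (_ `&` _); apply/seteqP; split => //= y _.
    by have [|] := leP (v y) l1; [left|right].
  have muS : (mu (eball x t) <= mu S + mu (eball x t `&` [set y | l1 < v y]%R))%E.
    by rewrite {1}BE; apply: measureU2; exact: measurableI.
  have muL : (mu (eball x t `&` [set y | l1 < v y]%R) <=
      (Y * (l1 - l0) `^ (- p))%:E)%E.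
    apply: le_trans (level_vol_le mv (measurable_eball z r3) l01 vY).
    apply: le_measure; rewrite ?inE; [exact: measurableI| |].
      by apply: measurableI => //; exact: measurable_eball.
    exact: setSI.
  have := le_trans muB (le_trans muS (leeD2l _ muL)).
  rewrite -/vlow; have : (mu S < +oo)%E.
    apply: le_lt_trans (eball_vol_fin x t); apply: le_measure; rewrite ?inE//.
      exact: measurableI.
    exact: subIsetl.
  case: (mu S) => [m| |] //= _; rewrite ?lee_fin ?EFinD; lra.
apply: (le_trans (EI r1 r2 l1 r10 r12 r23)).
rewrite /cR EFinM lee_wpmul2l ?lee_fin ?(ltW CE0)// EFinD; apply: leeD.
  apply: (@le_trans _ _ (\int[mu]_(x in eball z r3)
    (near_cst * H z rho * rho `^ p * (r2 - r1) `^ (- p) *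
      posp (v x - l0) `^ p)%:E)%E).
    apply: ge0_le_integral_gen => x zx.
      rewrite mule_ge0 ?lee_fin ?powR_ge0//.
      by apply: integral_ge0 => y _; rewrite lee_fin mulr_ge0 ?powR_ge0 ?pk_ge0.
    rewrite mulrC EFinM; apply: lee_pmul; rewrite ?lee_fin ?powR_ge0//.
    - by apply: integral_ge0 => y _; rewrite lee_fin mulr_ge0 ?powR_ge0 ?pk_ge0.
    - apply: ge0_ler_powR; rewrite ?nnegrE ?posp_ge0 ?(ltW p0)//.
      by apply: ler_posp; lra.
    have zx' : eball z rho x by exact: subset_eballr zx.
    apply: (@le_trans _ _ (\int[mu]_(y in eball z rho)
        ((r2 - r1) `^ (- p) * (enorm (x - y) `^ p * k x y))%:E)%E).
      apply: ge0_subset_integral_gen.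
      - by move=> y _; rewrite lee_fin mulr_ge0 ?powR_ge0 ?pk_ge0.
      - by move=> y _; rewrite lee_fin !mulr_ge0 ?powR_ge0 ?pk_ge0.
      - exact: subset_eballr.
      move=> y _; rewrite powR_div ?enorm_ge0//; last by lra.
      by rewrite powRN lee_fin mulrA [_^-1 * _]mulrC.
    rewrite integralZl_fin//; last 4 first.
    - exact: measurable_eball.
    - apply: measurable_funM; last exact: measurable_kernelr.
      apply: (measurableT_comp (measurable_powR _)).
      by apply: measurable_enorm; exact: measurable_fun_subrV.
    - by move=> y; rewrite mulr_ge0 ?powR_ge0 ?pk_ge0.
    - exact: powR_ge0.
    rewrite mulrC EFinM lee_wpmul2l ?lee_fin ?powR_ge0//.
    exact: near_integral_le.
  rewrite integralZl_fin//; last 4 first.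
  - exact: measurable_eball.
  - exact: measurable_posp_powR.
  - by move=> y; exact: powR_ge0.
  - by pos_tac.
  by rewrite [leRHS]EFinM lee_wpmul2l// lee_fin; pos_tac.
apply: (@le_trans _ _ (\int[mu]_(x in eball z r2)
    ((Th * (l1 - l0) `^ (- (p - 1))) * posp (v x - l0) `^ p)%:E)%E).
  apply: ge0_ae_le_integral_gen.
  - move=> x _; rewrite mule_ge0 ?lee_fin ?posp_ge0//.
    by apply: integral_ge0 => y _; rewrite lee_fin mulr_ge0 ?powR_ge0 ?pk_ge0.
  - by move=> x _; rewrite lee_fin; pos_tac.
  apply: filterS tail => x tailx zx.
  rewrite -mulrA EFinM muleC; apply: lee_pmul; rewrite ?lee_fin ?posp_ge0//.
  - by apply: integral_ge0 => y _; rewrite lee_fin mulr_ge0 ?powR_ge0 ?pk_ge0.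
  - exact: tailx.
  by rewrite mulrC posp_truncation.
rewrite integralZl_fin//; last 4 first.
- exact: measurable_eball.
- exact: measurable_posp_powR.
- by move=> y; exact: powR_ge0.
- by pos_tac.
rewrite [X in (_ <= X%:E)%E](_ : _ = Th * (l1 - l0) `^ (- (p - 1)) * Y); last by ring.
rewrite [leRHS]EFinM lee_wpmul2l ?lee_fin//; first by pos_tac.
apply: le_trans vY; apply: ge0_subset_integral_gen => //.
- by move=> y _; rewrite lee_fin powR_ge0.
- by move=> y _; rewrite lee_fin powR_ge0.
- by apply: subset_eballr; exact: ltW.
Qed.

Lemma far_kernel_le (z : 'rV[R]_n) (rho e : R) x y : 0 < rho -> 0 < e ->
  eball z rho x -> eball z rho y -> e <= enorm (x - y) ->
  k x y <= La * H z rho * rho `^ ta * e `^ (- (n%:R + ta)).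
Proof.
move=> rho0 e0 zx zy exy; apply: le_trans (pk_ub K rho0 zx zy) _.
have H0 := pk_H0 K z rho0; rewrite ler_wpM2l//; first by pos_tac.
by apply: le0_powR_le => //; pos_tac.
Qed.

End kernel.

(** * De Giorgi iteration *)

Section iteration.
Context (R : realType) (n : nat).
Hypothesis n0 : (0 < n)%N.
Variables (sg ta p la La CE : R).
Hypotheses (sg0 : 0 < sg) (sgta : sg <= ta) (tap : ta < p) (p1 : 1 < p).
Hypotheses (la0 : 0 < la) (La0 : 0 < La) (CE0 : 0 < CE).
Local Notation mu := (lebesgue_rV R n).
Local Notation near_cst := (near_cst n ta p La).
Local Notation vlow := (vlow R n).

Let ta0 : 0 < ta. Proof. exact: lt_le_trans sgta. Qed.
Let p0 : 0 < p. Proof. exact: lt_trans p1. Qed.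
Let pm1 : 0 <= p - 1. Proof. by rewrite subr_ge0 ltW. Qed.

(** The radii of one step, with h = 2^(-j): the next one, the support of the cutoff, the current
    one. *)
Let de_giorgi_radii (rho h : R) : 0 < rho -> 0 < h -> h <= 1 ->
  [/\ 0 < rho / 4 + rho / 4 * (h / 2),
      rho / 4 + rho / 4 * (h / 2) < rho / 4 + 3 / 16 * rho * h,
      rho / 4 + 3 / 16 * rho * h < rho / 4 + rho / 4 * h,
      rho / 4 + rho / 4 * h <= rho / 2 &
      rho / 2 <= rho].
Proof.
move=> rho0 h0 h1; have rh0 : 0 < rho * h by exact: mulr_gt0.
have rh1 : rho * h <= rho by rewrite ler_piMr// ltW.
by split; lra.
Qed.

Let de_giorgi_levels (kap l h : R) : 0 < kap -> 0 < h -> h <= 1 ->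
  l + kap * (1 - h) < l + kap * (1 - h / 2) /\ l <= l + kap * (1 - h / 2).
Proof.
move=> kap0 h0 h1; have kh0 : 0 < kap * h by exact: mulr_gt0.
have kh1 : kap * h <= kap by rewrite ler_piMr// ltW.
by split; lra.
Qed.

(** Levels rise from [l] to [l + kap], radii fall to [rho / 4], and the integral of the p-th power
    of the excess is kept below [e0] kap^p rho^n q^j. Its limit is 0, so nothing exceeds the top
    level. *)
Lemma de_giorgi (A : R) : 0 <= A -> exists2 e0, 0 < e0 &
  forall (k : 'rV[R]_n -> 'rV[R]_n -> R) (H : 'rV[R]_n -> R -> R),
  phase_kernel sg ta la La k H -> forall (v : 'rV[R]_n -> R) (z : 'rV[R]_n) (rho l kap : R),
  measurable_fun setT v -> 0 < rho -> rho <= 1 -> 0 < kap ->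
  (forall r3, 0 < r3 -> r3 <= rho / 2 -> energy_ineq p k CE v z r3) ->
  {ae mu, forall x, eball z (rho / 2) x ->
    (\int[mu]_(y in ~` eball z rho) (posp (v y - l) `^ (p - 1) * k x y)%:E
      <= (A * H z rho * kap `^ (p - 1))%:E)%E} ->
  (\int[mu]_(x in eball z rho) (posp (v x - l) `^ p)%:E <=
    (e0 * kap `^ p * rho ^+ n)%:E)%E ->
  {ae mu, forall x, eball z (rho / 4) x -> v x <= l + kap}.
Proof.
move=> A0.
have vl0 := vlow_gt0 R n0; have nc0 := near_cst_ge0 n tap La0.
(* One step loses at most the factor [D] = 2^(n+ta+p) to the power j, and the shrinking radius gains
   si^(sg j); this [M] makes their product at most 1. *)
have [M ME] : exists x, x = 1 + (n%:R + ta + p) / sg by eexists.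
have M1 : 1 <= M by rewrite ME lerDl divr_ge0 ?(ltW sg0)//; pos_tac.
have [si siE] : exists x, x = 2 `^ (- M) by eexists.
have si0 : 0 < si by rewrite siE powR_gt0.
have si12 : si <= 2^-1.
  rewrite -powR_inv1// siE; apply: ler_powR; [exact: ler1n|by rewrite lerN2].
(* The ratio for which Chebyshev's bound follows the volume of the shrinking balls: [si ^+ n] for
   the volume, 2^(-p) for the halved gap between levels. *)
have [q qE] : exists x, x = si ^+ n * 2 `^ (- p) by eexists.
have q0 : 0 < q by rewrite qE; pos_tac.
have q12 : q <= 2^-1.
  rewrite qE -[leRHS]mul1r; apply: ler_pM; rewrite ?exprn_ge0 ?powR_ge0 ?(ltW si0)//.
    by rewrite exprn_ile1 ?(ltW si0)// (le_trans si12)// invf_le1 ?ler1n.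
  rewrite -powR_inv1//; apply: ler_powR; [exact: ler1n|by rewrite lerN2 ltW].
(* The given tail plus the shell between the current ball and [rho]: points of the shell are at
   distance at least rho 2^(-j) / 16 from the support of the cutoff. *)
have [CA CAE] : exists x, x = A + La * 16 `^ (n%:R + ta) * (2 ^+ n + vlow) by eexists.
have CA0 : 0 <= CA by rewrite CAE; pos_tac.
have [C3 C3E] : exists x, x = near_cst * 16 `^ p + CA * 2 `^ (p - 1) by eexists.
have C30 : 0 <= C3 by rewrite C3E; pos_tac.
have [C4 C4E] : exists x, x = 2 * CE * C3 / (la * vlow) by eexists.
have C40 : 0 <= C4 by rewrite C4E; pos_tac.
have e8 : 0 < 8^-1 :> R by rewrite invr_gt0.
(* The bound 1/8 keeps the balls of radius [t] around points of the next ball inside the current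
   one, as consecutive radii differ by rho 2^(-j) / 8; the other bound closes the recursion. *)
have [t0 /andP[t00 t08] t0C] := exists_small_powR C40 q0 sg0 e8.
(* With this value the volume condition of [de_giorgi_step] holds with equality at every step. *)
have [e0 e0E] : exists x, x = vlow * t0 ^+ n / (2 * 2 `^ p) by eexists.
have e00 : 0 < e0 by rewrite e0E; pos_tac.
have e0vl : e0 <= vlow.
  rewrite e0E -mulrA ler_piMr ?(ltW vl0)//.
  rewrite ler_pdivrMr ?mul1r; last by pos_tac.
  apply: (@le_trans _ _ 1); first by rewrite exprn_ile1 ?(ltW t00)//; lra.
  by have := @powR_ge1 R 2 p (ler1n _ _) (ltW p0); lra.
exists e0 => // k H K v z rho l kap mv rho0 rho1 kap0 EI tail vY.
have H0 := pk_H0 K z rho0.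
have [r rE] : exists f : nat -> R, forall j, f j = rho / 4 + rho / 4 * 2^-1 ^+ j by eexists.
have [lv lvE] : exists f : nat -> R, forall j, f j = l + kap * (1 - 2^-1 ^+ j) by eexists.
have [Y YE] : exists f : nat -> R, forall j, f j = e0 * kap `^ p * rho ^+ n * q ^+ j by eexists.
have h0 j : 0 < 2^-1 ^+ j :> R by rewrite exprn_gt0.
have h1 j : 2^-1 ^+ j <= 1 :> R by rewrite exprn_ile1// invf_le1 ?ler1n.
have hS j : 2^-1 ^+ j.+1 = 2^-1 ^+ j / 2 :> R by rewrite exprSr.
have P j : (\int[mu]_(x in eball z (r j)) (posp (v x - lv j) `^ p)%:E <= (Y j)%:E)%E.
  elim: j => [|j IHj].
    rewrite YE expr0 mulr1; apply: le_trans vY.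
    rewrite lvE expr0 subrr mulr0 addr0; apply: ge0_subset_integral_gen => //.
    - by move=> x _; rewrite lee_fin powR_ge0.
    - by move=> x _; rewrite lee_fin powR_ge0.
    - by apply: subset_eballr; rewrite rE expr0; lra.
  have [h hE] : exists x : R, x = 2^-1 ^+ j by eexists.
  have hj0 : 0 < h by rewrite hE.
  have hj1 : h <= 1 by rewrite hE.
  have [r2 r2E] : exists x : R, x = rho / 4 + 3 / 16 * rho * h by eexists.
  have [t tE] : exists x : R, x = rho * t0 * si ^+ j by eexists.
  have [Th ThE] : exists x : R, x = H z rho * kap `^ (p - 1) * CA * (2 `^ (n%:R + ta)) ^+ j by
    eexists.
  have t_gt0 : 0 < t by rewrite tE; pos_tac.
  have Y0 : 0 <= Y j by rewrite YE; pos_tac.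
  have rh0 : 0 < rho * h by exact: mulr_gt0.
  have Th0 : 0 <= Th by rewrite ThE; pos_tac.
  have rj : r j = rho / 4 + rho / 4 * h by rewrite rE hE.
  have rSj : r j.+1 = rho / 4 + rho / 4 * (h / 2) by rewrite rE hS hE.
  have lvj : lv j = l + kap * (1 - h) by rewrite lvE hE.
  have lvSj : lv j.+1 = l + kap * (1 - h / 2) by rewrite lvE hS hE.
  have kh0 : 0 < kap * h by exact: mulr_gt0.
  have [rad1 rad2 rad3 rad4 rad5] := de_giorgi_radii rho0 hj0 hj1.
  have [lev1 lev2] := de_giorgi_levels l kap0 hj0 hj1.
  have dl : lv j.+1 - lv j = kap * h / 2 by rewrite lvj lvSj; field.
  have dr : r2 - r j.+1 = rho * h / 16 by rewrite r2E rSj; field.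
  have st : (1 + 1) = 2 :> R by ring.
  have := @de_giorgi_step _ _ n0 _ _ _ _ _ sg0 sgta tap p1 la0 La0 _ _ K _ CE0 v z rho (r j.+1)
    r2 (r j) (lv j) (lv j.+1) (Y j) t Th
    mv rho0 rho1.
  rewrite dl dr; move=> /(_ _ _ _ _ _ Y0 Th0 t_gt0 _ _ IHj) step.
  have {step} : (\int[mu]_(x in eball z (r j.+1)) (posp (v x - lv j.+1) `^ p)%:E <=
   ((la * H z rho * rho `^ sg * t `^ (- (n%:R + sg)) * (vlow * t ^+ n / 2))^-1 *
    (CE * (near_cst * H z rho * rho `^ p * (rho * h / 16) `^ (- p) * Y j +
           Th * (Y j * (kap * h / 2) `^ (- (p - 1))))))%:E)%E.
    apply: step.
    - by rewrite rSj.
    - by rewrite rSj r2E.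
    - by rewrite rj r2E.
    - by rewrite rj (le_trans rad4).
    - by rewrite lvj lvSj.
    - have sih : si ^+ j <= h by rewrite hE lerXn2r ?nnegrE ?(ltW si0).
      have : t0 * si ^+ j <= 8^-1 * h by apply: ler_pM; rewrite ?(ltW t00)//; pos_tac.
      rewrite -(ler_pM2l rho0) mulrA -tE rj rSj => tle.
      rewrite (le_trans (lerD (lexx _) tle))// le_eqVlt; apply/orP; left; apply/eqP.
      by field.
    - by apply: EI; rewrite rj// (lt_trans rad1)// (lt_trans rad2).
    - rewrite le_eqVlt; apply/orP; left; apply/eqP.
      rewrite YE e0E tE qE hE.
      have [lk ->] := expR_ex kap0; have [lr ->] := expR_ex rho0.
      have [lt ->] := expR_ex t00; have [ls ->] := expR_ex si0.
      have [lv0 ->] := expR_ex vl0; have [l2 ->] := expR_ex (@ltr0n R 2).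
      rewrite ?(expR_inv, expR_exprn, expR_powR, =^~ expRD).
      by congr expR; ring.
    - apply: filterS tail => x tailx zx.
      have zx2 : eball z (rho / 2) x by apply: subset_eballr zx;
        rewrite r2E (le_trans (ltW rad3)).
      have zxr : eball z rho x by apply: subset_eballr zx2.
      have mf : measurable_fun setT
          (fun y => posp (v y - lv j.+1) `^ (p - 1) * k x y).
        by apply: measurable_funM; [exact: measurable_posp_powR|exact: (measurable_kernelr K)].
      have f0 y : 0 <= posp (v y - lv j.+1) `^ (p - 1) * k x y.
        by rewrite mulr_ge0 ?powR_ge0 ?(pk_ge0 K).
      have mB := measurable_eball z rho; have mBj := measurable_eball z (r j).
      have posl y : posp (v y - lv j.+1) `^ (p - 1) <= posp (v y - l) `^ (p - 1).
        apply: ge0_ler_powR; rewrite ?nnegrE ?posp_ge0//.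
        by apply: ler_posp; rewrite lerD2l lerN2 lvSj.
      apply: le_trans (ge0_integral_setU_le mu (measurableC mB)
        (measurableD mB mBj) mf f0 _) _.
        move=> y yj; have [yB|] := pselect (eball z rho y); last by left.
        by right.
      apply: (@le_trans _ _ ((A * H z rho * kap `^ (p - 1))%:E +
        (H z rho * kap `^ (p - 1) * (La * 16 `^ (n%:R + ta) * (2 ^+ n + vlow)) *
          (2 `^ (n%:R + ta)) ^+ j)%:E)%E); last first.
        rewrite -EFinD lee_fin ThE CAE.
        have : 1 <= (2 `^ (n%:R + ta)) ^+ j :> R.
          by rewrite exprn_ege1// powR_ge1 ?ler1n//; pos_tac.
        move: ((2 `^ (n%:R + ta)) ^+ j) => X X1.
        have : 0 <= A * H z rho * kap `^ (p - 1) by pos_tac.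
        move: (kap `^ (p - 1)) (La * _ * _) => u w AHu.
        rewrite [leRHS](_ : _ = A * H z rho * u * X + H z rho * u * w * X); last by ring.
        by rewrite lerD2r ler_peMr.
      apply: leeD.
        apply: le_trans (tailx zx2); apply: ge0_le_integral_gen => y _.
          by rewrite lee_fin.
        by rewrite lee_fin ler_wpM2r// (pk_ge0 K).
      have [c cE] : exists x : R, x = La * H z rho * rho `^ ta * (rho * h / 16) `^ (- (n%:R +
        ta)) by eexists.
      have c0 : 0 <= c by rewrite cE; pos_tac.
      (* Splitting according to whether the excess is below or above [kap] bounds its power p - 1 by
         [g], whose integral is controlled by the volume and by the hypothesis on the p-th power. *)
      pose g y := kap `^ (p - 1) + kap^-1 * posp (v y - l) `^ p.
      have g0 y : 0 <= g y by rewrite /g; pos_tac.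
      have mg1 : measurable_fun setT (fun y => kap^-1 * posp (v y - l) `^ p).
        by apply: measurable_funM => //; exact: measurable_posp_powR.
      have mg : measurable_fun setT g by exact: measurable_funD.
      apply: (@le_trans _ _ (\int[mu]_(y in eball z rho) (c * g y)%:E)%E).
        apply: ge0_subset_integral_gen.
        - by move=> y _; rewrite lee_fin.
        - by move=> y _; rewrite lee_fin mulr_ge0.
        - by move=> y [].
        move=> y [zy yj]; rewrite lee_fin mulrC; apply: ler_pM; rewrite ?(pk_ge0 K) ?powR_ge0//.
          rewrite cE; apply: (far_kernel_le sg0 sgta La0 K) => //; first by pos_tac.
          have := ler_enormB y x z; move: yj zx; rewrite /eball/= (enormC y x).
          move=> /negP; rewrite -leNgt => yj zx {}zy.
          rewrite -(lerD2r r2) (le_trans _ (le_trans yj _))//.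
            by rewrite rj r2E le_eqVlt; apply/orP; left; apply/eqP; field.
          by rewrite (le_trans zy)// lerD2l ltW.
        apply: le_trans (posl y) _; rewrite /g.
        have [pk|pk] := leP (posp (v y - l)) kap.
          rewrite -[leLHS]addr0 lerD//; last by pos_tac.
          by apply: ge0_ler_powR; rewrite ?nnegrE ?posp_ge0 ?(ltW kap0).
        rewrite -(mulr_powRB1 (posp_ge0 _) p0) -[leLHS]add0r lerD ?powR_ge0//.
        by rewrite mulrA ler_peMl ?powR_ge0// mulrC ler_pdivlMr// mul1r ltW.
      rewrite integralZl_fin//.
      apply: (@le_trans _ _ (c%:E * (kap `^ (p - 1) * (2 ^+ n * rho ^+ n) +
          kap^-1 * (e0 * kap `^ p * rho ^+ n))%:E)%E).
        rewrite lee_wpmul2l ?lee_fin//; under eq_integral do rewrite EFinD.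
        rewrite ge0_integralD//; last 3 first.
        - by move=> y _; rewrite lee_fin powR_ge0.
        - by move=> y _; rewrite lee_fin mulr_ge0 ?powR_ge0// invr_ge0 ltW.
        - by apply/measurable_EFinP; exact: measurable_funTS.
        rewrite EFinD; apply: leeD.
          rewrite integral_cst// EFinM lee_wpmul2l ?lee_fin ?powR_ge0//.
          by apply: eball_vol_le; exact: ltW.
        rewrite integralZl_fin//; last 3 first.
        - exact: measurable_posp_powR.
        - by move=> y; exact: powR_ge0.
        - by rewrite invr_ge0 ltW.
        by rewrite [leRHS]EFinM lee_wpmul2l// lee_fin invr_ge0 ltW.
      rewrite -EFinM lee_fin.
      apply: (@le_trans _ _ (H z rho * kap `^ (p - 1) *
          (La * 16 `^ (n%:R + ta) * (2 ^+ n + e0)) * (2 `^ (n%:R + ta)) ^+ j)).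
        rewrite le_eqVlt; apply/orP; left; apply/eqP.
        rewrite mulrDr mulrDr [X in _ = X * _]mulrDr [RHS]mulrDl cE hE.
        rewrite (_ : 16 = 2 * 2 * 2 * 2); last by ring.
        have [lh ->] := expR_ex H0.
        have [lk ->] := expR_ex kap0; have [lr ->] := expR_ex rho0.
        have [le0 ->] := expR_ex e00; have [lL ->] := expR_ex La0.
        have [l2 ->] := expR_ex (@ltr0n R 2).
        rewrite ?(expR_inv, expR_exprn, expR_powR, =^~ expRD).
        by congr (_ + _); congr expR; ring.
      rewrite ler_wpM2r ?exprn_ge0 ?powR_ge0// ler_wpM2l//; first by pos_tac.
      by rewrite ler_wpM2l ?lerD2l//; pos_tac.
  move=> /le_trans; apply; rewrite lee_fin.
  have E1 : rho `^ p * (rho * h / 16) `^ (- p) = 16 `^ p * (2 `^ p) ^+ j.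
    rewrite hE (_ : 16 = 2 * 2 * 2 * 2); last by ring.
    have [lr ->] := expR_ex rho0; have [l2 ->] := expR_ex (@ltr0n R 2).
    rewrite ?(expR_inv, expR_exprn, expR_powR, =^~ expRD).
    by congr expR; ring.
  have E2 : kap `^ (p - 1) * (kap * h / 2) `^ (- (p - 1)) =
      2 `^ (p - 1) * (2 `^ (p - 1)) ^+ j.
    rewrite hE; have [lr ->] := expR_ex kap0; have [l2 ->] := expR_ex (@ltr0n R 2).
    rewrite ?(expR_inv, expR_exprn, expR_powR, =^~ expRD).
    by congr expR; ring.
  have E3 : (la * H z rho * rho `^ sg * t `^ (- (n%:R + sg)) * (vlow * t ^+ n / 2))^-1 =
      2 / (la * vlow * H z rho) * t0 `^ sg * (si `^ sg) ^+ j.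
    rewrite tE; have [lh ->] := expR_ex H0.
    have [lr ->] := expR_ex rho0; have [lt ->] := expR_ex t00.
    have [ls ->] := expR_ex si0.
    have [ll ->] := expR_ex la0; have [lv0 ->] := expR_ex vl0.
    have [l2 ->] := expR_ex (@ltr0n R 2).
    rewrite ?(expR_inv, expR_exprn, expR_powR, =^~ expRD).
    by congr expR; ring.
  have [D DE] : exists x : R, x = 2 `^ (n%:R + ta + p) by eexists.
  have D0 : 0 < D by rewrite DE powR_gt0.
  have le2 a b : a <= b -> 2 `^ a ^+ j <= 2 `^ b ^+ j :> R.
    by move=> ab; rewrite lerXn2r ?nnegrE ?powR_ge0// ler_powR ?ler1n.
  have L1 : near_cst * H z rho * rho `^ p * (rho * h / 16) `^ (- p) * Y j <=
      H z rho * Y j * (near_cst * 16 `^ p) * D ^+ j.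
    rewrite -[near_cst * _ * _ * _]mulrA E1.
    rewrite [leLHS](_ : _ = H z rho * Y j * (near_cst * 16 `^ p) * (2 `^ p) ^+ j);
      last by ring.
    rewrite ler_wpM2l//; first by pos_tac.
    by rewrite DE; apply: le2; rewrite lerDr; pos_tac.
  have L2 : Th * (Y j * (kap * h / 2) `^ (- (p - 1))) <=
      H z rho * Y j * (CA * 2 `^ (p - 1)) * D ^+ j.
    rewrite ThE [leLHS](_ : _ = H z rho * Y j * CA * (2 `^ (n%:R + ta)) ^+ j *
      (kap `^ (p - 1) * (kap * h / 2) `^ (- (p - 1)))); last by ring.
    rewrite E2 [leLHS](_ : _ = H z rho * Y j * (CA * 2 `^ (p - 1)) *
      ((2 `^ (n%:R + ta)) ^+ j * (2 `^ (p - 1)) ^+ j)); last by ring.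
    rewrite ler_wpM2l//; first by pos_tac.
    by rewrite -exprMn -powRDg// DE; apply: le2; rewrite addrA lerBlDr lerDl.
  (* The gain from the radius beats all the losses of step j; this is where the value of [M] is
     used. *)
  have siD : (si `^ sg) ^+ j * D ^+ j <= 1.
    rewrite -exprMn exprn_ile1//; first by pos_tac.
    rewrite siE DE -powRrM -powRDg// -[leRHS](powRr0 2) ler_powR ?ler1n//.
    have -> : - M * sg = - (sg + (n%:R + ta + p)) by rewrite ME; field; rewrite gt_eqF.
    by rewrite opprD -addrA addNr addr0 oppr_le0 ltW.
  rewrite E3.
  apply: (@le_trans _ _ (2 / (la * vlow * H z rho) * t0 `^ sg * (si `^ sg) ^+ j *
     (CE * (H z rho * Y j * C3 * D ^+ j)))).
    rewrite ler_wpM2l//; first by pos_tac.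
    rewrite ler_wpM2l ?(ltW CE0)//.
    by rewrite C3E mulrDr mulrDl lerD.
  rewrite [leLHS](_ : _ = Y j * (C4 * t0 `^ sg) * ((si `^ sg) ^+ j * D ^+ j)); last first.
    by rewrite C4E; field; rewrite !gt_eqF.
  have -> : Y j.+1 = Y j * q by rewrite !YE exprSr mulrA.
  apply: (@le_trans _ _ (Y j * (C4 * t0 `^ sg))).
    by rewrite ler_piMr//; pos_tac.
  by rewrite ler_wpM2l.
have {}P : (\int[mu]_(x in eball z (rho / 4)) (posp (v x - (l + kap)) `^ p)%:E = 0)%E.
  apply/eqP; rewrite eq_le; apply/andP; split; last first.
    by apply: integral_ge0 => x _; rewrite lee_fin powR_ge0.
  have {}P j : (\int[mu]_(x in eball z (rho / 4)) (posp (v x - (l + kap)) `^ p)%:E <=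
      (Y j)%:E)%E.
    apply: le_trans (P j); apply: ge0_subset_integral_gen.
    - by move=> x _; rewrite lee_fin powR_ge0.
    - by move=> x _; rewrite lee_fin powR_ge0.
    - by apply: subset_eballr; rewrite rE lerDl; pos_tac.
    move=> x _; rewrite lee_fin; apply: ge0_ler_powR; rewrite ?nnegrE ?posp_ge0//.
      exact: ltW.
    by apply: ler_posp; rewrite lvE; have := h0 j; nra.
  move: P; case: (integral _ _ _) => [I| |] P; last by rewrite leNye.
    rewrite lee_fin; apply: (@geometric_le0 _ (e0 * kap `^ p * rho ^+ n) q) => //.
      exact: ltW.
    by move=> j; rewrite -YE -lee_fin.
  by have := P 0%N; rewrite leye_eq.
have := integral_eq0_ae (measurable_eball z (rho / 4))
  (measurable_posp_powR (l + kap) p mv) (fun x => powR_ge0 _ _) P.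
apply: filterS => x /[apply] /powR_eq0_eq0 vx.
by rewrite -subr_le0 (le_trans (posp_ge _))// vx.
Qed.

(** * Decrease of the supremum when the low set has positive density *)

Let growth_radii (rho : R) : 0 < rho ->
  [/\ rho / 2 < 5 / 8 * rho, 5 / 8 * rho <= 3 / 4 * rho, 3 / 4 * rho < rho,
      rho / 2 / 2 <= 3 / 4 * rho & rho / 2 <= rho].
Proof. by move=> rho0; split; lra. Qed.

Let growth_gap (M om d x y : R) : d <= om / 2 -> M - d < x -> y <= M - om ->
  om / 2 <= x - y.
Proof. by lra. Qed.

Let growth_near (z x y : 'rV[R]_n) (rho : R) : eball z (rho / 2) x -> eball z (rho / 2) y ->
  enorm (x - y) <= rho.
Proof. by rewrite /eball/=; have := ler_enormB x z y; rewrite (enormC z); lra. Qed.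

Let growth_far (z x y : 'rV[R]_n) (rho : R) : eball z (rho / 2 / 2) x ->
  ~ eball z (rho / 2) y -> rho / 4 <= enorm (x - y).
Proof.
move=> + /negP; rewrite /eball/= -leNgt; have := ler_enormB y x z.
by rewrite (enormC y x); lra.
Qed.

(* Only the nonlocal cross term of the energy inequality is used to make the set
   where v is close to M small; no logarithmic estimate is needed. *)
Lemma growth (A : R) : 0 <= A -> exists2 de, 0 < de <= 2^-1 &
  forall (k : 'rV[R]_n -> 'rV[R]_n -> R) (H : 'rV[R]_n -> R -> R),
  phase_kernel sg ta la La k H -> forall (v : 'rV[R]_n -> R) (z : 'rV[R]_n) (rho M om : R),
  measurable_fun setT v -> 0 < rho -> rho <= 1 -> 0 < om ->
  (forall r3, 0 < r3 -> r3 <= rho -> energy_ineq p k CE v z r3) ->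
  {ae mu, forall x, eball z rho x -> v x <= M} ->
  ((vlow / 2 * (rho / 2) ^+ n)%:E <=
    mu (eball z (rho / 2) `&` [set x | (v x <= M - om)%R]))%E ->
  {ae mu, forall x, eball z (3 / 4 * rho) x ->
    (\int[mu]_(y in ~` eball z rho)
       (posp (v y - (M - de * om)) `^ (p - 1) * k x y)%:E
      <= (A * H z rho * (de * om) `^ (p - 1))%:E)%E} ->
  {ae mu, forall x, eball z (rho / 8) x -> v x <= M - de * om / 2}.
Proof.
move=> A0; have vl0 := vlow_gt0 R n0; have nc0 := near_cst_ge0 n tap La0.
(* Tail constant for the half ball: the shell between [rho / 2] and [rho] is added to [A], and
   2^(p-1) appears because [de_giorgi] is run with [kap = de * om / 2]. *)
have [A' A'E] : exists x, x = 2 `^ (p - 1) * (La * 4 `^ (n%:R + ta) * 2 ^+ n + A).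
  by eexists.
have A'0 : 0 <= A' by rewrite A'E; pos_tac.
have [e0 e00 DG] := de_giorgi A'0.
have [C5 C5E] : exists x, x = CE * 2 ^+ n * (near_cst * 8 `^ p + A) /
   (2 `^ (- (p - 1)) * la * vlow / 2 / 2 ^+ n) by eexists.
have C50 : 0 <= C5 by rewrite C5E; pos_tac.
have q0 : 0 < e0 / (2 `^ p * 2 ^+ n) by pos_tac.
have p10 : 0 < p - 1 by rewrite subr_gt0.
have h20 : 0 < 2^-1 :> R by rewrite invr_gt0.
(* The energy estimate bounds the integral of the p-th power of the excess by [C5] de^(p-1) times
   (de om)^p rho^n, so a small [de] meets the smallness required by [de_giorgi]. *)
have [de /andP[de0 de2] deC] := exists_small_powR C50 q0 p10 h20.
exists de; first by rewrite de0 de2.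
move=> k H K v z rho M om mv rho0 rho1 om0 EI vM vol tail.
have H0 := pk_H0 K z rho0.
have dom0 : 0 < de * om by exact: mulr_gt0.
have om20 : 0 < om / 2 by rewrite divr_gt0.
have [l lE] : exists x, x = M - de * om by eexists.
have domom : de * om <= om / 2.
  by rewrite mulrC ler_wpM2l// ltW.
have Moml : M - om <= l by rewrite lE lerD2l lerN2 (le_trans domom)// ler_piMr ?(ltW om0)//
  invf_le1 ?ler1n.
have wle : {ae mu, forall x, eball z rho x -> posp (v x - l) <= de * om}.
  apply: filterS vM => x vM zx; rewrite /posp ge_max (ltW dom0) andbT.
  by rewrite lE opprB addrCA gerDl subr_le0 vM.
have [r12 r58 r34 r14 r2rho] := growth_radii rho0.
have r23 : 5 / 8 * rho < rho by exact: le_lt_trans r34.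
have r2 : 0 < rho / 2 by rewrite divr_gt0.
have [cG cGE] : exists x, x = (om / 2) `^ (p - 1) *
   (la * H z rho * rho `^ sg * rho `^ (- (n%:R + sg))) *
   (vlow / 2 * (rho / 2) ^+ n) by eexists.
have cG0 : 0 < cG by rewrite cGE; pos_tac.
have Fge0 x y : 0 <= (if (v y <= l) && (l < v x) then
    (v x - v y) `^ (p - 1) * (v x - l) * k x y else 0).
  case: ifPn => // /andP[vy vx].
  by rewrite !mulr_ge0 ?powR_ge0 ?(pk_ge0 K)// subr_ge0 ltW.
have mB s : measurable (eball z s) := measurable_eball z s.
(* Since [de <= 1/2], a point above [l] and a point of the low set differ by at least [om / 2]. The
   coefficient thus carries om^(p-1) without any power of [de]. *)
have lower : ((cG%:E * \int[mu]_(x in eball z (rho / 2)) (posp (v x - l))%:E) <=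
   \int[mu]_(x in eball z (rho / 2)) \int[mu]_(y in eball z rho)
     (if (v y <= l) && (l < v x) then
       (v x - v y) `^ (p - 1) * (v x - l) * k x y else 0)%:E)%E.
  rewrite -integralZl_fin//; last 3 first.
  - exact: measurable_posp.
  - by move=> x; exact: posp_ge0.
  - exact: ltW.
  apply: ge0_le_integral_gen => x zx.
    by rewrite lee_fin mulr_ge0 ?posp_ge0// ltW.
  have [vx|vx] := leP (v x) l.
    rewrite posp_le0 ?subr_le0// mulr0.
    by apply: integral_ge0 => y _; rewrite andbF.
  have vx0 : 0 < v x - l by rewrite subr_gt0.
  rewrite posp_gt0//.
  pose S := eball z (rho / 2) `&` [set y | v y <= M - om].
  pose c := (om / 2) `^ (p - 1) * (v x - l) *
    (la * H z rho * rho `^ sg * rho `^ (- (n%:R + sg))).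
  have c0 : 0 <= c.
    rewrite /c; apply: mulr_ge0; last by pos_tac.
    by apply: mulr_ge0; [exact: powR_ge0|exact: ltW].
  apply: (@le_trans _ _ (c%:E * mu S)%E); last first.
    apply: integral_ge_cst => //.
    - apply: measurableI => //; exact: measurable_set_le.
    - by move=> y [zy _]; exact: subset_eballr zy.
    - by move=> y _; have := Fge0 x y; rewrite vx andbT lee_fin.
    move=> y [zy /= vy]; rewrite (le_trans vy Moml) lee_fin /c.
    have ovxy : om / 2 <= v x - v y by apply: growth_gap domom _ vy; rewrite -lE.
    apply: ler_pM.
    - by apply: mulr_ge0; [exact: powR_ge0|exact: ltW].
    - by pos_tac.
    - rewrite ler_wpM2r ?(ltW vx0)//; apply: ge0_ler_powR => //;
        rewrite nnegrE; first exact: ltW.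
      by apply: le_trans ovxy; exact: ltW.
    have zx' : eball z rho x by exact: subset_eballr zx.
    have zy' : eball z rho y by exact: subset_eballr zy.
    apply: le_trans (pk_lb K rho0 rho1 zx' zy').
    rewrite ler_wpM2l//; first by pos_tac.
    have [xey|xney] := eqVneq x y.
      by exfalso; move: ovxy; rewrite xey subrr leNgt divr_gt0.
    apply: le0_powR_le; [exact: enorm_gt0| |pos_tac].
    exact: growth_near zx zy.
  rewrite (_ : cG * _ = c * (vlow / 2 * (rho / 2) ^+ n)); last by rewrite cGE /c; ring.
  by rewrite EFinM lee_wpmul2l ?lee_fin.
(* The excess over [l] is at most [de * om] almost everywhere, so both terms on the right of the
   energy inequality are of order (de om)^p. *)
have upper : (\int[mu]_(x in eball z (rho / 2)) \int[mu]_(y in eball z rho)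
     (if (v y <= l) && (l < v x) then
       (v x - v y) `^ (p - 1) * (v x - l) * k x y else 0)%:E <=
   (CE * ((de * om) `^ p * H z rho * (near_cst * 8 `^ p + A) * (2 ^+ n * rho ^+ n)))%:E)%E.
  apply: (le_trans (EI rho rho0 (lexx _) (rho / 2) (5 / 8 * rho) l r2 r12 r23)).
  rewrite EFinM lee_wpmul2l ?lee_fin ?(ltW CE0)//.
  rewrite mulrDr mulrDl EFinD; apply: leeD.
    apply: (@le_trans _ _ (\int[mu]_(x in eball z rho)
      ((de * om) `^ p * H z rho * (near_cst * 8 `^ p))%:E)%E); last first.
      rewrite integral_cst// [leRHS]EFinM lee_wpmul2l ?lee_fin//; first by pos_tac.
      by apply: eball_vol_le; exact: ltW.
    apply: ge0_ae_le_integral_gen.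
    - move=> x _; rewrite mule_ge0 ?lee_fin ?powR_ge0//.
      by apply: integral_ge0 => y _; rewrite lee_fin mulr_ge0 ?powR_ge0 ?(pk_ge0 K).
    - by move=> x _; rewrite lee_fin; pos_tac.
    apply: filterS wle => x wle zx.
    rewrite -[X in (_ <= X%:E)%E]mulrA EFinM; apply: lee_pmul; rewrite ?lee_fin ?powR_ge0//.
    - by apply: integral_ge0 => y _; rewrite lee_fin mulr_ge0 ?powR_ge0 ?(pk_ge0 K).
    - by apply: ge0_ler_powR; rewrite ?nnegrE ?posp_ge0 ?(ltW p0) ?(ltW dom0) ?wle.
    have -> : 5 / 8 * rho - rho / 2 = rho / 8 by field.
    apply: (@le_trans _ _ (\int[mu]_(y in eball z rho)
        ((rho / 8) `^ (- p) * (enorm (x - y) `^ p * k x y))%:E)%E).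
      apply: ge0_le_integral_gen => y _.
        by rewrite lee_fin mulr_ge0 ?powR_ge0 ?(pk_ge0 K).
      have r80 : 0 <= rho / 8 by rewrite divr_ge0 ?(ltW rho0).
      rewrite [(enorm _ / _) `^ p]powR_div ?enorm_ge0//.
      by rewrite powRN lee_fin mulrA [_^-1 * _]mulrC.
    rewrite integralZl_fin//; last 3 first.
    - apply: measurable_funM; last exact: (measurable_kernelr K).
      apply: (measurableT_comp (measurable_powR _)).
      by apply: measurable_enorm; exact: measurable_fun_subrV.
    - by move=> y; rewrite mulr_ge0 ?powR_ge0 ?(pk_ge0 K).
    - exact: powR_ge0.
    apply: (le_trans (lee_wpmul2l _ (near_integral_le sg0 sgta tap p1 La0 K rho0 zx))).
      by rewrite lee_fin powR_ge0.
    rewrite -EFinM lee_fin le_eqVlt; apply/orP; left; apply/eqP.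
    have -> : (rho / 8) `^ (- p) = rho `^ (- p) * 8 `^ p.
      have [lr ->] := expR_ex rho0; have [l8 ->] := expR_ex (@ltr0n R 8).
      rewrite ?(expR_inv, expR_exprn, expR_powR, =^~ expRD).
      by congr expR; ring.
    rewrite [LHS](_ : _ = (rho `^ (- p) * rho `^ p) * (H z rho * (near_cst * 8 `^ p)));
      last by ring.
    by rewrite powRNM// mul1r.
  apply: (@le_trans _ _ (\int[mu]_(x in eball z (5 / 8 * rho))
      ((de * om) `^ p * H z rho * A)%:E)%E); last first.
    rewrite integral_cst// [leRHS]EFinM lee_wpmul2l ?lee_fin//; first by pos_tac.
    apply: (@le_trans _ _ (mu (eball z rho))).
      by apply: le_measure; rewrite ?inE//; apply: subset_eballr; exact: ltW.
    by apply: eball_vol_le; exact: ltW.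
  apply: ge0_ae_le_integral_gen.
  - move=> x _; rewrite mule_ge0 ?lee_fin ?posp_ge0//.
    by apply: integral_ge0 => y _; rewrite lee_fin mulr_ge0 ?powR_ge0 ?(pk_ge0 K).
  - by move=> x _; rewrite lee_fin; pos_tac.
  apply: filterS2 wle tail => x wle tailx zx.
  have zx1 : eball z rho x by apply: subset_eballr zx; exact: ltW.
  have zx2 : eball z (3 / 4 * rho) x by exact: subset_eballr zx.
  rewrite -(mulr_powRB1 (ltW dom0) p0).
  rewrite (_ : _ * _ * A = (de * om) * (A * H z rho * (de * om) `^ (p - 1))); last by ring.
  rewrite EFinM; apply: lee_pmul; rewrite ?lee_fin ?posp_ge0 ?wle//.
    by apply: integral_ge0 => y _; rewrite lee_fin mulr_ge0 ?powR_ge0 ?(pk_ge0 K).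
  by rewrite lE; exact: tailx.
have mwp := measurable_posp_powR l p mv.
have small : (\int[mu]_(x in eball z (rho / 2)) (posp (v x - l) `^ p)%:E <=
    (e0 * (de * om / 2) `^ p * (rho / 2) ^+ n)%:E)%E.
  apply: (@le_trans _ _ (\int[mu]_(x in eball z (rho / 2))
     ((de * om) `^ (p - 1) * posp (v x - l))%:E)%E).
    apply: ge0_ae_le_integral_gen.
    - by move=> x _; rewrite lee_fin powR_ge0.
    - by move=> x _; rewrite lee_fin mulr_ge0 ?powR_ge0 ?posp_ge0.
    apply: filterS wle => x wle zx; rewrite lee_fin -(mulr_powRB1 (posp_ge0 _) p0).
    rewrite mulrC ler_wpM2r ?posp_ge0//; apply: ge0_ler_powR => //.
    - by rewrite nnegrE posp_ge0.
    - by rewrite nnegrE ltW.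
    by apply: wle; exact: subset_eballr zx.
  rewrite integralZl_fin//; last 3 first.
  - exact: measurable_posp.
  - by move=> x; exact: posp_ge0.
  - exact: powR_ge0.
  have := le_trans lower upper; rewrite muleC -lee_pdivlMr// => W.
  apply: (le_trans (lee_wpmul2l _ W)); first by rewrite lee_fin powR_ge0.
  rewrite -!EFinM lee_fin.
  have E : (de * om) `^ (p - 1) *
    (CE * ((de * om) `^ p * H z rho * (near_cst * 8 `^ p + A) * (2 ^+ n * rho ^+ n)) / cG) =
    (C5 * de `^ (p - 1)) * ((de * om) `^ p * rho ^+ n).
    rewrite [LHS](_ : _ = (CE * 2 ^+ n * (near_cst * 8 `^ p + A)) *
      ((de * om) `^ (p - 1) * (de * om) `^ p * H z rho * rho ^+ n / cG)); last by ring.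
    rewrite C5E -[X in _ = X]mulrA -[X in _ = X]mulrA; congr (_ * _).
    rewrite cGE; have [lh ->] := expR_ex H0.
    have [lr ->] := expR_ex rho0; have [lo ->] := expR_ex om0.
    have [ld ->] := expR_ex de0; have [ll ->] := expR_ex la0.
    have [lv ->] := expR_ex vl0; have [l2 ->] := expR_ex (@ltr0n R 2).
    rewrite ?(expR_inv, expR_exprn, expR_powR, =^~ expRD).
    by congr expR; ring.
  rewrite E; have E' : e0 * (de * om / 2) `^ p * (rho / 2) ^+ n =
     e0 / (2 `^ p * 2 ^+ n) * ((de * om) `^ p * rho ^+ n).
    rewrite powR_div ?(ltW dom0)// expr_div_n; field.
    by rewrite !gt_eqF ?exprn_gt0 ?powR_gt0.
  by rewrite E' ler_wpM2r//; pos_tac.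
have dkap0 : 0 < de * om / 2 by rewrite divr_gt0.
have rho21 : rho / 2 <= 1 by exact: le_trans rho1.
(* De Giorgi on the half ball, from the level [M - de * om] up by half of [de * om]; a quarter of
   the radius [rho / 2] is [rho / 8]. *)
have := DG k H K v z (rho / 2) l (de * om / 2) mv r2 rho21 dkap0.
have -> : rho / 2 / 4 = rho / 8 by field.
have -> : l + de * om / 2 = M - de * om / 2 by rewrite lE; field.
apply => //.
  by move=> r3 r30 r3r; apply: EI r30 _; apply: (le_trans r3r); apply: le_trans r2rho;
    rewrite ler_piMr ?(ltW r2)// invf_le1 ?ler1n.
apply: filterS tail => x tailx zx.
have zx2 : eball z (3 / 4 * rho) x by exact: subset_eballr zx.
have zx1 : eball z rho x by apply: subset_eballr zx2; exact: ltW.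
have mf : measurable_fun setT (fun y => posp (v y - l) `^ (p - 1) * k x y).
  by apply: measurable_funM; [exact: measurable_posp_powR|exact: (measurable_kernelr K)].
have f0 y : 0 <= posp (v y - l) `^ (p - 1) * k x y.
  by rewrite mulr_ge0 ?powR_ge0 ?(pk_ge0 K).
apply: le_trans (ge0_integral_setU_le mu (measurableC (mB rho))
  (measurableD (mB rho) (mB (rho / 2))) mf f0 _) _.
  move=> y yj; have [yB|] := pselect (eball z rho y); last by left.
  by right.
apply: (@le_trans _ _ ((A * H z rho * (de * om) `^ (p - 1))%:E +
    (La * H z rho * rho `^ ta * (rho / 4) `^ (- (n%:R + ta)) *
      (de * om) `^ (p - 1) * (2 ^+ n * rho ^+ n))%:E)%E).
  apply: leeD; first by rewrite lE; exact: tailx.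
  pose c := La * H z rho * rho `^ ta * (rho / 4) `^ (- (n%:R + ta)) *
      (de * om) `^ (p - 1).
  apply: (@le_trans _ _ (\int[mu]_(y in eball z rho `\` eball z (rho / 2)) c%:E)%E).
    apply: ge0_ae_le_integral_gen.
    - by move=> y _; rewrite lee_fin.
    - by move=> y _; rewrite lee_fin /c; pos_tac.
    apply: filterS wle => y wle [zy zy2]; rewrite lee_fin mulrC /c.
    apply: ler_pM; rewrite ?(pk_ge0 K) ?powR_ge0//.
      apply: (far_kernel_le sg0 sgta La0 K) => //; first by rewrite divr_gt0.
      exact: growth_far zx zy2.
    by apply: ge0_ler_powR; rewrite ?nnegrE ?posp_ge0 ?(ltW dom0) ?wle.
  rewrite integral_cst//; last exact: measurableD.
  rewrite [leRHS]EFinM lee_wpmul2l ?lee_fin /c//; first by pos_tac.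
  apply: (@le_trans _ _ (mu (eball z rho))).
    by apply: le_measure; rewrite ?inE//; exact: measurableD.
  by apply: eball_vol_le; exact: ltW.
rewrite -EFinD lee_fin.
have Hrho : H z rho <= H z (rho / 2).
  have h12 : 1 <= 2 :> R by exact: ler1n.
  have := pk_scale K z r2 h12; rewrite (_ : 2 * (rho / 2) = rho); last by field.
  move=> /le_trans; apply; rewrite ler_piMl ?(ltW (pk_H0 K z r2))//.
  by rewrite powRN invf_le1 ?powR_gt0// powR_ge1// ltW.
apply: (@le_trans _ _ (A' * H z rho * (de * om / 2) `^ (p - 1))).
  rewrite le_eqVlt; apply/orP; left; apply/eqP; rewrite A'E.
  have -> : (de * om / 2) `^ (p - 1) = (de * om) `^ (p - 1) / 2 `^ (p - 1).
    by rewrite powR_div// ltW.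
  have -> : La * H z rho * rho `^ ta * (rho / 4) `^ (- (n%:R + ta)) *
      (de * om) `^ (p - 1) * (2 ^+ n * rho ^+ n) =
      (rho `^ ta * (rho / 4) `^ (- (n%:R + ta)) * rho ^+ n) * (La * H z rho *
        (de * om) `^ (p - 1) * 2 ^+ n) by ring.
  have -> : rho `^ ta * (rho / 4) `^ (- (n%:R + ta)) * rho ^+ n = 4 `^ (n%:R + ta).
    have [lr ->] := expR_ex rho0; have [l4 ->] := expR_ex (@ltr0n R 4).
    rewrite ?(expR_inv, expR_exprn, expR_powR, =^~ expRD).
    by congr expR; ring.
  by field; rewrite gt_eqF// powR_gt0.
rewrite ler_wpM2r ?powR_ge0// ler_wpM2l//.
Qed.

(** * Decay of the oscillation on balls of ratio 8 *)

Lemma geometric_scale (r0 r : R) : 0 < r -> r <= r0 ->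
  exists j, r0 * 8^-1 ^+ j.+1 < r <= r0 * 8^-1 ^+ j.
Proof.
move=> r_gt0 rr0; have r00 : 0 < r0 by exact: lt_le_trans rr0.
have ex : exists j, r0 * 8^-1 ^+ j.+1 < r.
  exists (Num.truncn (r0 / r)); rewrite exprVn ltr_pdivrMr ?exprn_gt0//.
  rewrite mulrC -ltr_pdivrMr//; apply: (lt_le_trans (truncnS_gt _)).
  by rewrite -natrX ler_nat; apply: ltnW; apply: ltn_expl.
exists (ex_minn ex); case: ex_minnP => -[|i] mi min; rewrite mi/=.
  by rewrite expr0 mulr1.
have := contraNnot (min i); rewrite -ltnNge leqnn => /(_ isT)/negP.
by rewrite -leNgt.
Qed.

(* A small Hoelder exponent makes the growth of [u] on the larger scales negligible
   against the decay of the kernel. *)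
Lemma small_exponent_weight (e be ep : R) : 0 < e -> 0 < be -> 0 < ep ->
  exists2 ga0, 0 < ga0 & forall ga x, 0 < ga -> ga <= ga0 -> 1 <= x ->
    ((8 * x) `^ ga - 1) `^ e <= ep * x `^ be.
Proof.
move=> e0 be0 ep0.
pose b := be / e; pose eta := ep `^ e^-1.
have b0 : 0 < b by rewrite divr_gt0.
have eta0 : 0 < eta by exact: powR_gt0.
have d0 : 0 < 2 * 8 `^ b :> R by rewrite mulr_gt0// powR_gt0.
exists (Num.min (b / 2) (eta * b / (2 * 8 `^ b))).
  by rewrite lt_min !divr_gt0// mulr_gt0.
move=> ga x ga0; rewrite le_min => /andP[gab gaeta] x1.
have x0 : 0 < x by exact: lt_le_trans x1.
have X1 : 1 <= 8 * x by rewrite (le_trans x1)// ler_peMl ?(ltW x0)// ler1n.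
have X0 : 0 < 8 * x by exact: lt_le_trans X1.
(* It suffices to bound the base by eta x^b, as eta^e = [ep] and b e = [be]. This uses exp(y) - 1 <=
   y exp(y) and ln X <= (2/b) X^(b/2); half of the exponent b serves each factor. *)
have bound : (8 * x) `^ ga - 1 <= eta * x `^ b.
  have lnX0 : 0 <= ln (8 * x) by exact: ln_ge0.
  have -> : (8 * x) `^ ga = expR (ga * ln (8 * x)) by rewrite /powR gt_eqF.
  have step1 : expR (ga * ln (8 * x)) - 1 <= ga * ln (8 * x) * expR (ga * ln (8 * x)).
    have := expR_ge1Dx (- (ga * ln (8 * x))).
    rewrite expRN -(ler_pM2r (expR_gt0 (ga * ln (8 * x)))) mulVf ?gt_eqF ?expR_gt0//.
    by rewrite mulrDl mul1r mulNr => ?; lra.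
  apply: (le_trans step1).
  have step2 : ln (8 * x) <= 2 / b * (8 * x) `^ (b / 2).
    have := ltW (@ln_sublinear R ((8 * x) `^ (b / 2)) (powR_gt0 _ X0)).
    rewrite ln_powR mulrC -ler_pdivlMr ?divr_gt0// => /le_trans; apply.
    by rewrite mulrC invf_div.
  have step3 : expR (ga * ln (8 * x)) <= (8 * x) `^ (b / 2).
    by rewrite /powR gt_eqF// ler_expR ler_wpM2r.
  apply: (@le_trans _ _ (ga * (2 / b * (8 * x) `^ (b / 2)) * (8 * x) `^ (b / 2))).
    apply: ler_pM; rewrite ?mulr_ge0 ?expR_ge0 ?(ltW ga0)//.
    by rewrite ler_wpM2l// ltW.
  have -> : ga * (2 / b * (8 * x) `^ (b / 2)) * (8 * x) `^ (b / 2) =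
     ga * (2 * 8 `^ b) / b * x `^ b.
    have bE : (8 * x) `^ (b / 2) * (8 * x) `^ (b / 2) = 8 `^ b * x `^ b.
      by rewrite -powRDg// -splitr powRM// ltW.
    rewrite [LHS](_ : _ = ga * (2 / b) * ((8 * x) `^ (b / 2) * (8 * x) `^ (b / 2)));
      last by ring.
    by rewrite bE; ring.
  rewrite ler_wpM2r ?powR_ge0// ler_pdivrMr//.
  by move: gaeta; rewrite ler_pdivlMr.
have lhs0 : 0 <= (8 * x) `^ ga - 1 by rewrite subr_ge0 powR_ge1// ltW.
apply: (@le_trans _ _ ((eta * x `^ b) `^ e)).
  apply: ge0_ler_powR; rewrite ?nnegrE ?(ltW e0)//.
  by rewrite mulr_ge0 ?powR_ge0.
rewrite powRM ?powR_ge0// /eta -!powRrM mulVf ?gt_eqF// powRr1 ?(ltW ep0)//.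
by rewrite /b mulrAC -mulrA divff ?gt_eqF// mulr1.
Qed.

Lemma powR_add3le (x y z a : R) : 0 <= x -> 0 <= y -> 0 <= z -> 0 <= a ->
  (x + y + z) `^ a <= 4 `^ a * (x `^ a + y `^ a + z `^ a).
Proof.
move=> x0 y0 z0 a0; apply: (le_trans (powR_addle (addr_ge0 x0 y0) z0 a0)).
have -> : 4 `^ a = 2 `^ a * 2 `^ a :> R by rewrite -powRM//; congr (_ `^ _); ring.
have h2 : 1 <= 2 `^ a :> R by rewrite powR_ge1// ler1n.
have := powR_addle x0 y0 a0; have := powR_ge0 z a.
rewrite -mulrA ler_pM2l ?powR_gt0//; nra.
Qed.

(* Besides the range of [u] on the [j]-th ball, the induction carries how far [u]
   leaves this range between the [j]-th ball and the initial one. *)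
Definition osc_state (ga B : R) (u : 'rV[R]_n -> R) (z : 'rV[R]_n) (r0 : R)
    (j : nat) (m : R) : Prop :=
  let om := 2 * B * (8 `^ (- ga)) ^+ j in
  let rho := r0 * 8^-1 ^+ j in
  [/\ - B <= m /\ m + om <= B,
      {ae mu, forall x, eball z rho x -> m <= u x <= m + om} &
      {ae mu, forall y, eball z r0 y -> ~ eball z rho y ->
        m - om * ((8 * (enorm (y - z) / rho)) `^ ga - 1) <= u y <=
        m + om + om * ((8 * (enorm (y - z) / rho)) `^ ga - 1)}].

(** From [rho] to [rho / 8] the power of the distance is multiplied by 8^ga and the range by
    8^(-ga), so their product is unchanged and the old far bounds imply the new ones. The factor 8
    inside the power makes it at least 1 on the new shell, where the old range already bounds
    [u]. *)
Lemma osc_state_next (ga B : R) u z (r0 : R) j (m m' : R) : 0 < ga -> 0 < B -> 0 < r0 ->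
  osc_state ga B u z r0 j m ->
  m <= m' -> m' + 2 * B * (8 `^ (- ga)) ^+ j.+1 <= m + 2 * B * (8 `^ (- ga)) ^+ j ->
  {ae mu, forall x, eball z (r0 * 8^-1 ^+ j.+1) x ->
     m' <= u x <= m' + 2 * B * (8 `^ (- ga)) ^+ j.+1} ->
  osc_state ga B u z r0 j.+1 m'.
Proof.
move=> ga0 B0 r00; rewrite /osc_state /=.
have q0 : 0 < 8 `^ (- ga) :> R by exact: powR_gt0.
have q1 : 8 `^ (- ga) <= 1 :> R by rewrite powRN invf_le1 ?powR_gt0// powR_ge1 ?ler1n// ltW.
have rho0 : 0 < r0 * 8^-1 ^+ j by rewrite mulr_gt0// exprn_gt0.
have rhoE : r0 * 8^-1 ^+ j.+1 = (r0 * 8^-1 ^+ j) / 8 by rewrite exprSr mulrA.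
have omE : 2 * B * (8 `^ (- ga)) ^+ j.+1 = 8 `^ (- ga) * (2 * B * (8 `^ (- ga)) ^+ j).
  by rewrite exprS; ring.
have om0 : 0 < 2 * B * (8 `^ (- ga)) ^+ j by rewrite !mulr_gt0// exprn_gt0.
rewrite omE rhoE.
move: (r0 * _) (2 * B * _) rho0 om0 => rho om rho0 om0 {rhoE omE}.
move=> [[mB mB'] osc far] mm' m'om osc'; split => //; first by split; lra.
apply: filterS2 osc far => y osc far zy nzy.
have Qq : 8 `^ ga * 8 `^ (- ga) = 1 :> R by rewrite mulrC powRNM.
have Q1 : 1 <= 8 `^ ga :> R by rewrite powR_ge1 ?ler1n// ltW.
have dE : (8 * (enorm (y - z) / (rho / 8))) `^ ga =
    8 `^ ga * (8 * (enorm (y - z) / rho)) `^ ga.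
  have d0 : 0 <= enorm (y - z) / rho by rewrite divr_ge0 ?enorm_ge0 ?(ltW rho0).
  have d80 : 0 <= 8 * (enorm (y - z) / rho) by rewrite mulr_ge0.
  rewrite -powRM//.
  by congr (_ `^ _); field; rewrite gt_eqF.
have key (X : R) : 8 `^ (- ga) * om * (8 `^ ga * X - 1) =
    om * X - 8 `^ (- ga) * om.
  rewrite mulrBr mulr1; congr (_ - _).
  by rewrite mulrACA -[_ * 8 `^ ga]mulrC Qq mul1r.
have [zyr|zyr] := pselect (eball z rho y).
  have := osc zyr => /andP[uy1 uy2].
  have d8 : 1 <= (8 * (enorm (y - z) / rho)) `^ ga.
    rewrite powR_ge1 ?(ltW ga0)// mulrA ler_pdivlMr// mul1r.
    by move: nzy => /negP; rewrite -leNgt ler_pdivrMr// mulrC.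
  rewrite dE key//; set X := _ `^ ga in d8 *.
  have : om <= om * X by rewrite ler_peMr// ltW.
  by move=> ?; clear osc'; apply/andP; split; lra.
have := far zy zyr; have d8 : 1 <= (8 * (enorm (y - z) / rho)) `^ ga.
  rewrite powR_ge1 ?(ltW ga0)// mulrA ler_pdivlMr// mul1r.
  move: zyr => /negP; rewrite -leNgt => rz; apply: (le_trans rz).
  by rewrite ler_peMl ?enorm_ge0// ler1n.
rewrite dE key//; set X := _ `^ ga in d8 * => /andP[uy1 uy2].
by clear osc'; apply/andP; split; lra.
Qed.

(** Supplies the tail hypothesis of [growth], applied with [om / 2]. Between [rho] and [r0] the
    growth recorded in the induction is integrated against the weight of [far_integral_le]; beyond
    [r0] only the given tail of [v] is available. *)
Lemma osc_tail (Th0 de ga Lam : R) : 0 <= Th0 -> 0 < de -> 0 < ga ->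
  ga * (p - 1) <= sg -> 0 < Lam -> Th0 <= (de * Lam) `^ (p - 1) ->
  (forall x, 1 <= x -> ((8 * x) `^ ga - 1) `^ (p - 1) <=
    (de / 2) `^ (p - 1) * x `^ (sg / 2)) ->
  forall (k : 'rV[R]_n -> 'rV[R]_n -> R) (H : 'rV[R]_n -> R -> R),
  phase_kernel sg ta la La k H ->
  forall (v : 'rV[R]_n -> R) (z : 'rV[R]_n) (r0 N M : R) (j : nat),
  let om := 2 * (Lam * N) * (8 `^ (- ga)) ^+ j in
  let rho := r0 * 8^-1 ^+ j in
  measurable_fun setT v -> 0 < r0 -> 0 < N -> om - Lam * N <= M ->
  {ae mu, forall y, eball z r0 y -> ~ eball z rho y ->
    v y <= M + om * ((8 * (enorm (y - z) / rho)) `^ ga - 1)} ->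
  {ae mu, forall x, eball z (3 / 4 * r0) x ->
    (\int[mu]_(y in ~` eball z r0) (`|v y| `^ (p - 1) * k x y)%:E <=
     (Th0 * H z r0 * N `^ (p - 1))%:E)%E} ->
  {ae mu, forall x, eball z (3 / 4 * rho) x ->
    (\int[mu]_(y in ~` eball z rho)
       (posp (v y - (M - de * (om / 2))) `^ (p - 1) * k x y)%:E
      <= (4 `^ (p - 1) * (4 * far_cst n sg ta La + 1) * H z rho *
          (de * (om / 2)) `^ (p - 1))%:E)%E}.
Proof.
move=> Th00 de0 ga0 gasg Lam0 Th0Lam wgt k H K v z r0 N M j om rho mv r00 N0.
have q0 : 0 < 8 `^ (- ga) :> R by exact: powR_gt0.
have h0 : 0 < 8^-1 ^+ j :> R by rewrite exprn_gt0// invr_gt0.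
have h1 : 8^-1 ^+ j <= 1 :> R by rewrite exprn_ile1 ?invr_ge0// invf_le1 ?ler1n.
have rho0 : 0 < rho by exact: mulr_gt0.
have rho_r0 : rho <= r0 by rewrite ler_piMr// ltW.
have LN0 : 0 < Lam * N by exact: mulr_gt0.
have om0 : 0 < om by rewrite !mulr_gt0// exprn_gt0.
have dom0 : 0 < de * (om / 2) by rewrite mulr_gt0// divr_gt0.
have omq : om * (8 `^ ga) ^+ j = 2 * (Lam * N).
  rewrite /om -mulrA -exprMn powRNM// expr1n mulr1//.
(* From [r0] down to [rho] the scale function [H] grows at least like 8^(sg j), while the power of
   the range falls by 8^(-ga (p-1) j); hence the condition on [ga * (p - 1)]. The factor [Lam]
   absorbs [Th0]. *)
have Hle : Th0 * H z r0 * N `^ (p - 1) <= H z rho * (de * (om / 2)) `^ (p - 1).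
  have c1 : 1 <= 8 ^+ j :> R by rewrite exprn_ege1// ler1n.
  have := pk_scale K z rho0 c1.
  rewrite (_ : 8 ^+ j * rho = r0); last first.
    by rewrite /rho mulrCA exprVn divff ?mulr1// gt_eqF// exprn_gt0.
  have := pk_H0 K z rho0; move: (H z rho) (H z r0) => h hr h_0 hle.
  apply: (@le_trans _ _ ((de * Lam) `^ (p - 1) * ((8 ^+ j) `^ (- sg) * h) * N `^ (p - 1))).
    rewrite ler_wpM2r ?powR_ge0//.
    apply: (@le_trans _ _ (Th0 * ((8 ^+ j) `^ (- sg) * h))); first by rewrite ler_wpM2l.
    by rewrite ler_wpM2r//; pos_tac.
  have -> : de * (om / 2) = de * Lam * N * (8 `^ (- ga)) ^+ j by rewrite /om; field.
  rewrite [X in _ <= _ * X]powRM ?exprn_ge0 ?mulr_ge0 ?(ltW N0) ?(ltW de0) ?(ltW Lam0)//.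
  rewrite [X in _ <= _ * (X * _)]powRM ?mulr_ge0 ?(ltW N0) ?(ltW de0) ?(ltW Lam0)//.
  rewrite [leLHS](_ : _ = h * ((de * Lam) `^ (p - 1) * N `^ (p - 1)) * (8 ^+ j) `^ (- sg));
    last by ring.
  rewrite [leRHS]mulrA ler_wpM2l//; first by pos_tac.
  rewrite !powR_geom ?powR_ge0// lerXn2r ?nnegrE ?powR_ge0//.
  by rewrite -powRrM ler_powR ?ler1n// mulNr lerN2.
move=> Mlow far tail.
have wd (y : 'rV[R]_n) : ~ eball z rho y -> 1 <= enorm (y - z) / rho.
  by move=> /negP; rewrite -leNgt ler_pdivlMr// mul1r.
have phi0 (y : 'rV[R]_n) : ~ eball z rho y ->
    0 <= (8 * (enorm (y - z) / rho)) `^ ga - 1.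
  move=> /wd wdy; rewrite subr_ge0 powR_ge1 ?(ltW ga0)//.
  by rewrite (le_trans wdy)// ler_peMl ?ler1n// (le_trans _ wdy).
pose c1 := 2 * 4 `^ (p - 1) * (de * (om / 2)) `^ (p - 1).
have c10 : 0 <= c1 by rewrite /c1; pos_tac.
pose w y := (enorm (y - z) / rho) `^ (sg / 2).
pose F x y := posp (v y - (M - de * (om / 2))) `^ (p - 1) * k x y.
have F0 x y : 0 <= F x y by rewrite /F mulr_ge0 ?powR_ge0 ?(pk_ge0 K).
(* Used with a = 0 inside [r0] and a = |v y| outside. The 2 in [c1] counts the constant part of the
   excess and its growth, both bounded by the weight. *)
have F3 x y a : ~ eball z rho y -> 0 <= a ->
    v y - M <= om * ((8 * (enorm (y - z) / rho)) `^ ga - 1) + a ->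
    F x y <= c1 * (k x y * w y) + 4 `^ (p - 1) * (a `^ (p - 1) * k x y).
  move=> zy a0 va; have w1 : 1 <= w y.
    by apply: powR_ge1; [exact: wd|rewrite divr_ge0// ltW].
  have ph := phi0 _ zy; have := wgt _ (wd _ zy).
  have omph : 0 <= om * ((8 * (enorm (y - z) / rho)) `^ ga - 1).
    by rewrite mulr_ge0// ltW.
  rewrite /F -/(w y); move: ph omph va; set phi := _ `^ ga - 1 => ph omph va wph.
  apply: (@le_trans _ _ ((4 `^ (p - 1) * ((de * (om / 2)) `^ (p - 1) +
      (om * phi) `^ (p - 1) + a `^ (p - 1))) * k x y)).
    rewrite ler_wpM2r ?(pk_ge0 K)//.
    apply: le_trans (powR_add3le (ltW dom0) omph a0 pm1).
    apply: ge0_ler_powR; rewrite ?nnegrE ?posp_ge0//.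
      by rewrite !addr_ge0// ltW.
    by rewrite /posp ge_max !addr_ge0 ?(ltW dom0)// andbT; lra.
  have omw : (om * phi) `^ (p - 1) <= (de * (om / 2)) `^ (p - 1) * w y.
    rewrite powRM ?(ltW om0)//.
    rewrite (_ : de * (om / 2) = om * (de / 2)); last by ring.
    by rewrite powRM ?divr_ge0 ?(ltW om0) ?(ltW de0)// -mulrA ler_wpM2l ?powR_ge0.
  have dw : (de * (om / 2)) `^ (p - 1) <= (de * (om / 2)) `^ (p - 1) * w y.
    by rewrite ler_peMr ?powR_ge0.
  rewrite [leRHS](_ : _ = (4 `^ (p - 1) * ((de * (om / 2)) `^ (p - 1) * w y +
    (de * (om / 2)) `^ (p - 1) * w y + a `^ (p - 1))) * k x y); last by rewrite /c1; ring.
  rewrite ler_wpM2r ?(pk_ge0 K)// ler_wpM2l ?powR_ge0//.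
  by rewrite lerD2r lerD.
have mB s : measurable (eball z s) := measurable_eball z s.
have mw : measurable_fun setT w.
  apply: (measurableT_comp (measurable_powR _)); apply: measurable_funM => //.
  by apply: measurable_enorm; exact: measurable_fun_subrV.
apply: filterS tail => x tailx zx.
have zx0 : eball z (3 / 4 * r0) x by apply: subset_eballr zx; rewrite ler_wpM2l.
have mk := measurable_kernelr K x.
have mkw : measurable_fun setT (fun y => k x y * w y) by exact: measurable_funM.
have kw0 y : 0 <= k x y * w y by rewrite mulr_ge0 ?powR_ge0 ?(pk_ge0 K).
have mvk : measurable_fun setT (fun y => `|v y| `^ (p - 1) * k x y).
  apply: measurable_funM => //; apply: (measurableT_comp (measurable_powR _)).
  exact: measurableT_comp.
have vk0 y : 0 <= `|v y| `^ (p - 1) * k x y by rewrite mulr_ge0 ?powR_ge0 ?(pk_ge0 K).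
have wint : (\int[mu]_(y in ~` eball z rho) (c1 * (k x y * w y))%:E <=
    (c1 * (far_cst n sg ta La * H z rho))%:E)%E.
  rewrite integralZl_fin//; last exact: measurableC.
  rewrite [leRHS]EFinM lee_wpmul2l ?lee_fin//.
  exact: (far_integral_le sg0 sgta La0 K).
have mF : measurable_fun setT (F x).
  by apply: measurable_funM => //; exact: measurable_posp_powR.
apply: le_trans (ge0_integral_setU_le mu (measurableC (mB r0))
  (measurableD (mB r0) (mB rho)) mF (F0 x) _) _.
  move=> y yj; have [yB|] := pselect (eball z r0 y); last by left.
  by right.
apply: (@le_trans _ _ ((c1 * (far_cst n sg ta La * H z rho) +
    4 `^ (p - 1) * (Th0 * H z r0 * N `^ (p - 1)))%:E +
    (c1 * (far_cst n sg ta La * H z rho))%:E)%E); last first.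
  rewrite -EFinD lee_fin.
  apply: (@le_trans _ _ (c1 * (far_cst n sg ta La * H z rho) + 4 `^ (p - 1) *
     (H z rho * (de * (om / 2)) `^ (p - 1)) + c1 * (far_cst n sg ta La * H z rho))).
    by rewrite lerD2r lerD2l ler_wpM2l ?powR_ge0.
  rewrite le_eqVlt; apply/orP; left; apply/eqP.
  by rewrite /c1; move: (far_cst _ _ _ _) => C; ring.
apply: leeD.
  apply: (@le_trans _ _ (\int[mu]_(y in ~` eball z r0) (c1 * (k x y * w y))%:E +
     \int[mu]_(y in ~` eball z r0) (4 `^ (p - 1) * (`|v y| `^ (p - 1) * k x y))%:E)%E).
    rewrite -ge0_integralD//; last 5 first.
    - exact: measurableC.
    - by move=> y _; rewrite lee_fin mulr_ge0.
    - by apply/measurable_EFinP; apply: measurable_funTS; apply: measurable_funM.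
    - by move=> y _; rewrite lee_fin mulr_ge0 ?powR_ge0.
    - by apply/measurable_EFinP; apply: measurable_funTS; apply: measurable_funM.
    apply: ge0_le_integral_gen => y zy; first by rewrite lee_fin; exact: F0.
    have zy' : ~ eball z rho y by move=> /(subset_eballr rho_r0).
    rewrite -EFinD lee_fin; apply: F3 => //.
    (* Beyond [r0] the allowed growth has reached the full initial range, which compensates a
       negative [M]; what remains of [v y - M] is at most |v y|. *)
    have phil : 2 * (Lam * N) <= om * (8 * (enorm (y - z) / rho)) `^ ga.
      rewrite -omq ler_wpM2l ?(ltW om0)// -powR_geom//.
      apply: ge0_ler_powR; rewrite ?nnegrE ?(ltW ga0) ?exprn_ge0//.
        by rewrite mulr_ge0// divr_ge0 ?enorm_ge0// ltW.
      apply: (@le_trans _ _ (1 * 8 ^+ j)); first by rewrite mul1r.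
      apply: ler_pM; rewrite ?exprn_ge0 ?ler1n//.
      rewrite ler_pdivlMr//; move: zy => /negP; rewrite -leNgt; apply: le_trans.
      by rewrite /rho mulrCA exprVn divff ?mulr1// gt_eqF// exprn_gt0.
    have := ler_norm (v y); move: phil; rewrite mulrBr mulr1.
    by set W := om * _ `^ ga; lra.
  rewrite EFinD; apply: leeD.
    apply: le_trans wint; apply: ge0_subset_integral_gen => //.
    - by move=> y _; rewrite lee_fin mulr_ge0.
    - by move=> y _; rewrite lee_fin mulr_ge0.
    by move=> y zy /(subset_eballr rho_r0).
  rewrite integralZl_fin//; last exact: measurableC.
  by rewrite [leRHS]EFinM lee_wpmul2l ?lee_fin ?powR_ge0//; exact: tailx.
apply: (@le_trans _ _ (\int[mu]_(y in eball z r0 `\` eball z rho)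
    (c1 * (k x y * w y))%:E)%E).
  apply: ge0_ae_le_integral_gen.
  - by move=> y _; rewrite lee_fin; exact: F0.
  - by move=> y _; rewrite lee_fin mulr_ge0.
  apply: filterS far => y far [zy zy']; rewrite lee_fin.
  have := @F3 x y 0 zy' (lexx _); rewrite powR0 ?mul0r ?mulr0 ?addr0; last first.
    by rewrite subr_eq0 gt_eqF.
  by apply; have := far zy zy'; lra.
apply: le_trans wint; apply: ge0_subset_integral_gen => //.
- by move=> y _; rewrite lee_fin mulr_ge0.
- by move=> y _; rewrite lee_fin mulr_ge0.
Qed.

(** Decides whether [growth] is applied to [u], lowering the top of the range, or to [- u], raising
    its bottom. *)
Lemma half_volume (u : 'rV[R]_n -> R) (z : 'rV[R]_n) (rho a : R) :
  measurable_fun setT u -> 0 < rho ->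
  ((vlow / 2 * rho ^+ n)%:E <= mu (eball z rho `&` [set x | (u x <= a)%R]))%E \/
  ((vlow / 2 * rho ^+ n)%:E <= mu (eball z rho `&` [set x | (- u x <= - a)%R]))%E.
Proof.
move=> mB rho0; apply/orP; rewrite -[_ || _]negbK negb_or -!ltNge; apply/negP => /andP[lt1 lt2].
have mN : measurable_fun setT (fun x => - u x) by exact: measurableT_comp.
have mS1 := measurableI _ _ (measurable_eball z rho) (measurable_set_le a mB).
have mS2 := measurableI _ _ (measurable_eball z rho) (measurable_set_le (- a) mN).
have := eball_vol_ge n0 z rho0; rewrite leNgt => /negP; apply.
have -> : eball z rho = (eball z rho `&` [set x | u x <= a]) `|`
    (eball z rho `&` [set x | - u x <= - a]).
  rewrite -setIUr -[LHS]setIT; congr (_ `&` _); apply/seteqP; split => // x _ /=.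
  by rewrite lerN2; have [|/ltW] := leP (u x) a; [left|right].
apply: (le_lt_trans (measureU2 _ mS1 mS2)).
apply: (lt_le_trans (lteD lt1 lt2)); rewrite -EFinD lee_fin -/vlow le_eqVlt.
by apply/orP; left; apply/eqP; field.
Qed.

Let osc_upper (q om de m x : R) : om - de * om / 4 <= q * om ->
  x <= m + om - de * (om / 2) / 2 -> x <= m + q * om.
Proof. by lra. Qed.

Let osc_lower (q om de m x : R) : om - de * om / 4 <= q * om ->
  - x <= - m - de * (om / 2) / 2 -> m + om - q * om <= x.
Proof. by lra. Qed.

(** Induction on the scale. One of the two halves of the range is taken on a large set, so [growth]
    with [om / 2] removes [de * om / 4] from one end, and 8^(-ga) is chosen no smaller than the
    remaining fraction. *)
Lemma oscillation (Th0 : R) : 0 <= Th0 -> exists ga Lam : R,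
  [/\ 0 < ga, ga < 1, 1 <= Lam &
  forall (k : 'rV[R]_n -> 'rV[R]_n -> R) (H : 'rV[R]_n -> R -> R),
  phase_kernel sg ta la La k H ->
  forall (u : 'rV[R]_n -> R) (z : 'rV[R]_n) (r0 N : R),
  measurable_fun setT u -> 0 < r0 -> r0 <= 1 -> 0 < N ->
  (forall r3, 0 < r3 -> r3 <= r0 -> energy_ineq p k CE u z r3) ->
  (forall r3, 0 < r3 -> r3 <= r0 -> energy_ineq p k CE (fun x => - u x) z r3) ->
  {ae mu, forall x, eball z r0 x -> `|u x| <= N} ->
  {ae mu, forall x, eball z (3 / 4 * r0) x ->
    (\int[mu]_(y in ~` eball z r0) (`|u y| `^ (p - 1) * k x y)%:E <=
     (Th0 * H z r0 * N `^ (p - 1))%:E)%E} ->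
  forall j, exists m, osc_state ga (Lam * N) u z r0 j m].
Proof.
move=> Th00; pose A := 4 `^ (p - 1) * (4 * far_cst n sg ta La + 1).
have A0 : 0 <= A.
  by rewrite /A; have := far_cst_ge0 n ta sg0 La0; move: (far_cst _ _ _ _) => C C0; pos_tac.
have [de /andP[de0 de2] GR] := growth A0.
have p10 : 0 < p - 1 by rewrite subr_gt0.
have sg20 : 0 < sg / 2 by rewrite divr_gt0.
have ep0 : 0 < (de / 2) `^ (p - 1) by rewrite powR_gt0// divr_gt0.
have [ga0 ga00 wgt] := small_exponent_weight p10 sg20 ep0.
(* The four bounds serve, in order, the weight, the comparison with the decay of [H], the inequality
   [qde], and [ga < 1]. *)
pose ga := Num.min (Num.min ga0 (sg / (p - 1))) (Num.min (de / 32) 2^-1).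
have ga_gt0 : 0 < ga by rewrite !lt_min ga00 !divr_gt0//= invr_gt0 ltr0n.
have [gaga0 gasg gade ga1] : [/\ ga <= ga0, ga <= sg / (p - 1), ga <= de / 32 & ga <= 2^-1].
  by split; rewrite /ga !ge_min lexx ?orbT.
clearbody ga.
(* The initial range is enlarged so that the tail beyond [r0] is small relative to [de] times the
   range. *)
pose Lam := 1 + Th0 `^ (p - 1)^-1 / de.
have Lam1 : 1 <= Lam by rewrite lerDl divr_ge0 ?powR_ge0// ltW.
have Lam0 : 0 < Lam by exact: lt_le_trans Lam1.
have LamTh : Th0 <= (de * Lam) `^ (p - 1).
  apply: (@le_trans _ _ ((Th0 `^ (p - 1)^-1) `^ (p - 1))).
    by rewrite -powRrM mulVf ?gt_eqF// powRr1.
  apply: ge0_ler_powR; rewrite ?nnegrE ?powR_ge0 ?mulr_ge0 ?(ltW de0) ?(ltW Lam0)//.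
  by rewrite /Lam mulrDr mulr1 mulrC divfK ?gt_eqF// lerDr ltW.
clearbody Lam.
(* 8^(-ga) is at least 1 - ga ln 8, hence at least 1 - 8 ga; this is where the 32 in [ga] comes
   from. *)
have qde : 1 - de / 4 <= 8 `^ (- ga).
  rewrite /powR gt_eqF//; apply: le_trans (expR_ge1Dx _).
  have : ln 8 <= 8 :> R by apply/ltW/ln_sublinear.
  by rewrite mulNr => ln8; rewrite lerD2l lerN2; nra.
exists ga, Lam; split => //; first by apply: (le_lt_trans ga1); rewrite invf_lt1// ltr1n.
move=> k H K u z r0 N mu' r00 r01 N0 EI EIN uN tail.
have LN0 : 0 < Lam * N by exact: mulr_gt0.
have gasg' : ga * (p - 1) <= sg by rewrite -ler_pdivlMr.
have wgt' x : 1 <= x -> ((8 * x) `^ ga - 1) `^ (p - 1) <= (de / 2) `^ (p - 1) * x `^ (sg / 2).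
  exact: wgt.
have TAIL := osc_tail Th00 de0 ga_gt0 gasg' Lam0 LamTh wgt' K.
have mN : measurable_fun setT (fun x => - u x) by exact: measurableT_comp.
elim => [|j [m st]].
  (* At the initial scale the condition on the larger balls is empty. *)
  exists (- (Lam * N)); rewrite /osc_state expr0 !mulr1; split.
  - by split => //; rewrite le_eqVlt; apply/orP; left; apply/eqP; ring.
  - apply: filterS uN => x uN zx; have := uN zx.
    have : N <= Lam * N by rewrite ler_peMl// ltW.
    rewrite ler_norml => NL /andP[u1 u2].
    by clear GR TAIL EI EIN tail; apply/andP; split; lra.
  - by apply: aeW => x /= ? ?.
pose rho := r0 * 8^-1 ^+ j; pose om := 2 * (Lam * N) * (8 `^ (- ga)) ^+ j.
have h0 : 0 < 8^-1 ^+ j :> R by rewrite exprn_gt0// invr_gt0.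
have h1 : 8^-1 ^+ j <= 1 :> R by rewrite exprn_ile1 ?invr_ge0// invf_le1 ?ler1n.
have rho0 : 0 < rho by exact: mulr_gt0.
have rho_r0 : rho <= r0 by rewrite ler_piMr// ltW.
have rho1 : rho <= 1 by exact: le_trans r01.
have rho20 : 0 < rho / 2 by rewrite divr_gt0.
have om0 : 0 < om by rewrite /om; pos_tac.
have om20 : 0 < om / 2 by rewrite divr_gt0.
have omS : 2 * (Lam * N) * (8 `^ (- ga)) ^+ j.+1 = 8 `^ (- ga) * om.
  by rewrite /om exprS; ring.
have rhoS : r0 * 8^-1 ^+ j.+1 = rho / 8 by rewrite /rho exprSr mulrA.
have qom : om - de * om / 4 <= 8 `^ (- ga) * om.
  rewrite (_ : _ - _ = (1 - de / 4) * om); first by rewrite ler_wpM2r// ltW.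
  by ring.
have q1 : 8 `^ (- ga) * om <= om.
  by rewrite ler_piMl ?(ltW om0)// powRN invf_le1 ?powR_gt0// powR_ge1 ?ler1n// ltW.
have [[mB1 mB2] osc far] := st; rewrite -/om -/rho in mB1 mB2 osc far.
have [vol|vol] := half_volume z (m + om / 2) mu' rho20.
  exists m; apply: (osc_state_next ga_gt0 LN0 r00 st) => //.
    by rewrite omS -/om lerD2l.
  rewrite omS rhoS.
  have GRu := GR k H K u z rho (m + om) (om / 2) mu' rho0 rho1 om20.
  have {}GRu : {ae mu, forall x, eball z (rho / 8) x -> u x <= m + om - de * (om / 2) / 2}.
    apply: GRu.
    - by move=> r3 r30 r3r; apply: EI => //; exact: le_trans rho_r0.
    - by apply: filterS osc => x osc zx; have /andP[] := osc zx.
    - by rewrite (_ : m + om - om / 2 = m + om / 2)//; field.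
    - apply: (TAIL u z r0 N (m + om) j mu' r00 N0) => //.
        by rewrite addrC; exact: lerD mB1 (lexx om).
      by apply: filterS far => y far zy zy'; have /andP[] := far zy zy'.
  apply: filterS2 GRu osc => x ux osc zx.
  have zx' : eball z rho x by apply: subset_eballr zx;
    rewrite ler_piMr ?(ltW rho0)// invf_le1 ?ler1n.
  by have /andP[-> _] := osc zx'; exact: osc_upper qom (ux zx).
(* The top is kept and the bottom is raised until the length is exactly the prescribed one. *)
exists (m + om - 8 `^ (- ga) * om); apply: (osc_state_next ga_gt0 LN0 r00 st).
- by rewrite -addrA lerDl subr_ge0.
- by rewrite omS -/om subrK.
rewrite omS rhoS.
have GRu := GR k H K (fun x => - u x) z rho (- m) (om / 2) mN rho0 rho1 om20.
have {}GRu : {ae mu, forall x, eball z (rho / 8) x -> - u x <= - m - de * (om / 2) / 2}.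
  apply: GRu.
  - by move=> r3 r30 r3r; apply: EIN => //; exact: le_trans rho_r0.
  - by apply: filterS osc => x osc zx; have /andP[+ _] := osc zx; rewrite lerN2.
  - by rewrite -opprD.
  - apply: (TAIL (fun x => - u x) z r0 N (- m) j mN r00 N0).
    + by rewrite -/om lerBlDr addrC -lerBlDr opprK addrC.
    + apply: filterS far => y far zy zy'; have /andP[+ _] := far zy zy'.
      by rewrite -/om -/rho; set W := om * _; clear GR TAIL EI EIN tail uN; lra.
    apply: filterS tail => x tailx zx; under eq_integral do rewrite normrN.
    exact: tailx.
apply: filterS2 GRu osc => x ux osc zx.
have zx' : eball z rho x by apply: subset_eballr zx;
  rewrite ler_piMr ?(ltW rho0)// invf_le1 ?ler1n.
have /andP[_ ux'] := osc zx'; rewrite subrK ux' andbT.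
exact: osc_lower qom (ux zx).
Qed.

(** A ball has positive measure. This turns an inequality between constants known at almost every
    point of a ball into a true one. *)
Lemma ae_eball_ex (z : 'rV[R]_n) (s : R) (P : 'rV[R]_n -> Prop) : 0 < s ->
  {ae mu, forall x, eball z s x -> P x} -> exists2 x, eball z s x & P x.
Proof.
move=> s0 [N [mN N0 PN]]; apply: contrapT => nex.
have sub : eball z s `<=` N.
  by move=> x zx; apply: PN => /= Px; apply: nex; exists x => //; exact: Px.
have := eball_vol_ge n0 z s0.
rewrite (subset_measure0 (measurable_eball z s) mN sub N0) lee_fin leNgt => /negP.
by apply; rewrite mulr_gt0 ?exprn_gt0// ?divr_gt0// ltr0n.
Qed.

(** The ranges at different scales pairwise intersect, since concentric balls share points where
    both bounds hold. So the supremum of the lower ends lies in every range, without the ranges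
    having to be nested. *)
Lemma osc_limit (ga B : R) (u : 'rV[R]_n -> R) (z : 'rV[R]_n) (r0 : R) :
  0 < ga -> ga < 1 -> 0 < B -> 0 < r0 ->
  (forall j, exists m, osc_state ga B u z r0 j m) ->
  exists2 c, `|c| <= B & forall rho, 0 < rho -> rho <= r0 ->
    {ae mu, forall x, eball z rho x -> `|u x - c| <= 16 * B * (rho / r0) `^ ga}.
Proof.
move=> ga0 ga1 B0 r00 /choice[m st].
have [q qE] : exists q : R, q = 8 `^ (- ga) by eexists.
have [om omE] : exists om : nat -> R, forall j, om j = 2 * B * q ^+ j by eexists.
have [rad radE] : exists rad : nat -> R, forall j, rad j = r0 * 8^-1 ^+ j by eexists.
have q0 : 0 < q by rewrite qE powR_gt0.
have om0 j : 0 < om j by rewrite omE; pos_tac.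
have rad0 j : 0 < rad j by rewrite radE mulr_gt0// exprn_gt0// invr_gt0.
have bd j : - B <= m j /\ m j + om j <= B.
  by have [bj _ _] := st j; rewrite omE qE.
have osc j : {ae mu, forall x, eball z (rad j) x -> m j <= u x <= m j + om j}.
  by have [_ oj _] := st j; rewrite omE qE radE.
have cross i j : m i <= m j + om j.
  have r0' : 0 < Num.min (rad i) (rad j) by rewrite lt_min !rad0.
  have : {ae mu, forall x, eball z (Num.min (rad i) (rad j)) x -> m i <= m j + om j}.
    apply: filterS2 (osc i) (osc j) => x oi oj zx.
    have zi : eball z (rad i) x by apply: subset_eballr zx; rewrite ge_min lexx.
    have zj : eball z (rad j) x by apply: subset_eballr zx; rewrite ge_min lexx orbT.
    have /andP[mu1 _] := oi zi; have /andP[_ um] := oj zj.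
    exact: le_trans um.
  by move=> /(ae_eball_ex r0')[x].
have hs : has_sup (range m).
  split; first by exists (m 0%N), 0%N.
  by exists (m 0%N + om 0%N) => _ [i _ <-]; exact: cross.
have mc j : m j <= sup (range m) by apply: sup_upper_bound => //; exists j.
have cm j : sup (range m) <= m j + om j.
  by apply: ge_sup; [exact: hs.1|move=> _ [i _ <-]; exact: cross].
exists (sup (range m)).
  have [b1 b2] := bd 0%N; have := mc 0%N; have := cm 0%N.
  by move=> c2 c1; rewrite ler_norml (le_trans b1 c1) (le_trans c2 b2).
move=> rho rho0 rho_r0; have [j /andP[j1 j2]] := geometric_scale rho0 rho_r0.
(* Since 8^(-j) < 8 rho / r0, the j-th range is at most 2 B 8^ga times the power of the ratio; 8^ga
   <= 8 gives 16. *)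
have omj : om j <= 16 * B * (rho / r0) `^ ga.
  rewrite omE qE -powR_geom//.
  apply: (@le_trans _ _ (2 * B * (8 * (rho / r0)) `^ ga)).
    rewrite ler_wpM2l ?mulr_ge0 ?(ltW B0)//.
    rewrite -powRV ?exprn_ge0// -exprVn.
    apply: ge0_ler_powR; rewrite ?nnegrE ?(ltW ga0) ?exprn_ge0 ?invr_ge0//.
      by rewrite mulr_ge0// divr_ge0// ltW.
    rewrite mulrA ler_pdivlMr//; move: j1; rewrite exprS.
    by move: (8^-1 ^+ j) => w; move=> ?; lra.
  have d0 : 0 <= rho / r0 by rewrite divr_ge0// ltW.
  rewrite powRM// mulrA ler_wpM2r ?powR_ge0//.
  have : 8 `^ ga <= 8 :> R by apply: ler1_powR; rewrite ?ler1n ?ltW.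
  move: (8 `^ ga) => X X8; rewrite [leRHS](_ : _ = 2 * B * 8); last by ring.
  by rewrite ler_wpM2l// mulr_ge0// ltW.
apply: filterS (osc j) => x oscx zx; apply: le_trans omj.
have /andP[u1 u2] : m j <= u x <= m j + om j.
  by apply: oscx; apply: subset_eballr zx; rewrite radE.
have c1 := mc j; have c2 := cm j; rewrite ler_distl.
by apply/andP; split; lra.
Qed.

(** Recentres the tail: the part of the ball around [x0] outside the small ball around [z] is
    controlled by the p-th power of [u], at distance at least s/4 from [x], which produces the power
    of 4 r / s. *)
Lemma outer_tail (Th : R) (k : 'rV[R]_n -> 'rV[R]_n -> R) (H : 'rV[R]_n -> R -> R)
    (u : 'rV[R]_n -> R) (x0 z : 'rV[R]_n) (r N s : R) :
  phase_kernel sg ta la La k H -> 0 <= Th ->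
  measurable_fun setT u -> 0 < r -> 0 < N -> 0 < s -> s <= r / 8 ->
  eball x0 (r / 2) z ->
  (\int[mu]_(y in eball x0 r) (`|u y| `^ p)%:E <= (N `^ p * r ^+ n)%:E)%E ->
  {ae mu, forall x, eball x0 (5 / 8 * r) x ->
    (\int[mu]_(y in ~` eball x0 r) (`|u y| `^ (p - 1) * k x y)%:E <=
     (Th * H x0 r * N `^ (p - 1))%:E)%E} ->
  {ae mu, forall x, eball z (3 / 4 * s) x ->
    (\int[mu]_(y in ~` eball z s) (`|u y| `^ (p - 1) * k x y)%:E <=
     ((Th + La * (4 * r / s) `^ (n%:R + ta) * (2 ^+ n + 1)) *
       H x0 r * N `^ (p - 1))%:E)%E}.
Proof.
move=> K Th0 mU r0 N0 s0 sr x0z uN tail.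
have H0 := pk_H0 K x0 r0.
have mB (x : 'rV[R]_n) (t : R) : measurable (eball x t) := measurable_eball x t.
apply: filterS tail => x tailx zx.
have x0x : eball x0 (5 / 8 * r) x.
  have := ler_enormB x z x0; move: zx x0z; rewrite /eball/=; lra.
have x0x' : eball x0 r x by apply: subset_eballr x0x; lra.
have mf : measurable_fun setT (fun y => `|u y| `^ (p - 1) * k x y).
  apply: measurable_funM; last exact: (measurable_kernelr K).
  by apply: (measurableT_comp (measurable_powR _)); exact: measurableT_comp.
have f0 y : 0 <= `|u y| `^ (p - 1) * k x y by rewrite mulr_ge0 ?powR_ge0 ?(pk_ge0 K).
apply: le_trans (ge0_integral_setU_le mu (measurableC (mB x0 r))
  (measurableD (mB x0 r) (mB z s)) mf f0 _) _.
  move=> y yj; have [yB|] := pselect (eball x0 r y); last by left.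
  by right.
rewrite mulrDl mulrDl EFinD; apply: leeD; first exact: tailx.
pose c := La * H x0 r * r `^ ta * (s / 4) `^ (- (n%:R + ta)).
have c0 : 0 <= c by rewrite /c; pos_tac.
(* Split at |u y| = N: the power p - 1 is below the first term, or else below the second. *)
pose g y := N `^ (p - 1) + N^-1 * `|u y| `^ p.
have g0 y : 0 <= g y by rewrite /g addr_ge0 ?mulr_ge0 ?powR_ge0 ?invr_ge0 ?(ltW N0).
have mu_p : measurable_fun setT (fun y => `|u y| `^ p).
  by apply: (measurableT_comp (measurable_powR _)); exact: measurableT_comp.
have mg1 : measurable_fun setT (fun y => N^-1 * `|u y| `^ p) by exact: measurable_funM.
have mg : measurable_fun setT g by exact: measurable_funD.
apply: (@le_trans _ _ (\int[mu]_(y in eball x0 r) (c * g y)%:E)%E).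
  apply: ge0_subset_integral_gen.
  - by move=> y _; rewrite lee_fin.
  - by move=> y _; rewrite lee_fin mulr_ge0.
  - by move=> y [].
  move=> y [zy zy']; rewrite lee_fin mulrC; apply: ler_pM; rewrite ?(pk_ge0 K) ?powR_ge0//.
    apply: (far_kernel_le sg0 sgta La0 K) => //; first by rewrite divr_gt0.
    have := ler_enormB y x z; move: zy' zx; rewrite /eball/= (enormC y x).
    by move=> /negP; rewrite -leNgt; lra.
  rewrite /g; have [pk|pk] := leP `|u y| N.
    rewrite -[leLHS]addr0 lerD//; last by rewrite mulr_ge0 ?powR_ge0 ?invr_ge0 ?(ltW N0).
    by apply: ge0_ler_powR; rewrite ?nnegrE ?(ltW N0).
  rewrite -(mulr_powRB1 (normr_ge0 _) p0) -[leLHS]add0r lerD ?powR_ge0//.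
  by rewrite mulrA ler_peMl ?powR_ge0// mulrC ler_pdivlMr// mul1r ltW.
rewrite integralZl_fin//.
apply: (@le_trans _ _ (c%:E * (N `^ (p - 1) * (2 ^+ n * r ^+ n) +
    N^-1 * (N `^ p * r ^+ n))%:E)%E).
  rewrite lee_wpmul2l ?lee_fin//; under eq_integral do rewrite EFinD.
  rewrite ge0_integralD//; last 3 first.
  - by move=> y _; rewrite lee_fin powR_ge0.
  - by move=> y _; rewrite lee_fin mulr_ge0 ?powR_ge0// invr_ge0 ltW.
  - by apply/measurable_EFinP; exact: measurable_funTS.
  rewrite EFinD; apply: leeD.
    rewrite integral_cst// EFinM lee_wpmul2l ?lee_fin ?powR_ge0//.
    by apply: eball_vol_le; exact: ltW.
  rewrite integralZl_fin//; last by rewrite invr_ge0 ltW.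
  by rewrite [leRHS]EFinM lee_wpmul2l// lee_fin invr_ge0 ltW.
rewrite -EFinM lee_fin le_eqVlt; apply/orP; left; apply/eqP.
have NE : N^-1 * N `^ p = N `^ (p - 1).
  by rewrite -(mulr_powRB1 (ltW N0) p0) mulKf// gt_eqF.
rewrite [_^-1 * (_ * _)]mulrA NE.
rewrite [LHS](_ : _ = (c * r ^+ n) * (N `^ (p - 1) * (2 ^+ n + 1))); last by ring.
suff -> : c * r ^+ n = La * (4 * r / s) `^ (n%:R + ta) * H x0 r by ring.
rewrite /c; have [lh ->] := expR_ex H0; have [lr ->] := expR_ex r0.
have [lL ->] := expR_ex La0; have [ls ->] := expR_ex s0.
have [l4 ->] := expR_ex (@ltr0n R 4).
rewrite ?(expR_inv, expR_exprn, expR_powR, =^~ expRD).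
by congr expR; ring.
Qed.

Let inner_radius (r e d : R) : 0 < r -> e < r / 2 -> d <= r / 8 -> e + d < r.
Proof. by lra. Qed.

Let three_quarters (r : R) : 0 < r -> r / 2 <= 3 / 4 * r.
Proof. by lra. Qed.

(** Around [z], [de_giorgi] at level 0 for [u] and [- u] on radius r/8 bounds |u| on radius r/32,
    where [oscillation] starts. The comparison of [H x0 r] with [H z r] is needed because the tail
    is measured at [x0] and the iteration is centred at [z]. *)
Lemma local_oscillation (Th Lb : R) : 0 <= Th -> 1 <= Lb -> exists ga C : R,
  [/\ 0 < ga, ga < 1, 0 < C &
  forall (k : 'rV[R]_n -> 'rV[R]_n -> R) (H : 'rV[R]_n -> R -> R),
  phase_kernel sg ta la La k H ->
  forall (u : 'rV[R]_n -> R) (x0 : 'rV[R]_n) (r N : R),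
  measurable_fun setT u -> 0 < r -> r <= 1 -> 0 < N ->
  (forall z, eball x0 r z -> H x0 r <= Lb * H z r) ->
  (forall z r3, 0 < r3 -> enorm (z - x0) + r3 < r -> energy_ineq p k CE u z r3) ->
  (forall z r3, 0 < r3 -> enorm (z - x0) + r3 < r ->
    energy_ineq p k CE (fun x => - u x) z r3) ->
  (\int[mu]_(y in eball x0 r) (`|u y| `^ p)%:E <= (N `^ p * r ^+ n)%:E)%E ->
  {ae mu, forall x, eball x0 (5 / 8 * r) x ->
    (\int[mu]_(y in ~` eball x0 r) (`|u y| `^ (p - 1) * k x y)%:E <=
     (Th * H x0 r * N `^ (p - 1))%:E)%E} ->
  forall z, eball x0 (r / 2) z ->
  exists2 c, `|c| <= C * N & forall rho, 0 < rho -> rho <= r / 32 ->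
    {ae mu, forall x, eball z rho x -> `|u x - c| <= C * N * (rho / r) `^ ga}].
Proof.
move=> Th0 Lb1; have Lb0 : 0 < Lb by exact: lt_le_trans Lb1.
(* 128 is 4 r / s for s = r/32, the smaller of the two radii at which the tail is used. *)
have [T2 T2E] : exists x, x =
  Lb * (Th + La * 128 `^ (n%:R + ta) * (2 ^+ n + 1)) by eexists.
have T20 : 0 <= T2 by rewrite T2E; pos_tac.
have [e0 e00 DG] := de_giorgi T20.
have [ga [Lam [ga0 ga1 Lam1 OSC]]] := oscillation T20.
have Lam0 : 0 < Lam by exact: lt_le_trans Lam1.
(* Large enough that the integral over the whole ball, at most N^p r^n, passes the smallness test of
   [de_giorgi] on radius r/8. *)
have [L0 L0E] : exists x, x = 1 + 8 ^+ n / e0 by eexists.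
have L01 : 1 <= L0 by rewrite L0E lerDl; pos_tac.
have L00 : 0 < L0 by exact: lt_le_trans L01.
have L0p : 8 ^+ n <= e0 * L0 `^ p.
  apply: (@le_trans _ _ (e0 * L0)).
    by rewrite L0E mulrDr mulr1 mulrC divfK ?gt_eqF// lerDr ltW.
  by rewrite ler_wpM2l ?(ltW e00)//; apply: le1r_powR => //; exact: ltW.
(* 16 comes from [osc_limit]; 32 from replacing the reference radius r/32 by [r], as 32^ga <= 32. *)
exists ga, (16 * (Lam * L0) * 32); split => //; first by pos_tac.
move=> k H K u x0 r N mU r0 r1 N0 HLb EI EIN uN tail z x0z.
have r8 : 0 < r / 8 by rewrite divr_gt0.
have r32 : 0 < r / 32 by rewrite divr_gt0.
have r832 : r / 32 <= r / 8 by rewrite ler_pM2l// lef_pV2 ?posrE ?ler_nat.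
have r81 : r / 8 <= 1 by rewrite (le_trans _ r1)// ler_piMr ?(ltW r0)// invf_le1 ?ler1n.
have r321 : r / 32 <= 1 by exact: le_trans r81.
have x0z' : eball x0 r z by apply: subset_eballr x0z;
  rewrite ler_piMr ?(ltW r0)// invf_le1 ?ler1n.
have kap0 : 0 < L0 * N by exact: mulr_gt0.
have NL : N `^ (p - 1) <= (L0 * N) `^ (p - 1).
  by apply: ge0_ler_powR; rewrite ?nnegrE ?(ltW N0) ?(ltW kap0)// ler_peMl// ltW.
have Hs s : 0 < s -> s <= r -> H x0 r <= Lb * H z s.
  move=> s0 sr; apply: (le_trans (HLb z x0z')); rewrite ler_wpM2l ?(ltW Lb0)//.
  have rs1 : 1 <= r / s by rewrite ler_pdivlMr// mul1r.
  have := pk_scale K z s0 rs1; rewrite divfK ?gt_eqF// => /le_trans; apply.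
  rewrite ler_piMl ?(ltW (pk_H0 K z s0))// powRN invf_le1 ?powR_gt0//.
    by rewrite powR_ge1// ltW.
  exact: lt_le_trans rs1.
have tailz s : 0 < s -> s <= r / 8 -> r / 32 <= s ->
  {ae mu, forall x, eball z (3 / 4 * s) x ->
    (\int[mu]_(y in ~` eball z s) (`|u y| `^ (p - 1) * k x y)%:E <=
     (T2 * H z s * N `^ (p - 1))%:E)%E}.
  move=> s0 s8 s32; have := outer_tail K Th0 mU r0 N0 s0 s8 x0z uN tail.
  apply: filterS => x tx zx; apply: (le_trans (tx zx)); rewrite lee_fin.
  rewrite ler_wpM2r ?powR_ge0// T2E.
  apply: (@le_trans _ _ ((Th + La * 128 `^ (n%:R + ta) * (2 ^+ n + 1)) * (Lb * H z s))).
    apply: ler_pM; [by pos_tac|exact: ltW (pk_H0 K x0 r0)| |].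
      rewrite lerD2l; apply: ler_wpM2r; first by pos_tac.
      rewrite ler_wpM2l ?(ltW La0)//; apply: ge0_ler_powR; rewrite ?nnegrE//.
      - by pos_tac.
      - by pos_tac.
      rewrite ler_pdivrMr// -ler_pdivrMl// (le_trans _ s32)//.
      by rewrite le_eqVlt; apply/orP; left; apply/eqP; field.
    apply: Hs => //; apply: (le_trans s8).
    by rewrite ler_piMr ?(ltW r0)// invf_le1 ?ler1n.
  by rewrite le_eqVlt; apply/orP; left; apply/eqP; ring.
have EIz r3 : 0 < r3 -> r3 <= r / 8 -> enorm (z - x0) + r3 < r.
  by move=> _; exact: inner_radius.
have sub8 : eball z (r / 8) `<=` eball x0 r.
  by apply: subset_eball; apply: ltW; exact: inner_radius.
have Lp (w : 'rV[R]_n -> R) : (forall y, posp (w y - 0) <= `|u y|) ->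
   (\int[mu]_(x in eball z (r / 8)) (posp (w x - 0) `^ p)%:E <=
     (e0 * (L0 * N) `^ p * (r / 8) ^+ n)%:E)%E.
  move=> wu; apply: (@le_trans _ _ (N `^ p * r ^+ n)%:E).
    apply: le_trans uN; apply: ge0_subset_integral_gen => //.
      by move=> y _; rewrite lee_fin powR_ge0.
    move=> y _; rewrite lee_fin; apply: ge0_ler_powR; rewrite ?nnegrE ?posp_ge0//.
    exact: ltW.
  rewrite lee_fin powRM ?(ltW L00) ?(ltW N0)// expr_div_n.
  rewrite [leRHS](_ : _ = (e0 * L0 `^ p / 8 ^+ n) * (N `^ p * r ^+ n)); last by ring.
  by rewrite ler_peMl ?mulr_ge0 ?powR_ge0 ?exprn_ge0 ?(ltW r0)// ler_pdivlMr ?exprn_gt0// mul1r.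
have tailDG (w : 'rV[R]_n -> R) : (forall y, posp (w y - 0) <= `|u y|) ->
  {ae mu, forall x, eball z (r / 8 / 2) x ->
    (\int[mu]_(y in ~` eball z (r / 8)) (posp (w y - 0) `^ (p - 1) * k x y)%:E
      <= (T2 * H z (r / 8) * (L0 * N) `^ (p - 1))%:E)%E}.
  move=> wu; apply: filterS (tailz _ r8 (lexx _) r832) => x tx zx.
  have zx' : eball z (3 / 4 * (r / 8)) x.
    by apply: subset_eballr zx; exact: three_quarters.
  apply: (@le_trans _ _ (\int[mu]_(y in ~` eball z (r / 8))
     (`|u y| `^ (p - 1) * k x y)%:E)%E).
    apply: ge0_le_integral_gen => y _.
      by rewrite lee_fin mulr_ge0 ?powR_ge0 ?(pk_ge0 K).
    rewrite lee_fin ler_wpM2r ?(pk_ge0 K)//; apply: ge0_ler_powR => //.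
    by rewrite nnegrE posp_ge0.
  apply: (le_trans (tx zx')); rewrite lee_fin ler_wpM2l//.
  by rewrite mulr_ge0// ltW// (pk_H0 K).
have r84 : r / 8 / 4 = r / 32 by field.
have r82 : r / 8 / 2 <= r / 8 by rewrite ler_piMr ?(ltW r8)// invf_le1 ?ler1n.
have mN : measurable_fun setT (fun x => - u x) by exact: measurableT_comp.
have up : {ae mu, forall x, eball z (r / 32) x -> u x <= 0 + L0 * N}.
  rewrite -r84; apply: (DG k H K u z (r / 8) 0 (L0 * N) mU r8 r81 kap0).
  - by move=> r3 r30 r3r; apply: EI => //; apply: EIz => //; exact: le_trans r82.
  - by apply: tailDG => y; rewrite subr0 /posp ge_max ler_norm normr_ge0.
  - by apply: Lp => y; rewrite subr0 /posp ge_max ler_norm normr_ge0.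
have down : {ae mu, forall x, eball z (r / 32) x -> - u x <= 0 + L0 * N}.
  rewrite -r84; apply: (DG k H K (fun x => - u x) z (r / 8) 0 (L0 * N) mN r8 r81 kap0).
  - by move=> r3 r30 r3r; apply: EIN => //; apply: EIz => //; exact: le_trans r82.
  - by apply: tailDG => y; rewrite subr0 /posp ge_max -normrN ler_norm normr_ge0.
  - by apply: Lp => y; rewrite subr0 /posp ge_max -normrN ler_norm normr_ge0.
have bound : {ae mu, forall x, eball z (r / 32) x -> `|u x| <= L0 * N}.
  apply: filterS2 up down => x ux nux zx; rewrite ler_norml.
  by have := ux zx; have := nux zx; rewrite !add0r lerNl => -> ->.
have [c cB osc] : exists2 c, `|c| <= Lam * (L0 * N) & forall rho, 0 < rho -> rho <= r / 32 ->
    {ae mu, forall x, eball z rho x ->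
      `|u x - c| <= 16 * (Lam * (L0 * N)) * (rho / (r / 32)) `^ ga}.
  apply: osc_limit => //; first by pos_tac.
  apply: (OSC k H K u z (r / 32) (L0 * N) mU r32 r321 kap0) => //.
  - by move=> r3 r30 r3r; apply: EI => //; apply: EIz => //; exact: le_trans r832.
  - by move=> r3 r30 r3r; apply: EIN => //; apply: EIz => //; exact: le_trans r832.
  apply: filterS (tailz _ r32 r832 (lexx _)) => x tx zx; apply: (le_trans (tx zx)).
  rewrite lee_fin ler_wpM2l// mulr_ge0//.
  by rewrite ltW// (pk_H0 K).
exists c.
  apply: (le_trans cB); rewrite [leRHS](_ : _ = 512 * (Lam * (L0 * N))); last by ring.
  by rewrite ler_peMl ?ler1n//; pos_tac.
move=> rho rho0 rho32; apply: filterS (osc rho rho0 rho32) => x + zx => /(_ zx).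
move=> /le_trans; apply.
have d0 : 0 <= rho / r by rewrite divr_ge0 ?ltW.
rewrite (_ : rho / (r / 32) = 32 * (rho / r)); last by field; rewrite gt_eqF.
rewrite powRM// [leRHS](_ : _ = 16 * (Lam * (L0 * N)) * (32 * (rho / r) `^ ga)); last by ring.
rewrite ler_wpM2l//; first by pos_tac.
rewrite ler_wpM2r ?powR_ge0//.
by apply: ler1_powR; rewrite ?ler1n ?ltW.
Qed.

End iteration.

(** * The energy inequality *)

Section energy_integrand.
Context (R : realType).
Variable p : R.
Hypothesis p1 : 1 < p.
Implicit Types U V A B al be : R.

Let p0 : 0 < p. Proof. exact: lt_trans p1. Qed.
Let pm1 : 0 < p - 1. Proof. by rewrite subr_gt0. Qed.

(** An integer above [p], so that Bernoulli's inequality for natural exponents suffices; it stands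
    where [p] would appear in the mean value bound. *)
Definition slope_cst : R := (Num.truncn p).+1%:R.

Lemma slope_cst_ge1 : 1 <= slope_cst.
Proof. by rewrite /slope_cst ler1n. Qed.

Lemma bernoulli_le (q : R) (m : nat) : 0 <= q -> q <= 1 -> 1 - m%:R * (1 - q) <= q ^+ m.
Proof.
move=> q0 q1; elim: m => [|m IH]; first by rewrite mul0r subr0 expr0.
rewrite exprS -natr1; apply: (@le_trans _ _ (q * (1 - m%:R * (1 - q)))).
  have : 0 <= m%:R * (1 - q) * (1 - q) by rewrite !mulr_ge0 ?subr_ge0.
  by lra.
by rewrite ler_wpM2l.
Qed.

(** Divided by be^p this reads 1 - q^p <= m (1 - q) for q = al / be in [0, 1], and q^p >= q^m for
    the integer m above [p]. *)
Lemma powR_slope al be : 0 <= al -> al <= be ->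
  be `^ p - al `^ p <= slope_cst * be `^ (p - 1) * (be - al).
Proof.
move=> al0; rewrite le_eqVlt => /predU1P[->|albe]; first by rewrite !subrr mulr0.
have be0 : 0 < be by exact: le_lt_trans albe.
have [q0 q1] : 0 <= al / be /\ al / be <= 1.
  by rewrite divr_ge0 ?(ltW be0)// ler_pdivrMr// mul1r (ltW albe).
have -> : be `^ p - al `^ p = be `^ p * (1 - (al / be) `^ p).
  by rewrite mulrBr mulr1 -powRM ?(ltW be0)// mulrC divfK ?gt_eqF.
have -> : slope_cst * be `^ (p - 1) * (be - al) = be `^ p * (slope_cst * (1 - al / be)).
  by rewrite -(mulr_powRB1 (ltW be0) p0); field; rewrite gt_eqF.
rewrite ler_wpM2l ?powR_ge0// lerBlDl -lerBlDr.
apply: (le_trans (bernoulli_le (Num.truncn p).+1 q0 q1)).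
rewrite -(powR_mulrn _ q0); move: q0; rewrite le_eqVlt => /predU1P[<-|q0].
  by rewrite !powR0 ?gt_eqF// ltr0n.
by apply: ger_powR; rewrite ?q0 ?q1// ltW// truncnS_gt.
Qed.

(** The integrand of the equation without the kernel, tested with the truncated solution: [U], [V]
    stand for u x - l and u y - l, and [A], [B] for the p-th powers of the cutoff at the two
    points. *)
Definition energy_integrand U V A B : R :=
  `|U - V| `^ (p - 2) * (U - V) * (posp U * A - posp V * B).

Lemma monotone_power t : 0 < t -> `|t| `^ (p - 2) * t = t `^ (p - 1).
Proof.
move=> t0; rewrite gtr0_norm// -[X in _ * X](powRr1 (ltW t0)) -powRDg//.
by congr (_ `^ _); ring.
Qed.

Lemma energy_integrandC U V A B : energy_integrand U V A B = energy_integrand V U B A.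
Proof. by rewrite /energy_integrand distrC; ring. Qed.

Lemma energy_integrand_cross U V A B : V <= 0 -> 0 < U ->
  energy_integrand U V A B = (U - V) `^ (p - 1) * (U * A).
Proof.
move=> V0 U0; rewrite /energy_integrand (posp_gt0 U0) (posp_le0 V0) mul0r subr0.
by rewrite monotone_power//; lra.
Qed.

Lemma energy_integrand_ge0 U V A B : V <= 0 -> 0 <= A -> 0 <= energy_integrand U V A B.
Proof.
move=> V0 A0; have [U0|U0] := leP U 0.
  by rewrite /energy_integrand !posp_le0// !mul0r subrr mulr0.
by rewrite energy_integrand_cross// !mulr_ge0 ?powR_ge0// ltW.
Qed.

(** Here y lies outside the cutoff. A negative contribution requires V > U > 0, and then (V -
    U)^(p-1) is at most V^(p-1). *)
Lemma energy_integrand_far U V A : 0 <= A -> A <= 1 ->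
  - (posp U * posp V `^ (p - 1)) <= energy_integrand U V A 0.
Proof.
move=> A0 A1; have h0 : - (posp U * posp V `^ (p - 1)) <= 0.
  by rewrite oppr_le0 mulr_ge0 ?posp_ge0 ?powR_ge0.
have [V0|V0] := leP V 0.
  by apply: (le_trans h0); apply: energy_integrand_ge0.
have [U0|U0] := leP U 0.
  by rewrite /energy_integrand posp_le0// !mul0r mulr0 subrr mulr0 oppr0.
rewrite /energy_integrand mulr0 subr0; have [UV|VU] := leP V U.
  apply: (le_trans h0); rewrite !mulr_ge0 ?powR_ge0 ?posp_ge0// subr_ge0//.
have VU0 : 0 < V - U by rewrite subr_gt0.
rewrite distrC -[U - V]opprB mulrN monotone_power// mulNr lerN2 mulrC.
rewrite !posp_gt0//; apply: ler_pM; rewrite ?powR_ge0//.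
- by rewrite mulr_ge0// ltW.
- by rewrite ler_piMr// ltW.
by apply: ge0_ler_powR; rewrite ?nnegrE ?(ltW pm1) ?(ltW V0) ?(ltW VU0)//; lra.
Qed.

(* With X = (U - V) be and D = m U |al - be|, the integrand is at least
   X^(p-1) (X - D), which is negative only if X < D. *)
Let energy_integrand_ordered U V al be : 0 < V -> V <= U -> 0 <= al -> 0 <= be ->
  - ((slope_cst * U * `|al - be|) `^ p) <= energy_integrand U V (al `^ p) (be `^ p).
Proof.
move=> V0; have m0 : 0 < slope_cst by exact: lt_le_trans slope_cst_ge1.
rewrite le_eqVlt => /predU1P[<-|VU] al0 be0.
  by rewrite /energy_integrand subrr mulr0 mul0r oppr_le0 powR_ge0.
have U0 : 0 < U by exact: lt_trans VU.
have UV : 0 < U - V by rewrite subr_gt0.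
rewrite /energy_integrand monotone_power// !posp_gt0//.
have [ba|ab] := leP be al.
  rewrite (@le_trans _ _ 0)// ?oppr_le0 ?powR_ge0// mulr_ge0 ?powR_ge0// subr_ge0.
  apply: ler_pM; rewrite ?powR_ge0 ?(ltW V0) ?(ltW VU)//.
  by apply: ge0_ler_powR; rewrite ?nnegrE ?(ltW p0).
have be_gt0 : 0 < be by exact: le_lt_trans ab.
have [X XE] : exists X, X = (U - V) * be by eexists.
have [D DE] : exists D, D = slope_cst * U * (be - al) by eexists.
have X0 : 0 < X by rewrite XE mulr_gt0.
have D0 : 0 < D by rewrite DE !mulr_gt0// subr_gt0.
rewrite distrC gtr0_norm ?subr_gt0// -DE.
apply: (@le_trans _ _ (X `^ (p - 1) * (X - D))).
  have [DX|XD] := leP D X.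
    rewrite (@le_trans _ _ 0)// ?oppr_le0 ?powR_ge0// mulr_ge0 ?powR_ge0// subr_ge0//.
  rewrite -(mulr_powRB1 (ltW D0) p0) lerNl -mulrN opprB mulrC.
  apply: ler_pM; rewrite ?powR_ge0//; first by rewrite subr_ge0 ltW.
    by rewrite lerBlDr lerDl ltW.
  by apply: ge0_ler_powR; rewrite ?nnegrE ?(ltW pm1) ?(ltW X0) ?(ltW D0)// ltW.
rewrite {1}XE powRM ?(ltW UV)// -mulrA ler_wpM2l ?powR_ge0//.
have slope : U * (be `^ p - al `^ p) <= U * (slope_cst * be `^ (p - 1) * (be - al)).
  by rewrite ler_pM2l//; apply: powR_slope => //; exact: ltW.
apply: (@le_trans _ _ ((U - V) * be `^ p - U * (be `^ p - al `^ p))); last by lra.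
rewrite mulrBr; apply: lerB.
  by rewrite XE mulrCA [be `^ _ * be]mulrC mulr_powRB1// ltW.
by apply: (le_trans slope); rewrite DE; lra.
Qed.

Lemma energy_integrand_near U V al be : 0 <= al -> 0 <= be ->
  - (slope_cst `^ p * (posp U `^ p + posp V `^ p) * `|al - be| `^ p) <=
  energy_integrand U V (al `^ p) (be `^ p).
Proof.
have m0 : 0 < slope_cst by exact: lt_le_trans slope_cst_ge1.
wlog VU : U V al be / V <= U.
  move=> h al0 be0; have [VU|/ltW UV] := leP V U; first exact: h.
  by rewrite energy_integrandC distrC addrC h.
move=> al0 be0.
have h0 : - (slope_cst `^ p * (posp U `^ p + posp V `^ p) * `|al - be| `^ p) <= 0.
  by rewrite oppr_le0 !mulr_ge0 ?addr_ge0 ?powR_ge0.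
have [V0|V0] := leP V 0.
  by apply: (le_trans h0); apply: energy_integrand_ge0 => //; exact: powR_ge0.
have U0 : 0 < U by exact: lt_le_trans VU.
apply: le_trans (energy_integrand_ordered V0 VU al0 be0).
rewrite !powRM ?mulr_ge0 ?(ltW m0) ?(ltW U0)// lerN2 ler_wpM2r ?powR_ge0//.
by rewrite ler_wpM2l ?powR_ge0// posp_gt0// lerDl powR_ge0.
Qed.

End energy_integrand.

(** * Tonelli's theorem on rectangles *)

Section iterated_integrals.
Context d1 d2 (T1 : measurableType d1) (T2 : measurableType d2) (R : realType).
Variables (m1 : {sigma_finite_measure set T1 -> \bar R}).
Variables (m2 : {sigma_finite_measure set T2 -> \bar R}).
Local Open Scope ereal_scope.

Lemma integral_indicM d (T : measurableType d) (m : {measure set T -> \bar R})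
    (D A : set T) (f : T -> R) :
  \int[m]_(x in D) ((\1_A x : R) * f x)%:E = \int[m]_(x in D `&` A) (f x)%:E.
Proof.
rewrite integral_mkcondr; apply: eq_integral => x _; rewrite patchE indicE.
by case: ifPn => _; rewrite ?mul1r ?mul0r.
Qed.

Lemma integralD_fin d (T : measurableType d) (m : {measure set T -> \bar R})
    (D : set T) (f g : T -> R) : measurable D ->
  measurable_fun setT f -> measurable_fun setT g ->
  (forall x, 0 <= f x)%R -> (forall x, 0 <= g x)%R ->
  \int[m]_(x in D) (f x + g x)%:E = \int[m]_(x in D) (f x)%:E + \int[m]_(x in D) (g x)%:E.
Proof.
move=> mD mf mg f0 g0; under eq_integral do rewrite EFinD.
rewrite ge0_integralD//.
- by move=> x _; rewrite lee_fin.
- by apply/measurable_EFinP; exact: measurable_funTS.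
- by move=> x _; rewrite lee_fin.
by apply/measurable_EFinP; exact: measurable_funTS.
Qed.

Lemma integral_rectangle (A : set T1) (B : set T2) (f : T1 * T2 -> R) :
  measurable A -> measurable B -> measurable_fun setT f -> (forall z, (0 <= f z)%R) ->
  \int[m1 \x m2]_(z in A `*` B) (f z)%:E =
  \int[m1]_(x in A) \int[m2]_(y in B) (f (x, y))%:E.
Proof.
move=> mA mB mf f0; have mAB : measurable (A `*` B) by exact: measurableX.
rewrite -[A `*` B]setTI -integral_indicM fubini_tonelli1; last 2 first.
- by apply/measurable_EFinP; apply: measurable_funM.
- by move=> z; rewrite lee_fin mulr_ge0.
rewrite [RHS]integral_mkcond; apply: eq_integral => x _; rewrite /fubini_F patchE.
case: ifPn => xA.
  rewrite -[B in RHS]setTI -integral_indicM; apply: eq_integral => y _.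
  by rewrite !indicE in_setX/= xA.
apply: integral0_eq => y _; rewrite indicE in_setX/= (negbTE xA).
by rewrite mul0r.
Qed.

Lemma integral_rectangle_swap (A : set T1) (B : set T2) (f : T1 * T2 -> R) :
  measurable A -> measurable B -> measurable_fun setT f -> (forall z, (0 <= f z)%R) ->
  \int[m1 \x m2]_(z in A `*` B) (f z)%:E =
  \int[m2]_(y in B) \int[m1]_(x in A) (f (x, y))%:E.
Proof.
move=> mA mB mf f0; have mAB : measurable (A `*` B) by exact: measurableX.
rewrite -[A `*` B]setTI -integral_indicM fubini_tonelli2; last 2 first.
- by apply/measurable_EFinP; apply: measurable_funM.
- by move=> z; rewrite lee_fin mulr_ge0.
rewrite [RHS]integral_mkcond; apply: eq_integral => y _; rewrite /fubini_G patchE.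
case: ifPn => yB.
  rewrite -[A in RHS]setTI -integral_indicM; apply: eq_integral => x _.
  by rewrite !indicE in_setX/= yB andbT.
apply: integral0_eq => x _; rewrite indicE in_setX/= (negbTE yB) andbF.
by rewrite mul0r.
Qed.

End iterated_integrals.

(** * Admissible test functions and the Caccioppoli inequality *)

Section caccioppoli.
Context (R : realType) (n : nat).
Variables (sg ta p la La lK uK : R).
Hypotheses (sg0 : 0 < sg) (sgta : sg <= ta) (tap : ta < p) (p1 : 1 < p).
Hypotheses (La0 : 0 < La) (lK0 : 0 < lK) (lKuK : lK <= uK).
Local Notation mu := (lebesgue_rV R n).
Local Notation mu2 := (lebesgue_rV R n \x lebesgue_rV R n)%E.
Variables (k : 'rV[R]_n -> 'rV[R]_n -> R) (H : 'rV[R]_n -> R -> R).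
Hypothesis Kk : phase_kernel sg ta la La k H.
Variable K : 'rV[R]_n * 'rV[R]_n -> R.
Hypothesis mK : measurable_fun setT K.
Hypothesis Kae : {ae mu2, forall z, z.1 != z.2 ->
  lK * k z.1 z.2 <= K z <= uK * k z.1 z.2}.
Implicit Types (Omega : set 'rV[R]_n) (u v phi : 'rV[R]_n -> R).

Let p0 : 0 < p. Proof. exact: lt_trans p1. Qed.
Let pm1 : 0 <= p - 1. Proof. by rewrite subr_ge0 ltW. Qed.
Let uK0 : 0 < uK. Proof. exact: lt_le_trans lKuK. Qed.

Definition cutoff (z : 'rV[R]_n) (r1 r2 : R) (x : 'rV[R]_n) : R :=
  posp (Num.min 1 ((r2 - enorm (x - z)) / (r2 - r1))).

Lemma cutoff_ge0 z r1 r2 x : 0 <= cutoff z r1 r2 x.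
Proof. exact: posp_ge0. Qed.

Lemma cutoff_le1 z r1 r2 x : cutoff z r1 r2 x <= 1.
Proof. by rewrite /cutoff /posp ge_max ge_min lexx ler01. Qed.

Lemma cutoff1 z r1 r2 x : r1 < r2 -> eball z r1 x -> cutoff z r1 r2 x = 1.
Proof.
move=> r12; rewrite /eball/= => zx; have d0 : 0 < r2 - r1 by rewrite subr_gt0.
have : 1 <= (r2 - enorm (x - z)) / (r2 - r1) by rewrite ler_pdivlMr//; lra.
by rewrite /cutoff => /min_idPl ->; rewrite posp_gt0.
Qed.

Lemma cutoff0 z r1 r2 x : r1 < r2 -> ~ eball z r2 x -> cutoff z r1 r2 x = 0.
Proof.
move=> r12 /negP; rewrite -leNgt => zx; have d0 : 0 < r2 - r1 by rewrite subr_gt0.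
by rewrite /cutoff posp_le0// ge_min pmulr_lle0 ?invr_gt0// subr_le0 zx orbT.
Qed.

Let truncation_lipschitz (a b : R) :
  `|posp (Num.min 1 a) - posp (Num.min 1 b)| <= `|a - b|.
Proof.
wlog ab : a b / a <= b.
  by move=> h; have [/h //|/ltW/h] := leP a b; rewrite distrC [in leRHS]distrC.
rewrite distrC [in leRHS]distrC [leRHS]ger0_norm ?subr_ge0// ger0_norm; last first.
  by rewrite subr_ge0 ler_posp// le_min !ge_min lexx ab orbT.
have m1 : Num.min 1 b <= Num.min 1 a + (b - a).
  rewrite -lerBlDr le_min; have : Num.min 1 b <= 1 by rewrite ge_min lexx.
  have : Num.min 1 b <= b by rewrite ge_min lexx orbT.
  by move=> b1 b2; apply/andP; split; lra.
have a1 := posp_ge (Num.min 1 a); have a2 := posp_ge0 (Num.min 1 a).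
by rewrite lerBlDr {1}/posp ge_max; apply/andP; split; lra.
Qed.

Lemma cutoff_lipschitz z r1 r2 x y : r1 < r2 ->
  `|cutoff z r1 r2 x - cutoff z r1 r2 y| <= enorm (x - y) / (r2 - r1).
Proof.
move=> r12; have d0 : 0 < r2 - r1 by rewrite subr_gt0.
apply: (le_trans (truncation_lipschitz _ _)).
rewrite -mulrBl normrM (@gtr0_norm _ (_^-1)) ?invr_gt0//.
rewrite ler_wpM2r ?invr_ge0 ?(ltW d0)// ler_norml.
have := ler_enormB x y z; have := ler_enormB y x z; rewrite (enormC y x).
by lra.
Qed.

Lemma measurable_cutoff z r1 r2 : measurable_fun setT (cutoff z r1 r2).
Proof.
apply: measurable_maxr => //; apply: measurable_minr => //.
apply: measurable_funM => //; apply: measurable_funB => //.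
by apply: measurable_enorm; exact: measurable_fun_subrV.
Qed.

Definition kernel_energy Omega phi : \bar R :=
  (\int[mu2]_(z in interaction_set Omega) (`|phi z.1 - phi z.2| `^ p * k z.1 z.2)%:E)%E.

(** The equation for Borel data: test functions are Borel, vanish at every point outside [Omega],
    and have finite energy for the regular kernel [k], while [K] is only comparable to [k] almost
    everywhere. *)
Definition weak_form Omega u : Prop := forall phi, measurable_fun setT phi ->
  (forall x, ~ Omega x -> phi x = 0) ->
  (\int[mu]_(x in Omega) (`|phi x| `^ p)%:E < +oo)%E ->
  (kernel_energy Omega phi < +oo)%E ->
  (\int[mu2]_(z in interaction_set Omega)
     (`|u z.1 - u z.2| `^ (p - 2) * (u z.1 - u z.2) * (phi z.1 - phi z.2) * K z)%:E = 0)%E.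

Lemma kernel_energyN Omega u : kernel_energy Omega (fun x => - u x) = kernel_energy Omega u.
Proof. by rewrite /kernel_energy; under eq_integral do rewrite -opprD normrN. Qed.

Lemma weak_formN Omega u : weak_form Omega u -> weak_form Omega (fun x => - u x).
Proof.
move=> wu phi mphi phi0 phip phiE.
rewrite -[RHS](wu (fun x => - phi x)); first 1 last.
- exact: measurableT_comp.
- by move=> x /phi0 ->; rewrite oppr0.
- by under eq_integral do rewrite normrN.
- by rewrite kernel_energyN.
apply: eq_integral => z _; congr EFin.
rewrite (_ : - u z.1 - - u z.2 = - (u z.1 - u z.2)); last by ring.
by rewrite normrN; ring.
Qed.

(* Split at distance 1: the increment is at most [enorm (x - y) / d] near [x] and
   at most [1 <= enorm (x - y) `^ (sg / 2)] away from [x]. *)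
Lemma cutoff_integral_le (d M : R) (x : 'rV[R]_n) : 0 < d -> H x 1 <= M ->
  (\int[mu]_y ((Num.min 1 (enorm (x - y) / d)) `^ p * k x y)%:E <=
   ((near_cst n ta p La / d `^ p + far_cst n sg ta La) * M)%:E)%E.
Proof.
move=> d0 HM.
have mk := measurable_kernelr Kk x.
have mdist : measurable_fun setT (fun y : 'rV[R]_n => enorm (x - y)).
  by apply: measurable_enorm; exact: measurable_fun_subrV.
have mf : measurable_fun setT (fun y : 'rV[R]_n => (Num.min 1 (enorm (x - y) / d)) `^ p * k x y).
  apply: measurable_funM => //; apply: (measurableT_comp (measurable_powR _)).
  by apply: measurable_minr => //; exact: measurable_funM.
have h0 (y : 'rV[R]_n) : 0 <= Num.min 1 (enorm (x - y) / d).
  by rewrite le_min ler01 divr_ge0 ?enorm_ge0// ltW.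
have f0 (y : 'rV[R]_n) : 0 <= (Num.min 1 (enorm (x - y) / d)) `^ p * k x y.
  by rewrite mulr_ge0 ?powR_ge0 ?(pk_ge0 Kk).
have H0 := pk_H0 Kk x (@ltr01 R).
have nc := near_cst_ge0 n tap La0; have fc := far_cst_ge0 n ta sg0 La0.
apply: le_trans (ge0_integral_setU_le mu (measurable_eball x 1)
  (measurableC (measurable_eball x 1)) mf f0 _) _.
  by move=> y _; have [?|?] := pselect (eball x 1 y); [left|right].
rewrite mulrDl EFinD; apply: leeD.
  apply: (@le_trans _ _ (\int[mu]_(y in eball x 1)
      ((d `^ p)^-1 * (enorm (x - y) `^ p * k x y))%:E)%E).
    apply: ge0_le_integral_gen => y _; rewrite lee_fin// mulrA.
    rewrite ler_wpM2r ?(pk_ge0 Kk)//.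
    apply: (@le_trans _ _ ((enorm (x - y) / d) `^ p)).
      by rewrite ge0_ler_powR ?nnegrE ?(ltW p0) ?divr_ge0 ?enorm_ge0 ?(ltW d0)// ge_min lexx orbT.
    by rewrite powR_div ?enorm_ge0 ?(ltW d0)// mulrC.
  rewrite integralZl_fin//; last 4 first.
  - exact: measurable_eball.
  - by apply: measurable_funM => //; exact: (measurableT_comp (measurable_powR _)).
  - by move=> y; rewrite mulr_ge0 ?powR_ge0 ?(pk_ge0 Kk).
  - by rewrite invr_ge0 powR_ge0.
  rewrite (mulrC (near_cst _ _ _ _)) -mulrA EFinM lee_wpmul2l ?lee_fin ?invr_ge0 ?powR_ge0//.
  apply: (le_trans (near_integral_le sg0 sgta tap p1 La0 Kk ltr01 (eball_center x ltr01))).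
  by rewrite lee_fin powR1 mulr1 ler_wpM2l.
apply: (@le_trans _ _ (far_cst n sg ta La * H x 1)%:E); last first.
  by rewrite lee_fin ler_wpM2l.
have xx : eball x (3 / 4 * 1) x by apply: eball_center; lra.
apply: le_trans (far_integral_le sg0 sgta La0 Kk ltr01 xx).
apply: ge0_le_integral_gen => y; first by rewrite lee_fin.
rewrite /setC/eball/= => /negP; rewrite -leNgt => xy.
rewrite lee_fin mulrC ler_wpM2l ?(pk_ge0 Kk)// divr1.
apply: (@le_trans _ _ 1); last by rewrite powR_ge1// divr_ge0// ltW.
apply: (@le_trans _ _ (1 `^ p)); last by rewrite powR1.
rewrite ge0_ler_powR ?nnegrE ?(ltW p0)//.
by rewrite ge_min lexx.
Qed.

Lemma posp_lipschitz (a b : R) : `|posp a - posp b| <= `|a - b|.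
Proof.
wlog ab : a b / a <= b.
  by move=> h; have [/h //|/ltW/h] := leP a b; rewrite distrC [in leRHS]distrC.
rewrite distrC [in leRHS]distrC [leRHS]ger0_norm ?subr_ge0// ger0_norm; last first.
  by rewrite subr_ge0 ler_posp.
have a1 := posp_ge a; have a2 := posp_ge0 a.
by rewrite lerBlDr {1}/posp ge_max; apply/andP; split; lra.
Qed.

Let powR_cutoff (a b : R) : 0 <= a -> a <= 1 -> 0 <= b -> b <= 1 ->
  `|a `^ p - b `^ p| <= slope_cst p * `|a - b|.
Proof.
wlog ab : a b / a <= b.
  move=> h a0 a1 b0 b1; have [ab|/ltW ba] := leP a b; first exact: h.
  by rewrite distrC (distrC a); exact: h.
move=> a0 a1 b0 b1; rewrite distrC (distrC a) !ger0_norm ?subr_ge0//; last first.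
  by rewrite ge0_ler_powR ?nnegrE ?(ltW p0).
apply: (le_trans (powR_slope p1 a0 ab)).
rewrite ler_wpM2r ?subr_ge0// ler_piMr//.
apply: (@le_trans _ _ (1 `^ (p - 1))); last by rewrite powR1.
by rewrite ge0_ler_powR ?nnegrE.
Qed.

(** Energy density of a cutoff of slope 1/d, truncated at 1. Its integral in one variable is bounded
    uniformly in the other. *)
Definition near_weight (d : R) (x y : 'rV[R]_n) : R :=
  (Num.min 1 (enorm (x - y) / d)) `^ p * k x y.

Let near_weight_ge0 d x y : 0 <= near_weight d x y.
Proof. by rewrite mulr_ge0 ?powR_ge0 ?(pk_ge0 Kk). Qed.

Let measurable_dist : measurable_fun setT
  (fun z : 'rV[R]_n * 'rV[R]_n => enorm (z.1 - z.2)).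
Proof.
by apply: measurable_enorm; apply: measurable_fun_subrV;
  [exact: measurable_fst|exact: measurable_snd].
Qed.

Let measurable_near_weight d :
  measurable_fun setT (fun z : 'rV[R]_n * 'rV[R]_n => near_weight d z.1 z.2).
Proof.
apply: measurable_funM; last exact: (pk_meas Kk).
apply: (measurableT_comp (measurable_powR _)).
by apply: measurable_minr => //; exact: measurable_funM.
Qed.

Let near_weight_integral (d M : R) (W : 'rV[R]_n -> R) : 0 < d ->
  (forall x, H x 1 <= M) -> measurable_fun setT W -> (forall x, 0 <= W x) ->
  (\int[mu]_x (W x)%:E < +oo)%E ->
  (\int[mu2]_z (W z.1 * near_weight d z.1 z.2)%:E < +oo)%E /\
  (\int[mu2]_z (W z.2 * near_weight d z.1 z.2)%:E < +oo)%E.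
Proof.
move=> d0 HM mW W0 WI.
pose C := (near_cst n ta p La / d `^ p + far_cst n sg ta La) * M.
have C0 : 0 <= C.
  have nc := near_cst_ge0 n tap La0; have fc := far_cst_ge0 n ta sg0 La0.
  rewrite mulr_ge0//; first by rewrite addr_ge0// divr_ge0// powR_ge0.
  by apply: le_trans (HM 0); exact: ltW (pk_H0 Kk 0 ltr01).
have m1 : measurable_fun setT (fun z : 'rV[R]_n * 'rV[R]_n => W z.1 * near_weight d z.1 z.2).
  by apply: measurable_funM => //; exact: (measurableT_comp mW measurable_fst).
have m2 : measurable_fun setT (fun z : 'rV[R]_n * 'rV[R]_n => W z.2 * near_weight d z.1 z.2).
  by apply: measurable_funM => //; exact: (measurableT_comp mW measurable_snd).
have key : (\int[mu]_(x in setT) \int[mu]_(y in setT) (W x * near_weight d x y)%:E < +oo)%E.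
  apply: (@le_lt_trans _ _ (\int[mu]_x (C * W x)%:E)%E); last first.
    by rewrite integralZl_fin// lte_mul_pinfty.
  apply: ge0_le_integral_gen => x _.
    by apply: integral_ge0 => y _; rewrite lee_fin mulr_ge0.
  rewrite integralZl_fin//.
    rewrite (mulrC C) EFinM lee_wpmul2l ?lee_fin//.
    exact: cutoff_integral_le.
  exact: (measurableT_comp (measurable_near_weight d) (pair1_measurable x)).
split; rewrite -setXTT.
  rewrite (integral_rectangle mu mu measurableT measurableT m1)// => z.
  by rewrite mulr_ge0.
rewrite (integral_rectangle_swap mu mu measurableT measurableT m2); last first.
  by move=> z; rewrite mulr_ge0.
apply: le_lt_trans key; apply: ge0_le_integral_gen => x _.
  by apply: integral_ge0 => y _; rewrite lee_fin mulr_ge0.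
apply: ge0_le_integral_gen => y _ /=; first by rewrite lee_fin mulr_ge0.
by rewrite lee_fin /near_weight (pk_sym Kk) enormC.
Qed.

Lemma measurable_interaction_set Omega : measurable Omega ->
  measurable (interaction_set Omega).
Proof.
move=> mO; apply: measurableC; apply: measurableX; exact: measurableC.
Qed.

Definition test_function u (z : 'rV[R]_n) (r1 r2 l : R) (x : 'rV[R]_n) : R :=
  posp (u x - l) * cutoff z r1 r2 x `^ p.

Lemma measurable_test_function u z r1 r2 l : measurable_fun setT u ->
  measurable_fun setT (test_function u z r1 r2 l).
Proof.
move=> mU; apply: measurable_funM; first exact: measurable_posp.
by apply: (measurableT_comp (measurable_powR _)); exact: measurable_cutoff.
Qed.

Lemma test_function0 u z r1 r2 l x : r1 < r2 -> ~ eball z r2 x ->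
  test_function u z r1 r2 l x = 0.
Proof. by move=> r12 zx; rewrite /test_function cutoff0// powR0 ?mulr0// gt_eqF. Qed.

Let ball_excess u z r2 l x : R := \1_(eball z r2) x * posp (u x - l).

(** Product rule: the increment of the excess, at most |u x - u y|, plus the excess at a point of
    the ball times the increment of the cutoff. By symmetry that point is [x]; if neither point is
    in the ball, both values vanish. *)
Let test_function_diff u z r1 r2 l x y : r1 < r2 ->
  `|test_function u z r1 r2 l x - test_function u z r1 r2 l y| <=
  `|u x - u y| + slope_cst p * ball_excess u z r2 l x * Num.min 1 (enorm (x - y) / (r2 - r1))
    + slope_cst p * ball_excess u z r2 l y * Num.min 1 (enorm (x - y) / (r2 - r1)).
Proof.
have [W WE] : exists W, W = ball_excess u z r2 l by eexists.
rewrite -WE; move=> r12; have d0 : 0 < r2 - r1 by rewrite subr_gt0.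
have m0 : 0 <= slope_cst p by rewrite (le_trans ler01)// slope_cst_ge1.
have W0 t : 0 <= W t by rewrite WE mulr_ge0 ?posp_ge0// indicE ler0n.
have D0 x' y' : 0 <= Num.min 1 (enorm (x' - y' : 'rV[R]_n) / (r2 - r1)).
  by rewrite le_min ler01 divr_ge0 ?enorm_ge0// ltW.
wlog zx : x y / eball z r2 x => [h|].
  have [zx|nzx] := pselect (eball z r2 x); first exact: h.
  have [zy|nzy] := pselect (eball z r2 y).
    rewrite (distrC (test_function _ _ _ _ _ x)) (distrC (u x)) (enormC x) addrAC.
    exact: h.
  by rewrite !test_function0// subrr normr0 !addr_ge0 ?mulr_ge0// D0.
have {}D0 := D0 x y.
apply: (@le_trans _ _ (`|u x - u y| +
    slope_cst p * W x * Num.min 1 (enorm (x - y) / (r2 - r1)))); last first.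
  by rewrite lerDl !mulr_ge0.
rewrite /test_function; set A := cutoff _ _ _ x; set B := cutoff _ _ _ y.
have product_diff (a b c d : R) : a * c - b * d = (a - b) * d + a * (c - d) by ring.
rewrite product_diff.
apply: (le_trans (ler_normD _ _)); rewrite !normrM; apply: lerD.
  apply: (@le_trans _ _ (`|u x - u y| * 1)); last by rewrite mulr1.
  apply: ler_pM => //.
    by apply: (le_trans (posp_lipschitz _ _)); rewrite opprB addrA subrK.
  rewrite ger0_norm ?powR_ge0//; apply: (@le_trans _ _ (1 `^ p)); last by rewrite powR1.
  by rewrite ge0_ler_powR ?nnegrE ?(ltW p0) ?cutoff_ge0 ?cutoff_le1.
rewrite WE /ball_excess indicE mem_set// mul1r ger0_norm ?posp_ge0//.
rewrite [leRHS](_ : _ = posp (u x - l) *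
  (slope_cst p * Num.min 1 (enorm (x - y) / (r2 - r1)))); last by ring.
rewrite ler_wpM2l ?posp_ge0//.
apply: (le_trans (powR_cutoff _ _ _ _)); rewrite ?cutoff_ge0 ?cutoff_le1//.
rewrite ler_wpM2l// le_min cutoff_lipschitz// andbT.
have := cutoff_ge0 z r1 r2 x; have := cutoff_le1 z r1 r2 x.
have := cutoff_ge0 z r1 r2 y; have := cutoff_le1 z r1 r2 y.
by rewrite -/A -/B => *; rewrite ler_norml; apply/andP; split; lra.
Qed.

(** The first term of [test_function_diff] is paid by the energy of [u]. The other two are
    integrable over all pairs by [near_weight_integral], because the excess on the ball is in L^p:
    [u] is, and the ball has finite volume. *)
Lemma test_function_admissible Omega u z r1 r2 l M : measurable Omega ->
  measurable_fun setT u -> (\int[mu]_(x in Omega) (`|u x| `^ p)%:E < +oo)%E ->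
  (kernel_energy Omega u < +oo)%E -> (forall x, H x 1 <= M) -> r1 < r2 ->
  eball z r2 `<=` Omega ->
  (\int[mu]_(x in Omega) (`|test_function u z r1 r2 l x| `^ p)%:E < +oo)%E /\
  (kernel_energy Omega (test_function u z r1 r2 l) < +oo)%E.
Proof.
move=> mO mU uI uE HM r12 zO; have d0 : 0 < r2 - r1 by rewrite subr_gt0.
have mB := measurable_eball z r2.
have m1 : 1 <= slope_cst p := slope_cst_ge1 p.
have m0 : 0 <= slope_cst p by exact: le_trans m1.
have [W WE] : exists W, W = ball_excess u z r2 l by eexists.
have W0 t : 0 <= W t by rewrite WE mulr_ge0 ?posp_ge0// indicE ler0n.
have mW : measurable_fun setT W.
  by rewrite WE; apply: measurable_funM; [exact: measurable_indic|exact: measurable_posp].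
have mWp : measurable_fun setT (fun x => W x `^ p).
  exact: (measurableT_comp (measurable_powR _)).
have mup : measurable_fun setT (fun x => `|u x| `^ p).
  by apply: (measurableT_comp (measurable_powR _)); exact: measurableT_comp.
have Wp : (\int[mu]_x (W x `^ p)%:E < +oo)%E.
  pose c := 2 `^ p : R; have c0 : 0 <= c by exact: powR_ge0.
  apply: (@le_lt_trans _ _ (\int[mu]_(x in eball z r2)
      (c * (`|u x| `^ p + `|l| `^ p))%:E)%E).
    rewrite -[eball z r2]setTI -integral_indicM; apply: ge0_le_integral_gen => x _.
      by rewrite lee_fin powR_ge0.
    rewrite lee_fin WE /ball_excess indicE; case: (x \in _); last first.
      by rewrite !mul0r powR0// gt_eqF.
    rewrite !mul1r; apply: le_trans (powR_addle _ _ (ltW p0)) => //.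
    rewrite ge0_ler_powR ?nnegrE ?(ltW p0) ?posp_ge0 ?addr_ge0//.
    rewrite /posp ge_max addr_ge0// andbT.
    by apply: (le_trans (ler_norm _)); exact: ler_normB.
  rewrite integralZl_fin//; last exact: measurable_funD.
  apply: lte_mul_pinfty => //.
  under eq_integral do rewrite EFinD.
  rewrite ge0_integralD//; last by apply/measurable_EFinP; exact: measurable_funTS.
  apply: lte_add_pinfty.
    by apply: le_lt_trans uI; apply: ge0_subset_integral_gen.
  by rewrite integral_cst// lte_mul_pinfty ?lee_fin ?powR_ge0// eball_vol_fin.
split.
  apply: le_lt_trans Wp; apply: ge0_subset_integral_gen => //.
    by move=> x _; rewrite lee_fin powR_ge0.
  move=> x _; rewrite lee_fin ge0_ler_powR ?nnegrE ?(ltW p0)//.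
  have [zx|nzx] := pselect (eball z r2 x); last by rewrite test_function0// normr0.
  rewrite WE /ball_excess indicE mem_set// mul1r /test_function ger0_norm ?mulr_ge0 ?posp_ge0
    ?powR_ge0//.
  rewrite ler_piMr ?posp_ge0//; apply: (@le_trans _ _ (1 `^ p)); last by rewrite powR1.
  by rewrite ge0_ler_powR ?nnegrE ?(ltW p0) ?cutoff_ge0 ?cutoff_le1.
have [N1 N2] := near_weight_integral d0 HM mWp (fun x => powR_ge0 _ _) Wp.
pose f1 z := `|u z.1 - u z.2| `^ p * k z.1 z.2.
pose f2 z := W z.1 `^ p * near_weight (r2 - r1) z.1 z.2.
pose f3 z := W z.2 `^ p * near_weight (r2 - r1) z.1 z.2.
have f10 z' : 0 <= f1 z' by rewrite mulr_ge0 ?powR_ge0 ?(pk_ge0 Kk).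
have f20 z' : 0 <= f2 z' by rewrite mulr_ge0 ?powR_ge0.
have f30 z' : 0 <= f3 z' by rewrite mulr_ge0 ?powR_ge0.
have mf1 : measurable_fun setT f1.
  apply: measurable_funM; last exact: (pk_meas Kk).
  apply: (measurableT_comp (measurable_powR _)); apply: measurableT_comp => //.
  apply: measurable_funB; first exact: (measurableT_comp mU measurable_fst).
  exact: (measurableT_comp mU measurable_snd).
have mf2 : measurable_fun setT f2.
  by apply: measurable_funM => //; exact: (measurableT_comp mWp measurable_fst).
have mf3 : measurable_fun setT f3.
  by apply: measurable_funM => //; exact: (measurableT_comp mWp measurable_snd).
pose c := 4 `^ p * slope_cst p `^ p.
have c0 : 0 <= c by rewrite mulr_ge0 ?powR_ge0.
have mI := measurable_interaction_set mO.
apply: (@le_lt_trans _ _ (\int[mu2]_(z in interaction_set Omega) (c * (f1 z + f2 z + f3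
  z))%:E)%E).
  apply: ge0_le_integral_gen => -[x y] _ /=.
    by rewrite lee_fin mulr_ge0 ?powR_ge0 ?(pk_ge0 Kk).
  rewrite lee_fin /f1 /f2 /f3 /near_weight/=.
  rewrite [leRHS](_ : _ = c * (`|u x - u y| `^ p +
    W x `^ p * (Num.min 1 (enorm (x - y) / (r2 - r1))) `^ p +
    W y `^ p * (Num.min 1 (enorm (x - y) / (r2 - r1))) `^ p) * k x y); last by ring.
  rewrite ler_wpM2r ?(pk_ge0 Kk)//.
  have D0 : 0 <= Num.min 1 (enorm (x - y) / (r2 - r1)).
    by rewrite le_min ler01 divr_ge0 ?enorm_ge0// ltW.
  have b1 : 0 <= slope_cst p * W x * Num.min 1 (enorm (x - y) / (r2 - r1)).
    by rewrite !mulr_ge0.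
  have b2 : 0 <= slope_cst p * W y * Num.min 1 (enorm (x - y) / (r2 - r1)).
    by rewrite !mulr_ge0.
  apply: (@le_trans _ _ ((`|u x - u y| + slope_cst p * W x * Num.min 1 (enorm (x - y) / (r2 - r1))
    + slope_cst p * W y * Num.min 1 (enorm (x - y) / (r2 - r1))) `^ p)).
    rewrite ge0_ler_powR ?nnegrE ?(ltW p0) ?addr_ge0//.
    by rewrite WE; exact: test_function_diff.
  apply: (le_trans (powR_add3le _ _ _ (ltW p0))) => //.
  rewrite /c -[leRHS]mulrA ler_wpM2l ?powR_ge0// !powRM ?mulr_ge0// !mulrDr !mulrA.
  rewrite !lerD2r ler_peMl ?powR_ge0//.
  by rewrite powR_ge1// ltW.
rewrite integralZl_fin//; last 2 first.
- by do 2 apply: measurable_funD => //.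
- by move=> z'; rewrite !addr_ge0.
apply: lte_mul_pinfty => //.
under eq_integral do rewrite !EFinD.
have mEF (f : 'rV[R]_n * 'rV[R]_n -> R) : measurable_fun setT f ->
    measurable_fun (interaction_set Omega) (fun z => (f z)%:E).
  by move=> mf; apply/measurable_EFinP; exact: measurable_funTS.
rewrite ge0_integralD//; first last.
- exact: mEF.
- by move=> z' _; rewrite lee_fin.
- by apply: (mEF (fun z => f1 z + f2 z)); exact: measurable_funD.
- by move=> z' _; rewrite -EFinD lee_fin addr_ge0.
apply: lte_add_pinfty; last first.
  apply: le_lt_trans N2; apply: ge0_subset_integral_gen => //;
  by move=> z' _; rewrite lee_fin; exact: f30.
rewrite ge0_integralD//; first last.
- exact: mEF.
- by move=> z' _; rewrite lee_fin.
- exact: mEF.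
- by move=> z' _; rewrite lee_fin.
apply: lte_add_pinfty; first exact: uE.
apply: le_lt_trans N1; apply: ge0_subset_integral_gen => //;
  by move=> z' _; rewrite lee_fin; exact: f20.
Qed.

Let test_integrandE u z r1 r2 l x y :
  `|u x - u y| `^ (p - 2) * (u x - u y) *
    (test_function u z r1 r2 l x - test_function u z r1 r2 l y) =
  energy_integrand p (u x - l) (u y - l) (cutoff z r1 r2 x `^ p) (cutoff z r1 r2 y `^ p).
Proof.
rewrite /energy_integrand /test_function.
by rewrite (_ : u x - l - (u y - l) = u x - u y)//; ring.
Qed.

Let lower_boundM (J Q ka x : R) : 0 <= x -> lK * x <= ka -> ka <= uK * x ->
  0 <= Q -> - Q <= J -> - (uK * x * Q) <= J * ka.
Proof.
move=> x0 ka1 ka2 Q0 QJ.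
have ka0 : 0 <= ka by apply: le_trans ka1; rewrite mulr_ge0// ltW.
apply: (@le_trans _ _ (- Q * ka)); last by rewrite ler_wpM2r.
by rewrite mulNr lerN2 mulrC ler_wpM2r.
Qed.

Let cross_bound u z r1 r2 l x y (ka : R) : r1 < r2 -> eball z r1 x ->
  u y <= l -> l < u x -> lK * k x y <= ka ->
  lK * ((u x - u y) `^ (p - 1) * (u x - l) * k x y) <=
  `|u x - u y| `^ (p - 2) * (u x - u y) *
    (test_function u z r1 r2 l x - test_function u z r1 r2 l y) * ka.
Proof.
move=> r12 zx uy ux ka1; rewrite test_integrandE energy_integrand_cross ?subr_le0 ?subr_gt0//.
rewrite cutoff1// powR1 mulr1 (_ : u x - l - (u y - l) = u x - u y); last by ring.
rewrite mulrCA ler_wpM2l// mulr_ge0 ?powR_ge0// subr_ge0 ltW//.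
Qed.

(** Four cases. Both points inside [r3]: the near bound. One inside [r2] and the other outside [r3]:
    the far bound. In the other cases with a point outside [r3] both cutoffs vanish, and so does the
    integrand. *)
Let negative_bound u z r1 r2 r3 l x y (ka : R) : r1 < r2 -> r2 < r3 ->
  lK * k x y <= ka -> ka <= uK * k x y ->
  0 <= `|u x - u y| `^ (p - 2) * (u x - u y) *
    (test_function u z r1 r2 l x - test_function u z r1 r2 l y) * ka +
  uK * slope_cst p `^ p * (\1_(eball z r3 `*` eball z r3) (x,
    y) * (posp (u x - l) `^ p * ((enorm (x - y) / (r2 - r1)) `^ p * k x y)) +
    \1_(eball z r3 `*` eball z r3) (x, y) * (posp (u y - l) `^ p * ((enorm (x - y) / (r2 - r1))
      `^ p * k x y)) +
    \1_(eball z r2 `*` ~` eball z r3) (x, y) * (posp (u x - l) * (posp (u y - l) `^ (p - 1) * k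
      x y)) +
    \1_(~` eball z r3 `*` eball z r2) (x, y) * (posp (u y - l) * (posp (u x - l) `^ (p - 1) * k
      x y))).
Proof.
move=> r12 r23 ka1 ka2; have d0 : 0 < r2 - r1 by rewrite subr_gt0.
pose w t := posp (u t - l); rewrite -/(w x) -/(w y).
have k0 := pk_ge0 Kk x y; have w0 t : 0 <= w t by exact: posp_ge0.
have m1 : 1 <= slope_cst p := slope_cst_ge1 p.
have mp1 : 1 <= slope_cst p `^ p by rewrite powR_ge1// ltW.
have mp0 : 0 <= slope_cst p `^ p by exact: le_trans mp1.
have c0 t : ~ eball z r3 t -> cutoff z r1 r2 t `^ p = 0.
  move=> zt; rewrite cutoff0 ?powR0 ?gt_eqF// => zt2; apply: zt.
  by apply: subset_eballr zt2; exact: ltW.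
have cp1 t : cutoff z r1 r2 t `^ p <= 1.
  apply: (@le_trans _ _ (1 `^ p)); last by rewrite powR1.
  by rewrite ge0_ler_powR ?nnegrE ?(ltW p0) ?cutoff_ge0 ?cutoff_le1.
rewrite test_integrandE !indicE !in_setX !in_setC.
have [zx|zx] := boolP (x \in eball z r3); have [zy|zy] := boolP (y \in eball z r3).
- rewrite !mul1r !andbF !mul0r !addr0/= -lerBlDr sub0r.
  apply: le_trans (lower_boundM k0 ka1 ka2 _ (energy_integrand_near p1 _ _ _ _)).
  + rewrite lerN2 -/(w x) -/(w y).
    rewrite [leRHS](_ : _ = uK * k x y * (slope_cst p `^ p * (w x `^ p + w y `^ p) *
       (enorm (x - y) / (r2 - r1)) `^ p)); last by ring.
    rewrite ler_wpM2l ?mulr_ge0 ?(ltW uK0)// ler_wpM2l ?mulr_ge0 ?addr_ge0 ?powR_ge0//.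
    rewrite ge0_ler_powR ?nnegrE ?(ltW p0) ?divr_ge0 ?enorm_ge0 ?(ltW d0)//.
    exact: cutoff_lipschitz.
  + by rewrite !mulr_ge0 ?addr_ge0 ?powR_ge0.
  + exact: cutoff_ge0.
  + exact: cutoff_ge0.
- rewrite !andbF !andbT !mul0r !add0r addr0 (c0 y); last by move/mem_set; exact/negP.
  have [zx2|zx2] := boolP (x \in eball z r2); last first.
    rewrite cutoff0//; last by move/mem_set; exact/negP.
    by rewrite /energy_integrand powR0 ?gt_eqF// !mulr0 subrr !(mulr0, mul0r) addr0.
  rewrite mul1r -lerBlDr sub0r.
  apply: le_trans (lower_boundM k0 ka1 ka2 _ (energy_integrand_far p1 _ _ (powR_ge0 _ _) (cp1
    x))).
  + rewrite lerN2 -/(w x) -/(w y).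
    rewrite [leRHS](_ : _ = slope_cst p `^ p * (uK * k x y * (w x * w y `^ (p - 1))));
      last by ring.
    by rewrite ler_peMl// !mulr_ge0 ?powR_ge0 ?(ltW uK0).
  + by rewrite mulr_ge0 ?posp_ge0 ?powR_ge0.
- rewrite !andbF !andbT !mul0r !add0r (c0 x); last by move/mem_set; exact/negP.
  have [zy2|zy2] := boolP (y \in eball z r2); last first.
    rewrite cutoff0//; last by move/mem_set; exact/negP.
    by rewrite /energy_integrand powR0 ?gt_eqF// !mulr0 subrr !(mulr0, mul0r) addr0.
  rewrite mul1r -lerBlDr sub0r energy_integrandC.
  apply: le_trans (lower_boundM k0 ka1 ka2 _ (energy_integrand_far p1 _ _ (powR_ge0 _ _) (cp1
    y))).
  + rewrite lerN2 -/(w x) -/(w y).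
    rewrite [leRHS](_ : _ = slope_cst p `^ p * (uK * k x y * (w y * w x `^ (p - 1))));
      last by ring.
    by rewrite ler_peMl// !mulr_ge0 ?powR_ge0 ?(ltW uK0).
  + by rewrite mulr_ge0 ?posp_ge0 ?powR_ge0.
rewrite (c0 x); last by move/mem_set; exact/negP.
rewrite (c0 y); last by move/mem_set; exact/negP.
rewrite /energy_integrand !mulr0 subrr mulr0 mul0r add0r mulr_ge0 ?mulr_ge0 ?(ltW uK0)//.
by rewrite !addr_ge0// mulr_ge0 ?mulr_ge0 ?powR_ge0.
Qed.

(** The 2 counts each error term together with its mirror image under exchange of [x] and [y]. *)
Definition caccioppoli_cst : R := 2 * (uK * slope_cst p `^ p) / lK.

Lemma caccioppoli_cst_gt0 : 0 < caccioppoli_cst.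
Proof.
rewrite /caccioppoli_cst divr_gt0// mulr_gt0// mulr_gt0// powR_gt0//.
Qed.

(** Pointwise, [lK] times the cross term is at most the tested integrand plus the error terms [S].
    On cross pairs the integrand is nonnegative and is kept, elsewhere [S] compensates its negative
    part. *)
Lemma caccioppoli Omega u z r3 M : measurable Omega ->
  measurable_fun setT u -> (\int[mu]_(x in Omega) (`|u x| `^ p)%:E < +oo)%E ->
  (kernel_energy Omega u < +oo)%E -> (forall x, H x 1 <= M) ->
  weak_form Omega u -> eball z r3 `<=` Omega ->
  energy_ineq p k caccioppoli_cst u z r3.
Proof.
move=> mO mU uI uE HM wu zO r1 r2 l r10 r12 r23.
have [mB1 mB2 mB3] : [/\ measurable (eball z r1),
  measurable (eball z r2) & measurable (eball z r3)].
  by split; exact: measurable_eball.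
have mC3 : measurable (~` eball z r3) by exact: measurableC.
have zO2 : eball z r2 `<=` Omega by apply: subset_trans zO; apply: subset_eballr; exact: ltW.
have zO1 : eball z r1 `<=` Omega by apply: subset_trans zO2; apply: subset_eballr; exact: ltW.
have mI := measurable_interaction_set mO.
pose phi := test_function u z r1 r2 l.
have mphi : measurable_fun setT phi by exact: measurable_test_function.
pose F (zz : 'rV[R]_n * 'rV[R]_n) := `|u zz.1 - u zz.2| `^ (p - 2) * (u zz.1 - u zz.2) *
  (phi zz.1 - phi zz.2) * K zz.
have F0 : (\int[mu2]_(zz in interaction_set Omega) (F zz)%:E = 0)%E.
  have [a1 a2] := test_function_admissible l mO mU uI uE HM r12 zO2.
  apply: wu => // x nOx; apply: test_function0 => // zx; apply: nOx; exact: zO2.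
pose w x := posp (u x - l).
have w0 x : 0 <= w x by exact: posp_ge0.
pose gg (zz : 'rV[R]_n * 'rV[R]_n) := if (u zz.2 <= l) && (l < u zz.1) then
  (u zz.1 - u zz.2) `^ (p - 1) * (u zz.1 - l) * k zz.1 zz.2 else 0.
pose q (x y : 'rV[R]_n) := (enorm (x - y) / (r2 - r1)) `^ p * k x y.
pose h1 (zz : 'rV[R]_n * 'rV[R]_n) := w zz.1 `^ p * q zz.1 zz.2.
pose h2 (zz : 'rV[R]_n * 'rV[R]_n) := w zz.2 `^ p * q zz.1 zz.2.
pose h3 (zz : 'rV[R]_n * 'rV[R]_n) := w zz.1 * (w zz.2 `^ (p - 1) * k zz.1 zz.2).
pose h4 (zz : 'rV[R]_n * 'rV[R]_n) := w zz.2 * (w zz.1 `^ (p - 1) * k zz.1 zz.2).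
pose A := eball z r1 `*` eball z r3.
pose B33 := eball z r3 `*` eball z r3.
pose B23 := eball z r2 `*` ~` eball z r3.
pose B32 := ~` eball z r3 `*` eball z r2.
have mA : measurable A by exact: measurableX.
have mB33 : measurable B33 by exact: measurableX.
have mB23 : measurable B23 by exact: measurableX.
have mB32 : measurable B32 by exact: measurableX.
pose S zz := \1_B33 zz * h1 zz + \1_B33 zz * h2 zz + \1_B23 zz * h3 zz + \1_B32 zz * h4 zz.
have mu1 : measurable_fun setT (fun zz : 'rV[R]_n * 'rV[R]_n => u zz.1).
  exact: (measurableT_comp mU measurable_fst).
have mu2' : measurable_fun setT (fun zz : 'rV[R]_n * 'rV[R]_n => u zz.2).
  exact: (measurableT_comp mU measurable_snd).
have mw1 : measurable_fun setT (fun zz : 'rV[R]_n * 'rV[R]_n => w zz.1).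
  exact: measurable_posp.
have mw2 : measurable_fun setT (fun zz : 'rV[R]_n * 'rV[R]_n => w zz.2).
  exact: measurable_posp.
have mpow a (f : 'rV[R]_n * 'rV[R]_n -> R) : measurable_fun setT f ->
  measurable_fun setT (fun zz => f zz `^ a).
  by move=> mf; exact: (measurableT_comp (measurable_powR _)).
have mk := pk_meas Kk.
have mq : measurable_fun setT (fun zz : 'rV[R]_n * 'rV[R]_n => q zz.1 zz.2).
  by apply: measurable_funM => //; apply: mpow; exact: measurable_funM.
have q0 x y : 0 <= q x y by rewrite mulr_ge0 ?powR_ge0 ?(pk_ge0 Kk).
have mgg : measurable_fun setT gg.
  apply: measurable_fun_ifT => //.
    by apply: measurable_and; [exact: measurable_fun_ler|exact: measurable_fun_ltr].
  apply: measurable_funM => //; apply: measurable_funM; last exact: measurable_funB.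
  by apply: mpow; exact: measurable_funB.
have gg0 zz : 0 <= gg zz.
  rewrite /gg; case: ifP => // /andP[_ ux].
  by rewrite !mulr_ge0 ?powR_ge0 ?(pk_ge0 Kk)// subr_ge0 ltW.
have mh1 : measurable_fun setT h1 by apply: measurable_funM => //; exact: mpow.
have mh2 : measurable_fun setT h2 by apply: measurable_funM => //; exact: mpow.
have mh3 : measurable_fun setT h3.
  by apply: measurable_funM => //; apply: measurable_funM => //; exact: mpow.
have mh4 : measurable_fun setT h4.
  by apply: measurable_funM => //; apply: measurable_funM => //; exact: mpow.
have h10 zz : 0 <= h1 zz by rewrite mulr_ge0 ?powR_ge0.
have h20 zz : 0 <= h2 zz by rewrite mulr_ge0 ?powR_ge0.
have h30 zz : 0 <= h3 zz by rewrite mulr_ge0 ?mulr_ge0 ?powR_ge0 ?(pk_ge0 Kk).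
have h40 zz : 0 <= h4 zz by rewrite mulr_ge0 ?mulr_ge0 ?powR_ge0 ?(pk_ge0 Kk).
have i0 (D : set ('rV[R]_n * 'rV[R]_n)) f zz : (forall zz, 0 <= f zz) ->
    0 <= (\1_D zz : R) * f zz.
  by move=> f0; rewrite mulr_ge0// indicE ler0n.
have mi (D : set ('rV[R]_n * 'rV[R]_n)) f : measurable D -> measurable_fun setT f ->
    measurable_fun setT (fun zz => (\1_D zz : R) * f zz).
  by move=> mD mf; apply: measurable_funM.
have mS : measurable_fun setT S by do 3 (apply: measurable_funD; last exact: mi); exact: mi.
have S0 zz : 0 <= S zz by rewrite !addr_ge0// i0.
have c0 : 0 <= uK * slope_cst p `^ p by rewrite mulr_ge0 ?powR_ge0 ?ltW.
have mF : measurable_fun setT F.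
  apply: measurable_funM => //; apply: measurable_funM; last first.
    apply: measurable_funB; first exact: (measurableT_comp mphi measurable_fst).
    exact: (measurableT_comp mphi measurable_snd).
  apply: measurable_funM; last exact: measurable_funB.
  by apply: mpow; apply: measurableT_comp => //; exact: measurable_funB.
(* Neither side is known to be finite, so the integrated inequality comes from the vanishing
   integral and not from a subtraction. *)
have := @integral0_le _ _ _ mu2 (interaction_set Omega) (fun zz => (F zz)%:E)
  (fun zz => lK * (\1_A zz * gg zz)) (fun zz => uK * slope_cst p `^ p * S zz) mI.
have -> : (\int[mu2]_(zz in interaction_set Omega) (lK * (\1_A zz * gg zz))%:E =
  lK%:E * \int[mu]_(x in eball z r1) \int[mu]_(y in eball z r3) (gg (x, y))%:E)%E.
  rewrite integralZl_fin//; last 3 first.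
  - exact: mi.
  - by move=> zz; exact: i0.
  - exact: ltW.
  rewrite integral_indicM (_ : _ `&` A = A).
    by rewrite (integral_rectangle mu mu mB1 mB3 mgg gg0).
  by apply/setIidPr => -[x y] [/= zx _] [/= nx _]; apply: nx; exact: zO1.
set I1 := (\int[mu]_(x in eball z r3) _)%E.
set I2 := (\int[mu]_(x in eball z r2) _)%E.
have I10 : (0 <= I1)%E.
  apply: integral_ge0 => x _; rewrite mule_ge0 ?lee_fin ?powR_ge0//.
  by apply: integral_ge0 => y _; rewrite lee_fin; exact: (q0 x y).
have I20 : (0 <= I2)%E.
  apply: integral_ge0 => x _; apply: mule_ge0; first by rewrite lee_fin; exact: (w0 x).
  by apply: integral_ge0 => y _; rewrite lee_fin mulr_ge0 ?powR_ge0 ?(pk_ge0 Kk).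
have mqx x : measurable_fun setT (q x) by exact: (measurableT_comp mq (pair1_measurable x)).
have mwk x : measurable_fun setT (fun y => w y `^ (p - 1) * k x y).
  apply: measurable_funM; last exact: (measurable_kernelr Kk).
  exact: measurable_posp_powR.
have wk0 x y : 0 <= w y `^ (p - 1) * k x y by rewrite mulr_ge0 ?powR_ge0 ?(pk_ge0 Kk).
have E1 : (\int[mu2]_(zz in B33) (h1 zz)%:E = I1)%E.
  rewrite (integral_rectangle mu mu mB3 mB3 mh1 h10); apply: eq_integral => x _.
  exact: (integralZl_fin mu mB3 (mqx x) (q0 x) (powR_ge0 (w x) p)).
have E2 : (\int[mu2]_(zz in B33) (h2 zz)%:E = I1)%E.
  rewrite (integral_rectangle_swap mu mu mB3 mB3 mh2 h20); apply: eq_integral => x _.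
  apply: etrans (integralZl_fin mu mB3 (mqx x) (q0 x) (powR_ge0 (w x) p)).
  by apply: eq_integral => y _; rewrite /h2/= /q enormC (pk_sym Kk).
have E3 : (\int[mu2]_(zz in B23) (h3 zz)%:E = I2)%E.
  rewrite (integral_rectangle mu mu mB2 mC3 mh3 h30); apply: eq_integral => x _.
  exact: (integralZl_fin mu mC3 (mwk x) (wk0 x) (w0 x)).
have E4 : (\int[mu2]_(zz in B32) (h4 zz)%:E = I2)%E.
  rewrite (integral_rectangle_swap mu mu mC3 mB2 mh4 h40); apply: eq_integral => x _.
  apply: etrans (integralZl_fin mu mC3 (mwk x) (wk0 x) (w0 x)).
  by apply: eq_integral => y _; rewrite /h4/= (pk_sym Kk).
have SI : (\int[mu2]_zz (S zz)%:E = I1 + I1 + I2 + I2)%E.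
  have [n1 n2] := (mi _ _ mB33 mh1, mi _ _ mB33 mh2).
  have [n3 n4] := (mi _ _ mB23 mh3, mi _ _ mB32 mh4).
  have [i1 i2] := ((fun zz => i0 B33 _ zz h10), (fun zz => i0 B33 _ zz h20)).
  have [i3 i4] := ((fun zz => i0 B23 _ zz h30), (fun zz => i0 B32 _ zz h40)).
  have n12 := measurable_funD n1 n2; have i12 zz := addr_ge0 (i1 zz) (i2 zz).
  have n123 := measurable_funD n12 n3; have i123 zz := addr_ge0 (i12 zz) (i3 zz).
  rewrite (integralD_fin mu2 measurableT n123 n4 i123 i4).
  rewrite (integralD_fin mu2 measurableT n12 n3 i12 i3).
  rewrite (integralD_fin mu2 measurableT n1 n2 i1 i2).
  by rewrite !(integral_indicM mu2 setT) !setTI E1 E2 E3 E4.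
have le1 : (\int[mu2]_(zz in interaction_set Omega) (uK * slope_cst p `^ p * S zz)%:E <=
  (uK * slope_cst p `^ p)%:E * (I1 + I1 + I2 + I2))%E.
  rewrite -SI -integralZl_fin//; apply: ge0_subset_integral_gen;
    by [move=> zz _; rewrite lee_fin mulr_ge0 | |].
move=> /(_ _ _ _ _ _ F0) main.
have {main} : (lK%:E * \int[mu]_(x in eball z r1) \int[mu]_(y in eball z r3) (gg (x, y))%:E <=
  (uK * slope_cst p `^ p)%:E * (I1 + I1 + I2 + I2))%E.
  apply: le_trans le1; apply: main.
  - by apply/measurable_EFinP; exact: measurable_funTS.
  - by apply: measurable_funTS; apply: measurable_funM => //; exact: mi.
  - by apply: measurable_funTS; exact: measurable_funM.
  - by move=> zz _; rewrite mulr_ge0 ?(ltW lK0) ?i0.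
  - by move=> zz _; rewrite mulr_ge0.
  apply: filterS Kae => -[x y] /= Kxy _; rewrite lee_fin.
  (* The kernel is controlled off the diagonal only. On it the tested integrand is 0, and so is
     [gg], as u cannot be both at most [l] and above it. *)
  have [xy|xy] := eqVneq x y.
    rewrite /F /gg /= xy subrr mulr0 !mul0r add0r.
    have -> : (u y <= l) && (l < u y) = false by case: (leP (u y) l).
    by rewrite !mulr0 mulr_ge0.
  have /andP[ka1 ka2] := Kxy xy.
  have := negative_bound u z l r12 r23 ka1 ka2.
  rewrite /F /S /h1 /h2 /h3 /h4 /q /w /phi /=.
  set hh := uK * _ * _ => pos.
  have hh0 : 0 <= hh by rewrite mulr_ge0//; exact: (S0 (x, y)).
  rewrite indicE; have [|_] := boolP ((x, y) \in A); last by rewrite mul0r mulr0.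
  rewrite in_setX => /andP[/set_mem zx _]; rewrite mul1r /gg/=.
  case: ifP => [/andP[uy ux]|_]; last by rewrite mulr0.
  rewrite -[leLHS]addr0; apply: lerD => //.
  exact: cross_bound.
rewrite -/gg => main.
have double_sum (a b : \bar R) : (0 <= a -> 0 <= b -> a + a + b + b = 2%:E * (a + b))%E.
  move=> a0 b0; rewrite (_ : 2%:E = 1 + 1)%E; last by rewrite -EFinD.
  by rewrite ge0_muleDl// !mul1e [RHS]addeACA addeA.
have {double_sum} I12 := double_sum _ _ I10 I20.
have -> : (\int[mu]_(x in eball z r1) \int[mu]_(y in eball z r3)
   (if (u y <= l) && (l < u x) then (u x - u y) `^ (p - 1) * (u x - l) * k x y else 0)%:E =
  lK^-1%:E * (lK%:E * \int[mu]_(x in eball z r1) \int[mu]_(y in eball z r3) (gg (x, y))%:E))%E.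
  by rewrite muleA -EFinM mulVf ?gt_eqF// mul1e.
apply: (@le_trans _ _ (lK^-1%:E * ((uK * slope_cst p `^ p)%:E * (I1 + I1 + I2 + I2)))%E).
  by rewrite lee_wpmul2l// lee_fin invr_ge0 ltW.
rewrite I12 !muleA -!EFinM le_eqVlt; apply/orP; left; apply/eqP.
by congr (_%:E * _)%E; rewrite /caccioppoli_cst; ring.
Qed.

End caccioppoli.

(** * Borel versions of the coefficients *)

Section double_phase_kernel.
Context (R : realType) (n : nat).
Variables (sg ta nu L al be : R).
Hypotheses (sg0 : 0 < sg) (sgta : sg <= ta) (taal : ta - sg <= al) (al1 : al <= 1).
Hypotheses (nu0 : 0 < nu) (L1 : 1 <= L) (be0 : 0 <= be).
Variables A B : 'rV[R]_n -> 'rV[R]_n -> R.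

Record regular_coefficients : Prop := RegularCoefficients {
  rc_measA : measurable_fun setT (fun z : 'rV[R]_n * 'rV[R]_n => A z.1 z.2) ;
  rc_measB : measurable_fun setT (fun z : 'rV[R]_n * 'rV[R]_n => B z.1 z.2) ;
  rc_symA : forall x y, A x y = A y x ;
  rc_symB : forall x y, B x y = B y x ;
  rc_A0 : forall x y, 0 <= A x y ;
  rc_B0 : forall x y, 0 <= B x y ;
  rc_BL : forall x y, B x y <= L ;
  rc_ge : forall x y, nu <= A x y + B x y ;
  rc_le : forall x y, A x y + B x y <= L ;
  rc_holder : holder_coefficient al be B }.

Hypothesis AB : regular_coefficients.

Let ta0 : 0 < ta. Proof. exact: lt_le_trans sgta. Qed.
Let L0 : 0 < L. Proof. exact: lt_le_trans L1. Qed.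
Let e0 : 0 <= ta - sg. Proof. by rewrite subr_ge0. Qed.
Let e1 : ta - sg <= 1. Proof. exact: le_trans al1. Qed.
Let al0 : 0 <= al. Proof. exact: le_trans taal. Qed.

Definition dphase_kernel (x y : 'rV[R]_n) : R :=
  A x y * enorm (x - y) `^ (- (n%:R + sg)) + B x y * enorm (x - y) `^ (- (n%:R + ta)).

Definition dphase_scale (z : 'rV[R]_n) (r : R) : R := r `^ (- sg) + B z z * r `^ (- ta).

(** Reciprocal of the constant needed in the lower bound: the part 1 + 2 be is paid by
    [X >= nu / 2], the part B rho by [B rho <= 2 X], with [X] as in [dphase_kernelP]. *)
Definition dphase_lower : R := (2 * (1 + 2 * be) / nu + 2)^-1.

Definition dphase_upper : R := 3 * L + 2 * be.

Let den0 : 0 < 2 * (1 + 2 * be) / nu + 2.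
Proof. by rewrite addr_gt0// divr_gt0//; have := be0; lra. Qed.

Lemma dphase_lower_gt0 : 0 < dphase_lower.
Proof. by rewrite invr_gt0. Qed.

Lemma dphase_upper_gt0 : 0 < dphase_upper.
Proof. by rewrite /dphase_upper; have := be0; have := L0; lra. Qed.

Let radius_powR (r : R) : 0 < r -> r <= 1 -> (2 * r) `^ al <= 2 * r `^ (ta - sg).
Proof.
move=> r0 r1; rewrite powRM ?(ltW r0)//; apply: ler_pM; rewrite ?powR_ge0//.
  by apply: ler1_powR => //; rewrite ler1n.
by apply: ger_powR => //; rewrite r0 r1.
Qed.

Let coefficient_osc z (r : R) x y : 0 < r -> eball z r x -> eball z r y ->
  `|B x y - B z z| <= be * (2 * r) `^ al.
Proof.
move=> r0 zx zy; apply: (le_trans (rc_holder AB _ _ _ _)); rewrite ler_wpM2l//.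
rewrite ge0_ler_powR ?nnegrE ?addr_ge0 ?enorm_ge0 ?mulr_ge0 ?(ltW r0)//.
by move: zx zy; rewrite /eball/= => zx zy; rewrite mulr_natl mulr2n lerD ?ltW.
Qed.

Let diameter_lt (z : 'rV[R]_n) (r : R) (x y : 'rV[R]_n) : 0 < r -> eball z r x -> eball z r y ->
  x != y ->
  enorm (x - y) < 2 * r.
Proof.
rewrite /eball/= => r0 zx zy xy; apply: (le_lt_trans (ler_enormB x z y)).
by rewrite (enormC z) mulr_natl mulr2n ltrD.
Qed.

Let scale_lower z (r : R) : 0 < r -> dphase_scale z r * r `^ sg = 1 + B z z * r `^ (- (ta - sg)).
Proof.
move=> r0; rewrite /dphase_scale mulrDl powRNM// -mulrA -powRDg//.
by congr (_ + _ * _ `^ _); ring.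
Qed.

Let scale_upper z (r : R) : 0 < r -> dphase_scale z r * r `^ ta = r `^ (ta - sg) + B z z.
Proof.
move=> r0; rewrite /dphase_scale mulrDl -mulrA powRNM// mulr1 -powRDg//.
by congr (_ `^ _ + _); ring.
Qed.

Lemma dphase_kernelP : phase_kernel sg ta dphase_lower dphase_upper dphase_kernel dphase_scale.
Proof.
have nsg : - (n%:R + sg) != 0 by rewrite oppr_eq0 gt_eqF// ltr_wpDl.
have nta : - (n%:R + ta) != 0 by rewrite oppr_eq0 gt_eqF// ltr_wpDl.
have B0 := rc_B0 AB; have A0 := rc_A0 AB.
split.
- have mdist : measurable_fun setT (fun z : 'rV[R]_n * 'rV[R]_n => enorm (z.1 - z.2)).
    by apply: measurable_enorm; apply: measurable_fun_subrV;
      [exact: measurable_fst|exact: measurable_snd].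
  apply: measurable_funD; apply: measurable_funM.
  + exact: rc_measA AB.
  + exact: (measurableT_comp (measurable_powR _)).
  + exact: rc_measB AB.
  + exact: (measurableT_comp (measurable_powR _)).
- by move=> x y; rewrite addr_ge0 ?mulr_ge0 ?powR_ge0.
- by move=> x y; rewrite /dphase_kernel (rc_symA AB) (rc_symB AB) enormC.
- by move=> z r r0; rewrite /dphase_scale ltr_pwDl ?powR_gt0// mulr_ge0 ?powR_ge0.
- move=> z r x y r0 r1 zx zy; have [<-|xy] := eqVneq x y.
    by rewrite /dphase_kernel subrr enorm0 !powR0// !mulr0 addr0.
  have d0 := enorm_gt0 xy; have d2 := diameter_lt r0 zx zy xy.
  have r20 : 0 < 2 * r by rewrite mulr_gt0.
  rewrite -[dphase_lower * _ * _]mulrA scale_lower// /dphase_kernel.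
  have -> : - (n%:R + ta) = - (n%:R + sg) + - (ta - sg) :> R by ring.
  rewrite [enorm _ `^ (_ + _)]powRDg//.
  have D0 : 0 < enorm (x - y) `^ (- (n%:R + sg)) by rewrite powR_gt0.
  have rho1 : 1 <= r `^ (- (ta - sg)).
    by rewrite powRN invf_ge1 ?powR_gt0// -[leRHS](powRr0 r) ger_powR ?r0.
  have dd : r `^ (- (ta - sg)) / 2 <= enorm (x - y) `^ (- (ta - sg)).
    apply: le_trans (le0_powR_le d0 (ltW d2) e0).
    rewrite powRM ?(ltW r0)// mulrC ler_wpM2r ?powR_ge0//.
    by rewrite powRN lef_pV2 ?posrE ?powR_gt0// ler1_powR// ler1n.
  have rhor : r `^ (ta - sg) * r `^ (- (ta - sg)) = 1 by rewrite mulrC powRNM.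
  have osc : B z z <= B x y + 2 * be * r `^ (ta - sg).
    have := coefficient_osc r0 zx zy; have := ler_wpM2l be0 (radius_powR r0 r1).
    by rewrite ler_distl => b1 /andP[b2 _]; lra.
  have AB1 := rc_ge AB x y; have Bxy := B0 x y; have Axy := A0 x y.
  move: (enorm (x - y) `^ (- (n%:R + sg))) D0 (enorm (x - y) `^ (- (ta - sg))) dd => D D0 dd.
  move: (r `^ (- (ta - sg))) rho1 rhor => rho rho1 rhor ddrho.
  apply: (@le_trans _ _ ((A x y + B x y * dd) * D)); last by rewrite le_eqVlt; apply/orP; left;
    apply/eqP; ring.
  rewrite ler_wpM2r ?(ltW D0)//.
  have [X XE] : exists X, X = A x y + B x y * (rho / 2) by eexists.
  apply: (@le_trans _ _ X); last by rewrite XE lerD2l ler_wpM2l.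
  have Xnu : nu / 2 <= X.
    have : B x y * (1 / 2) <= B x y * (rho / 2) by rewrite ler_wpM2l// ler_wpM2r// invr_ge0.
    by rewrite XE; lra.
  rewrite /dphase_lower mulrC ler_pdivrMr//.
  (* On a ball of radius r <= 1 the oscillation of [B] is at most 2 be r^(ta-sg), by
     [ta - sg <= al]; multiplied by [rho] this is the constant 2 be. *)
  have Bz : B z z * rho <= B x y * rho + 2 * be.
    have rho0 : 0 <= rho by rewrite (le_trans ler01).
    have := ler_wpM2r rho0 osc; by rewrite mulrDl -(mulrA (2 * be)) rhor mulr1.
  have X1 : (1 + 2 * be) * 1 <= (1 + 2 * be) * (2 / nu * X).
    rewrite ler_wpM2l ?addr_ge0 ?mulr_ge0// -ler_pdivrMl ?divr_gt0// mulr1 invf_div//.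
  have X2 : B x y * rho <= 2 * X by rewrite XE; lra.
  apply: (@le_trans _ _ ((1 + 2 * be) * 1 + B x y * rho)); first by lra.
  apply: (le_trans (lerD X1 X2)).
  by rewrite le_eqVlt; apply/orP; left; apply/eqP; ring.
- move=> z r x y r0 zx zy; have [<-|xy] := eqVneq x y.
    by rewrite /dphase_kernel subrr enorm0 !powR0// !mulr0 addr0.
  have d0 := enorm_gt0 xy; have d2 := diameter_lt r0 zx zy xy.
  rewrite -[dphase_upper * _ * _]mulrA scale_upper// /dphase_kernel.
  have -> : - (n%:R + sg) = - (n%:R + ta) + (ta - sg) :> R by ring.
  rewrite [enorm _ `^ (_ + _)]powRDg// mulrCA mulrC -mulrDl.
  rewrite ler_wpM2r ?powR_ge0//.
  have re0 : 0 < r `^ (ta - sg) by rewrite powR_gt0.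
  have dd : enorm (x - y) `^ (ta - sg) <= 2 * r `^ (ta - sg).
    apply: (@le_trans _ _ ((2 * r) `^ (ta - sg))).
      by rewrite ge0_ler_powR ?nnegrE ?enorm_ge0 ?mulr_ge0 ?(ltW r0)// ltW.
    by rewrite powRM ?(ltW r0)// ler_wpM2r ?powR_ge0// ler1_powR// ler1n.
  have AL : A x y <= L by have := rc_le AB x y; have := B0 x y; lra.
  have a1 : A x y * enorm (x - y) `^ (ta - sg) <= L * (2 * r `^ (ta - sg)).
    by apply: ler_pM; rewrite ?powR_ge0.
  (* For r <= 1 by Hoelder continuity; for larger radii [B <= L] is enough, as then r^(ta-sg) >=
     1. *)
  have b1 : B x y <= B z z + (L + 2 * be) * r `^ (ta - sg).
    have [r1|r1] := leP r 1.
      have := coefficient_osc r0 zx zy; have := ler_wpM2l be0 (radius_powR r0 r1).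
      rewrite ler_distl => b2 /andP[_ b3].
      have : 0 <= L * r `^ (ta - sg) by rewrite mulr_ge0// ltW.
      by lra.
    have : L * 1 <= L * r `^ (ta - sg).
      by rewrite ler_wpM2l ?(ltW L0)// powR_ge1// ltW.
    have := rc_BL AB x y; have := B0 z z.
    have : 0 <= be * r `^ (ta - sg) by rewrite mulr_ge0// ltW.
    by lra.
  have : 1 * B z z <= dphase_upper * B z z.
    rewrite ler_wpM2r// /dphase_upper; have := be0; have := L1; lra.
  by move: a1 b1; rewrite /dphase_upper mulrC; lra.
- move=> z r c r0 c1; have c0 : 0 < c by exact: lt_le_trans c1.
  rewrite /dphase_scale !powRM ?(ltW c0) ?(ltW r0)// mulrDr lerD2l mulrCA.
  rewrite ler_wpM2r// ?mulr_ge0 ?powR_ge0//.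
  by apply: ler_powR => //; rewrite lerN2.
move=> z r c r0 c1; have c0 : 0 < c by exact: lt_le_trans c1.
rewrite /dphase_scale !powRM ?(ltW c0) ?(ltW r0)// mulrDr; apply: lerD.
  rewrite mulrA -powRDg// ler_peMl ?powR_ge0// powR_ge1//.
rewrite [leRHS](_ : _ = (c `^ (- ta) * c `^ ta) * (B z z * r `^ (- ta))); last by ring.
by rewrite powRNM// mul1r.
Qed.

Lemma dphase_scale1 z : dphase_scale z 1 <= 1 + L.
Proof. by rewrite /dphase_scale !powR1 mulr1 lerD2l (rc_BL AB). Qed.

Lemma dphase_scale_near (x z : 'rV[R]_n) (r : R) : 0 < r -> r <= 1 -> eball x r z ->
  dphase_scale x r <= (1 + 2 * be) * dphase_scale z r.
Proof.
move=> r0 r1 xz; rewrite -(ler_pM2r (powR_gt0 ta r0)) -mulrA !scale_upper//.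
have := coefficient_osc r0 xz xz; have := ler_wpM2l be0 (radius_powR r0 r1).
rewrite ler_distl => b2 /andP[b3 _].
have : 0 <= be * B z z by rewrite mulr_ge0// (rc_B0 AB).
by lra.
Qed.

(** Bounds the expression under the essential supremum of [G_ball] by the scale function at the
    centre, so that the inverse growth function can be compared with [H]. *)
Lemma dphase_sum_le (x y z : 'rV[R]_n) (r : R) : 0 < r -> r <= 1 ->
  eball x r y -> eball x r z ->
  A y z * r `^ (- sg) + B y z * r `^ (- ta) <= (L + 2 * be + 1) * dphase_scale x r.
Proof.
move=> r0 r1 xy xz; rewrite -(ler_pM2r (powR_gt0 ta r0)) -[leRHS]mulrA scale_upper//.
rewrite mulrDl -[A y z * _ * _]mulrA -[B y z * _ * _]mulrA powRNM// mulr1 -powRDg//.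
rewrite (_ : - sg + ta = ta - sg); last by ring.
have := coefficient_osc r0 xy xz; have := ler_wpM2l be0 (radius_powR r0 r1).
rewrite ler_distl => b2 /andP[_ b3].
have AL : A y z <= L by have := rc_le AB y z; have := rc_B0 AB y z; lra.
have : A y z * r `^ (ta - sg) <= L * r `^ (ta - sg) by rewrite ler_wpM2r ?powR_ge0.
have : 0 <= (L + 2 * be) * B x x.
  by rewrite mulr_ge0 ?(rc_B0 AB)//; have := be0; have := L0; lra.
by have := powR_ge0 r (ta - sg); lra.
Qed.

End double_phase_kernel.

(** * Null sets in products *)

Section product_null_sets.
Context d1 d2 (T1 : measurableType d1) (T2 : measurableType d2) (R : realType).
Variables (m1 : {sigma_finite_measure set T1 -> \bar R}).
Variables (m2 : {sigma_finite_measure set T2 -> \bar R}).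

Lemma ae_prod1 (P : T1 -> Prop) :
  {ae m1, forall x, P x} -> {ae (m1 \x m2)%E, forall z, P z.1}.
Proof.
move=> [N [mN N0 PN]]; exists (N `*` setT); split.
- exact: measurableX.
- by transitivity (m1 N * m2 setT)%E; [exact: product_measure1E|rewrite N0 mul0e].
by move=> [x y] /= nP; split => //; exact: PN.
Qed.

Lemma ae_prod2 (P : T2 -> Prop) :
  {ae m2, forall y, P y} -> {ae (m1 \x m2)%E, forall z, P z.2}.
Proof.
move=> [N [mN N0 PN]]; exists (setT `*` N); split.
- exact: measurableX.
- by rewrite [LHS]product_measure1E// N0 mule0.
by move=> [x y] /= nP; split => //; exact: PN.
Qed.

Lemma ae_section (P : T1 * T2 -> Prop) : {ae (m1 \x m2)%E, forall z, P z} ->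
  {ae m1, forall x, {ae m2, forall y, P (x, y)}}.
Proof.
move=> [N [mN N0 PN]].
have : ae_eq m1 setT (fun x => m2 (xsection N x)) (cst 0%E).
  apply/ae_eq_integral_abs => //; first exact: measurable_fun_xsection.
  rewrite -[RHS]N0; apply: eq_integral => x _; exact: gee0_abs.
apply: filterS => x /(_ I) /= x0; exists (xsection N x); split => //.
  exact: measurable_xsection.
by move=> y /= nP; rewrite /xsection/= inE; exact: PN.
Qed.

End product_null_sets.

(** The two orders of integration give a null set and its mirror image the same measure. *)
Lemma ae_swap d (T : measurableType d) (R : realType)
    (m : {sigma_finite_measure set T -> \bar R}) (P : T * T -> Prop) :
  {ae (m \x m)%E, forall z, P z} -> {ae (m \x m)%E, forall z, P (z.2, z.1)}.
Proof.
move=> [N [mN N0 PN]]; pose S := (fun z : T * T => (z.2, z.1)) @^-1` N.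
have mS : measurable S.
  rewrite -[S]setTI; apply: measurable_fun_pair => //.
have ind0 (D : set (T * T)) z : (0 <= \1_D z :> R) by rewrite indicE ler0n.
have mind (D : set (T * T)) : measurable D -> measurable_fun setT (\1_D : _ -> R).
  by move=> mD; exact: measurable_indic.
exists S; split => //; last by move=> z /= nP; exact: PN.
transitivity (\int[m \x m]_(z in setT `*` setT) (\1_S z)%:E)%E.
  by rewrite setXTT integral_indic// setIT.
rewrite (integral_rectangle m m measurableT measurableT (mind _ mS) (ind0 S)).
transitivity (\int[m]_(y in setT) \int[m]_(x in setT) (\1_N (x, y))%:E)%E.
  by apply: eq_integral => y _; apply: eq_integral => x _; rewrite !indicE.
rewrite -(integral_rectangle_swap m m measurableT measurableT (mind _ mN) (ind0 N)).
by rewrite setXTT integral_indic// setIT.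
Qed.

(** The integral is the difference of those of the positive and negative parts, and for these no
    measurability is required. *)
Lemma ae_eq_integral_gen d (T : measurableType d) (R : realType)
    (m : {measure set T -> \bar R}) (D : set T) (f g : T -> \bar R) :
  {ae m, forall x, D x -> f x = g x} ->
  (\int[m]_(x in D) f x = \int[m]_(x in D) g x)%E.
Proof.
move=> fg; rewrite integralE [RHS]integralE; congr (_ - _)%E.
  apply: ge0_ae_eq_integral_gen => //; apply: filterS fg => x + Dx => /(_ Dx).
  by rewrite !funeposE => ->.
apply: ge0_ae_eq_integral_gen => //; apply: filterS fg => x + Dx => /(_ Dx).
by rewrite !funenegE => ->.
Qed.

(** * Regular versions of the coefficients *)

Section coefficient_versions.
Context (R : realType) (n : nat).
Local Notation mu := (lebesgue_rV R n).
Local Notation mu2 := (lebesgue_rV R n \x lebesgue_rV R n)%E.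

(** Superlevel sets of a Hoelder continuous function are open. *)
Lemma holder_coefficient_measurable (al be : R) (b : 'rV[R]_n -> 'rV[R]_n -> R) :
  0 < al -> 0 <= be -> holder_coefficient al be b ->
  measurable_fun setT (fun z : 'rV[R]_n * 'rV[R]_n => b z.1 z.2).
Proof.
move=> al0 be0 hb; apply: (measurability _ (RGenOInfty.measurableE R)) => //.
move=> _ [_ [c ->] <-]; rewrite setTI; apply: box_open_measurable => -[x y].
rewrite /= in_itv/= andbT -subr_gt0 => g0.
have [e /andP[e0 _] eg] := exists_small_powR be0 (divr_gt0 g0 (@ltr0n R 2)) al0 (@ltr01 R).
have m0 : 0 < 2 * n%:R + 1 :> R by rewrite ltr_wpDl ?mulr_ge0.
exists (e / (2 * n%:R + 1)); first exact: divr_gt0.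
move=> [x' y'] /= xx' yy'; rewrite in_itv/= andbT.
have dist (v w : 'rV[R]_n) : (forall i, `|v ord0 i - w ord0 i| < e / (2 * n%:R + 1)) ->
    enorm (v - w) <= n%:R * (e / (2 * n%:R + 1)).
  move=> vw; apply: enorm_le_coord; first by rewrite divr_ge0 ?ltW.
  by move=> i; rewrite !mxE; exact/ltW/vw.
have : `|b x' y' - b x y| <= be * e `^ al.
  apply: (le_trans (hb _ _ _ _)); rewrite ler_wpM2l//.
  rewrite ge0_ler_powR ?nnegrE ?(ltW al0) ?addr_ge0 ?enorm_ge0 ?(ltW e0)//.
  apply: (le_trans (lerD (dist _ _ xx') (dist _ _ yy'))).
  rewrite -mulrDl mulrA ler_pdivrMr// mulrC ler_wpM2l ?(ltW e0)//; lra.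
rewrite ler_distl => /andP[]; move: eg g0; lra.
Qed.

Variables (sg ta nu L al be : R).
Hypotheses (nu0 : 0 < nu) (nu1 : nu <= 1) (L1 : 1 <= L) (al0 : 0 < al) (be0 : 0 <= be).
Variables a b : 'rV[R]_n -> 'rV[R]_n -> R.
Hypotheses (a_meas : measurable_symmetric a) (b_meas : measurable_symmetric b).
Hypotheses (a_ge0 : forall x y, 0 <= a x y) (b_ge0 : forall x y, 0 <= b x y).
Hypotheses (ab : sum_bounds nu L a b) (hb : holder_coefficient al be b).

Let L0 : 0 < L. Proof. exact: lt_le_trans L1. Qed.

(* [b] is truncated at [L], and a Borel version of [a] is symmetrized and clamped
   between the bounds that [nu <= a + b <= L] imposes. *)
Lemma coefficient_versions : exists A B : 'rV[R]_n -> 'rV[R]_n -> R,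
  regular_coefficients nu L al be A B /\
  {ae mu2, forall z, a z.1 z.2 = A z.1 z.2 /\ b z.1 z.2 = B z.1 z.2}.
Proof.
have [asym bsym] := (a_meas.2, b_meas.2).
have [g mg ag] := lebesgue_measurable_version a_meas.1.
have mb := holder_coefficient_measurable al0 be0 hb.
pose B x y := Num.min (b x y) L.
pose A x y := Num.max (Num.max 0 (nu - B x y))
  (Num.min (Num.max (g (x, y)) (g (y, x))) (L - B x y)).
have mB : measurable_fun setT (fun z : 'rV[R]_n * 'rV[R]_n => B z.1 z.2).
  exact: measurable_minr.
have BL x y : B x y <= L by rewrite /B ge_min lexx orbT.
have B0 x y : 0 <= B x y by rewrite /B le_min b_ge0 ltW.
have Bsym x y : B x y = B y x by rewrite /B bsym.
have mgs : measurable_fun setT (fun z : 'rV[R]_n * 'rV[R]_n => g (z.2, z.1)).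
  by apply: (measurableT_comp mg); exact: measurable_fun_pair.
exists A, B; split.
  split => //.
  - apply: measurable_maxr; first by apply: measurable_maxr => //; exact: measurable_funB.
    apply: measurable_minr; last exact: measurable_funB.
    apply: measurable_maxr => //.
    by rewrite (_ : (fun _ => _) = g)//; apply/funext => -[].
  - by move=> x y; rewrite /A Bsym [Num.max (g (x, y)) _]maxC.
  - by move=> x y; rewrite /A !le_max lexx.
  - by move=> x y; rewrite -lerBlDr /A !le_max lexx orbT.
  - move=> x y; rewrite -lerBrDr /A ge_max ge_max ge_min lexx orbT andbT subr_ge0 BL.
    by rewrite lerD2r (le_trans nu1).
  move=> x1 y1 x2 y2; apply: le_trans (hb x1 y1 x2 y2).
  rewrite /B ler_norml; set b1 := b x1 y1; set b2 := b x2 y2.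
  have [n1 n2] := (ler_norm (b1 - b2), ler_norm (b2 - b1)); rewrite distrC in n2.
  have n0 := normr_ge0 (b1 - b2).
  by apply/andP; split; rewrite /Num.min; case: (ltP b1 L) => c1; case: (ltP b2 L) => c2; lra.
have ags := ae_swap ag.
apply: filterS3 ag ags ab => -[x y] /= ag1 ag2 /andP[ab1 ab2].
have bL : b x y <= L by have := a_ge0 x y; lra.
have -> : B x y = b x y by rewrite /B; apply/min_idPl.
split => //; rewrite /A -ag1 -ag2 /= (asym y x) maxxx.
have -> : B x y = b x y by rewrite /B; apply/min_idPl.
have -> : Num.min (a x y) (L - b x y) = a x y by apply/min_idPl; rewrite lerBrDr.
by apply/esym/max_idPr; rewrite ge_max a_ge0 lerBlDr.
Qed.

Variables Ksp Ktp : 'rV[R]_n -> 'rV[R]_n -> R.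
Hypotheses (Ks_meas : measurable_symmetric Ksp) (Kt_meas : measurable_symmetric Ktp).

Lemma kernel_version : exists2 K : 'rV[R]_n * 'rV[R]_n -> R, measurable_fun setT K &
  {ae mu2, forall z, a z.1 z.2 * Ksp z.1 z.2 + b z.1 z.2 * Ktp z.1 z.2 = K z}.
Proof.
apply: lebesgue_measurable_version.
by apply: measurable_funD; apply: measurable_funM;
  [exact: a_meas.1|exact: Ks_meas.1|exact: b_meas.1|exact: Kt_meas.1].
Qed.

End coefficient_versions.

(** * Transfer of the weak formulation to Borel data *)

Section weak_solution_versions.
Context (R : realType) (n : nat).
Local Notation mu := (lebesgue_rV R n).
Local Notation mu2 := (lebesgue_rV R n \x lebesgue_rV R n)%E.
Variables (s t p nu L : R).
Hypothesis p1 : 1 < p.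
Variables (a b Ksp Ktp A B : 'rV[R]_n -> 'rV[R]_n -> R).
Variable K : 'rV[R]_n * 'rV[R]_n -> R.
Hypotheses (A0 : forall x y, 0 <= A x y) (B0 : forall x y, 0 <= B x y).
Hypothesis abAB : {ae mu2, forall z, a z.1 z.2 = A z.1 z.2 /\ b z.1 z.2 = B z.1 z.2}.
Hypothesis KE : {ae mu2, forall z, a z.1 z.2 * Ksp z.1 z.2 + b z.1 z.2 * Ktp z.1 z.2 = K z}.
Hypotheses (Ks : kernel_bounds nu L s p Ksp) (Kt : kernel_bounds nu L t p Ktp).
Local Notation k := (dphase_kernel (s * p) (t * p) A B).

Lemma kernel_version_bounds : {ae mu2, forall z, z.1 != z.2 ->
  nu * k z.1 z.2 <= K z <= L * k z.1 z.2}.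
Proof.
apply: filterS2 (filterI Ks Kt) (filterI abAB KE) => -[x y] /= [ks kt] [[aA bB] <-] xy.
have /andP[s1 s2] := ks xy; have /andP[t1 t2] := kt xy.
rewrite aA bB /dphase_kernel !powRN; apply/andP; split.
  rewrite mulrDr; apply: lerD; rewrite mulrCA; exact: ler_wpM2l.
rewrite mulrDr; apply: lerD; rewrite [leRHS]mulrCA; exact: ler_wpM2l.
Qed.

Variables (Omega : set 'rV[R]_n) (u v : 'rV[R]_n -> R).
Hypothesis uv : {ae mu, forall x, u x = v x}.

Let uv2 : {ae mu2, forall z, u z.1 = v z.1 /\ u z.2 = v z.2}.
Proof.
by apply: filterS2 (ae_prod1 (lebesgue_rV R n) uv) (ae_prod2 (lebesgue_rV R n) uv).
Qed.

Let kernel_integrand (h : R) z : a z.1 z.2 = A z.1 z.2 -> b z.1 z.2 = B z.1 z.2 ->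
  a z.1 z.2 * (h / enorm (z.1 - z.2) `^ (n%:R + s * p)) +
  b z.1 z.2 * (h / enorm (z.1 - z.2) `^ (n%:R + t * p)) = h * k z.1 z.2.
Proof. by move=> -> ->; rewrite /dphase_kernel !powRN; ring. Qed.

Lemma version_integral : energy_space a b s t p Omega u ->
  (\int[mu]_(x in Omega) (`|v x| `^ p)%:E < +oo)%E.
Proof.
move=> [_ uI _].
have e : {ae mu, forall x, Omega x -> (`|u x| `^ p)%:E = (`|v x| `^ p)%:E}.
  by apply: filterS uv => x -> _.
by rewrite -(ae_eq_integral_gen e).
Qed.

Lemma version_energy : energy_space a b s t p Omega u ->
  (kernel_energy p k Omega v < +oo)%E.
Proof.
move=> [_ _ uE]; congr (_ < _)%E : uE; apply: ae_eq_integral_gen.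
apply: filterS2 uv2 abAB => z [<- <-] [aA bB] _.
by rewrite kernel_integrand.
Qed.

(** A test function of finite energy for the regular kernel lies in the original energy space,
    because the two energy integrands agree almost everywhere. *)
Lemma version_weak_form : weak_solution a b Ksp Ktp s t p Omega u ->
  weak_form p k K Omega v.
Proof.
move=> [_ wu] phi mphi phi0 phiI phiE.
have <- : (\int[mu2]_(z in interaction_set Omega)
       (`|u z.1 - u z.2| `^ (p - 2) * (u z.1 - u z.2) * (phi z.1 - phi z.2)
        * (a z.1 z.2 * Ksp z.1 z.2 + b z.1 z.2 * Ktp z.1 z.2))%:E = 0)%E.
  apply: wu; last by apply: aeW => x; exact: phi0.
  split; [exact: measurable_lebesgue_measurable_fun|exact: phiI|].
  congr (_ < _)%E : phiE; apply: ae_eq_integral_gen.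
  by apply: filterS abAB => z [aA bB] _; rewrite kernel_integrand.
apply: ae_eq_integral_gen; apply: filterS2 uv2 KE => z [<- <-] <- _ //.
Qed.

End weak_solution_versions.

(** * The nonlocal tail *)

Section growth_function.
Context (R : realType) (n : nat).
Hypothesis n0 : (0 < n)%N.
Local Notation mu := (lebesgue_rV R n).
Local Notation mu2 := (lebesgue_rV R n \x lebesgue_rV R n)%E.
Variables (s t p nu L al be : R).
Hypotheses (s0 : 0 < s) (st : s < t) (p1 : 1 < p) (tsal : (t - s) * p <= al).
Hypotheses (al1 : al <= 1) (nu0 : 0 < nu) (L1 : 1 <= L) (be0 : 0 <= be).
Variables a b A B : 'rV[R]_n -> 'rV[R]_n -> R.
Hypothesis AB : regular_coefficients nu L al be A B.
Hypothesis abAB : {ae mu2, forall z, a z.1 z.2 = A z.1 z.2 /\ b z.1 z.2 = B z.1 z.2}.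
Local Notation k := (dphase_kernel (s * p) (t * p) A B).
Local Notation H := (dphase_scale (s * p) (t * p) B).

Let p0 : 0 < p. Proof. exact: lt_trans p1. Qed.
Let pm1 : 0 < p - 1. Proof. by rewrite subr_gt0. Qed.
Let sp0 : 0 < s * p. Proof. exact: mulr_gt0. Qed.
Let spt : s * p <= t * p. Proof. by rewrite ler_pM2r// ltW. Qed.
Let tp0 : 0 < t * p. Proof. exact: lt_le_trans spt. Qed.
Let tsp : t * p - s * p <= al. Proof. by rewrite -mulrBl. Qed.

Variables (x0 : 'rV[R]_n) (r : R).
Hypotheses (r0 : 0 < r) (r1 : r <= 1).

Let growth_density (z : 'rV[R]_n * 'rV[R]_n) : \bar R :=
  (a z.1 z.2 / r `^ (s * p) + b z.1 z.2 / r `^ (t * p))%:E.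

Let growth_sup : \bar R := ess_sup mu2 (growth_density \_ (eball x0 r `*` eball x0 r)).

Let growth_sup_le : (growth_sup <= ((L + 2 * be + 1) * H x0 r)%:E)%E.
Proof.
have H0 : 0 < H x0 r := pk_H0 (dphase_kernelP sp0 spt tsp al1 nu0 L1 be0 AB) x0 r0.
apply/ess_supP; apply: filterS abAB => -[x y] /= [aA bB]; rewrite patchE.
case: ifPn => [|_]; last first.
  by rewrite lee_fin mulr_ge0 ?(ltW H0)//; have := be0; have := L1; lra.
rewrite in_setX => /andP[/set_mem x0x /set_mem x0y].
rewrite /growth_density/= lee_fin aA bB -!powRN.
exact: (dphase_sum_le spt tsp al1 L1 be0 AB).
Qed.

(** Otherwise almost no pair would lie in the product of the two balls, whose measure is positive.
    For r <= 1 both inverse powers of [r] are at least 1, so the density is at least A + B. *)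
Let growth_sup_ge : (nu%:E <= growth_sup)%E.
Proof.
rewrite leNgt; apply/negP => lt_nu.
have : {ae mu2, forall z, ~ (eball x0 r `*` eball x0 r) z}.
  apply: filterS2 abAB (ess_sup_ge mu2 (growth_density \_ (eball x0 r `*` eball x0 r))).
  move=> [x y] /= [aA bB]; rewrite patchE => /[swap] xy; rewrite mem_set//.
  move=> /le_lt_trans/(_ lt_nu); rewrite /growth_density/= lte_fin aA bB ltNge => /negP; apply.
  have rp q : 0 < q -> 1 <= (r `^ q)^-1.
    move=> q0; rewrite invf_ge1 ?powR_gt0// -[leRHS](powRr0 r).
    by apply: ger_powR; rewrite ?r0// ltW.
  apply: (le_trans (rc_ge AB x y)); apply: lerD.
    by rewrite ler_peMr ?(rc_A0 AB)// rp.
  by rewrite ler_peMr ?(rc_B0 AB)// rp.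
move=> [N [mN N0 sub]].
have : (mu2 (eball x0 r `*` eball x0 r) <= mu2 N)%E.
  apply: le_measure; rewrite ?inE//; first by apply: measurableX; exact: measurable_eball.
  by move=> z zB; apply: sub => /= nz; exact: nz.
rewrite N0 leNgt => /negP; apply.
rewrite [ltRHS](_ : _ = mu (eball x0 r) * mu (eball x0 r))%E; last first.
  by apply: product_measure1E; exact: measurable_eball.
have b0 : (0 < mu (eball x0 r))%E.
  apply: lt_le_trans (eball_vol_ge n0 x0 r0).
  by rewrite lte_fin mulr_gt0 ?exprn_gt0// !divr_gt0// ltr0n.
exact: mule_gt0.
Qed.

Let growth_cst : R := fine growth_sup.

Let growth_supE : growth_sup = growth_cst%:E.
Proof.
rewrite /growth_cst fineK// fin_numE; apply/andP; split.
  by rewrite gt_eqF//; apply: lt_le_trans growth_sup_ge; exact: ltNyr.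
by rewrite -ltey; apply: le_lt_trans growth_sup_le _; exact: ltry.
Qed.

Let growth_cst_gt0 : 0 < growth_cst.
Proof. by have := growth_sup_ge; rewrite growth_supE lee_fin; exact: lt_le_trans. Qed.

Let growth_cst_le : growth_cst <= (L + 2 * be + 1) * H x0 r.
Proof. by have := growth_sup_le; rewrite growth_supE lee_fin. Qed.

Let g_ballE tau : 0 <= tau -> g_ball a b s t p x0 r tau = growth_cst * tau `^ (p - 1).
Proof.
rewrite le_eqVlt => /predU1P[<-|tau0].
  by rewrite /g_ball invr0 mulr0 powR0 ?mulr0// gt_eqF.
have taup : 0 < tau `^ p by rewrite powR_gt0.
rewrite /g_ball /G_ball (_ : ess_sup _ _ = ((tau `^ p)%:E * growth_sup)%E).
  rewrite growth_supE -EFinM/= -(mulr_powRB1 (ltW tau0) p0).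
  by field; rewrite gt_eqF.
rewrite -ess_sup_pZl//; congr (ess_sup _ _); apply/funext => z /=; rewrite !patchE.
case: ifPn => _; last by rewrite mule0.
by rewrite /growth_density -EFinM; congr EFin; ring.
Qed.

(** The growth function is a positive finite constant times the power p - 1, hence injective on the
    half line with an explicit inverse. The constant is at most a multiple of [H x0 r]. *)
Lemma g_ball_invP (T : R) : 0 <= T ->
  0 <= g_ball_inv a b s t p x0 r T /\
  T <= (L + 2 * be + 1) * H x0 r * g_ball_inv a b s t p x0 r T `^ (p - 1).
Proof.
move=> T0; pose tau0 := (T / growth_cst) `^ (p - 1)^-1.
have tau00 : 0 <= tau0 by exact: powR_ge0.
have q0 : 0 <= T / growth_cst by rewrite divr_ge0// ltW.
have gtau : g_ball a b s t p x0 r tau0 = T.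
  rewrite g_ballE// /tau0 -powRrM mulVf ?gt_eqF// powRr1// mulrC divfK// gt_eqF//.
have -> : g_ball_inv a b s t p x0 r T = tau0.
  rewrite -gtau /g_ball_inv pinvKV//; last by rewrite inE.
  move=> x y; rewrite !inE/= => x00 y0; rewrite !g_ballE// => /mulfI.
  move=> /(_ (lt0r_neq0 growth_cst_gt0)) xy.
  rewrite -(powRr1 x00) -(powRr1 y0) -(mulfV (lt0r_neq0 pm1)).
  by rewrite !powRrM xy.
split => //; rewrite -{1}gtau g_ballE// ler_wpM2r ?powR_ge0//.
Qed.

Variables (u v : 'rV[R]_n -> R).
Hypothesis uv : {ae mu, forall x, u x = v x}.
Hypothesis mv : measurable_fun setT v.
Hypothesis tailfin : (tail a b s t p u x0 (r / 2) r < +oo)%E.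

Let tail_density (x y : 'rV[R]_n) : R :=
  A x y * (`|v y| `^ (p - 1) / enorm (y - x0) `^ (n%:R + s * p)) +
  B x y * (`|v y| `^ (p - 1) / enorm (y - x0) `^ (n%:R + t * p)).

Let tail_density_ge0 x y : 0 <= tail_density x y.
Proof.
by rewrite addr_ge0// mulr_ge0 ?(rc_A0 AB) ?(rc_B0 AB)// divr_ge0// powR_ge0.
Qed.

Let measurable_tail_density x : measurable_fun setT (tail_density x).
Proof.
have mpow (f : 'rV[R]_n -> R) q : measurable_fun setT f ->
  measurable_fun setT (fun y => f y `^ q).
  by move=> mf; exact: (measurableT_comp (measurable_powR _)).
have md (q : R) : measurable_fun setT (fun y : 'rV[R]_n => (enorm (y - x0) `^ q)^-1).
  under eq_fun do rewrite -powRN; apply: mpow; apply: measurable_enorm.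
  exact: measurable_fun_subrV.
have mvp : measurable_fun setT (fun y => `|v y| `^ (p - 1)).
  by apply: mpow; exact: measurableT_comp.
apply: measurable_funD; apply: measurable_funM; try by apply: measurable_funM.
  exact: (measurableT_comp (rc_measA AB) (pair1_measurable x)).
exact: (measurableT_comp (rc_measB AB) (pair1_measurable x)).
Qed.

Let tail_density_ae : {ae mu, forall x, eball x0 r x ->
  (\int[mu]_(y in ~` eball x0 (r / 2)) (tail_density x y)%:E <=
   tail a b s t p u x0 (r / 2) r)%E}.
Proof.
pose F x := (\int[mu]_(y in ~` eball x0 (r / 2))
  (a x y * (`|u y| `^ (p - 1) / enorm (y - x0) `^ (n%:R + s * p))
   + b x y * (`|u y| `^ (p - 1) / enorm (y - x0) `^ (n%:R + t * p)))%:E)%E.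
have -> : tail a b s t p u x0 (r / 2) r = ess_sup mu (F \_ (eball x0 r)) by [].
apply: filterS2 (ae_section abAB) (ess_sup_ge mu (F \_ (eball x0 r))) => x abx Fx x0x.
move: Fx; rewrite patchE (mem_set x0x) => Fx; suff -> : (\int[mu]_(y in ~` eball x0 (r / 2))
  (tail_density x y)%:E = F x)%E by [].
apply: ae_eq_integral_gen.
by apply: filterS2 abx uv => y /= [aA bB] uvy _; rewrite /tail_density aA bB uvy.
Qed.

(** An essential supremum of nonnegative values is seen to be nonnegative at a point of a ball of
    positive measure, where it bounds the integral. *)
Lemma tail_version_ge0 : (0 <= tail a b s t p u x0 (r / 2) r)%E.
Proof.
have [x _] := ae_eball_ex n0 r0 tail_density_ae; apply: le_trans.
by apply: integral_ge0 => y _; rewrite lee_fin tail_density_ge0.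
Qed.

Let tailE : tail a b s t p u x0 (r / 2) r = (fine (tail a b s t p u x0 (r / 2) r))%:E.
Proof. by rewrite fineK// ge0_fin_numE ?tail_version_ge0. Qed.

(** The tail weighs [y] by its distance to [x0], the kernel by its distance to [x]. For these points
    the second is at least 3/8 of the first, which costs the power of 8/3. *)
Let kernel_tail_density x y : eball x0 (5 / 8 * r) x -> ~ eball x0 r y ->
  `|v y| `^ (p - 1) * k x y <= (8 / 3) `^ (n%:R + t * p) * tail_density x y.
Proof.
rewrite /eball/= => x0x /negP; rewrite -leNgt => x0y.
have d0 : 0 < enorm (y - x0) by exact: lt_le_trans x0y.
have c0 : (0 : R) < 3 / 8 by rewrite divr_gt0.
have c1 : (1 : R) <= 8 / 3 by rewrite ler_pdivlMr// mul1r ler_nat.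
have dxy : 3 / 8 * enorm (y - x0) <= enorm (x - y).
  by have := ler_enormB y x x0; rewrite (enormC y x); lra.
have far q : 0 < q -> q <= t * p ->
    enorm (x - y) `^ (- (n%:R + q)) <= (8 / 3) `^ (n%:R + t * p) / enorm (y - x0) `^ (n%:R + q).
  move=> q0 qt; have nq : 0 <= n%:R + q by rewrite addr_ge0// ltW.
  apply: (le_trans (le0_powR_le (mulr_gt0 c0 d0) dxy nq)).
  rewrite powRM ?(ltW c0) ?(ltW d0)// [X in _ * X]powRN ler_wpM2r ?invr_ge0 ?powR_ge0//.
  by rewrite -powRV ?(ltW c0)// invf_div; apply: ler_powR => //; rewrite lerD2l.
rewrite /dphase_kernel /tail_density mulrDr [leRHS]mulrDr; apply: lerD.
  rewrite [leLHS]mulrCA [leRHS]mulrCA; apply: ler_wpM2l; first exact: rc_A0 AB x y.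
  by rewrite [leRHS]mulrCA ler_wpM2l ?powR_ge0// far.
rewrite [leLHS]mulrCA [leRHS]mulrCA; apply: ler_wpM2l; first exact: rc_B0 AB x y.
by rewrite [leRHS]mulrCA ler_wpM2l ?powR_ge0// far.
Qed.

Lemma tail_version_le (N : R) :
  g_ball_inv a b s t p x0 r (fine (tail a b s t p u x0 (r / 2) r)) <= N ->
  {ae mu, forall x, eball x0 (5 / 8 * r) x ->
    (\int[mu]_(y in ~` eball x0 r) (`|v y| `^ (p - 1) * k x y)%:E <=
     ((8 / 3) `^ (n%:R + t * p) * (L + 2 * be + 1) * H x0 r * N `^ (p - 1))%:E)%E}.
Proof.
have [g0 gT] := g_ball_invP (fine_ge0 tail_version_ge0).
move: g0 gT; set tau := g_ball_inv _ _ _ _ _ _ _ _ => g0 gT gN.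
have H0 : 0 < H x0 r := pk_H0 (dphase_kernelP sp0 spt tsp al1 nu0 L1 be0 AB) x0 r0.
have c0 : 0 <= (8 / 3) `^ (n%:R + t * p) :> R by exact: powR_ge0.
apply: filterS tail_density_ae => x tx x0x.
have r58 : 5 / 8 * r <= r by rewrite ler_piMl ?(ltW r0)// ler_pdivrMr// mul1r ler_nat.
have r2 : r / 2 <= r by rewrite ler_piMr ?(ltW r0)// invf_le1 ?ler1n.
have x0r : eball x0 r x by exact: subset_eballr x0x.
apply: (@le_trans _ _ (\int[mu]_(y in ~` eball x0 (r / 2))
    ((8 / 3) `^ (n%:R + t * p) * tail_density x y)%:E)%E).
  apply: ge0_subset_integral_gen.
  - move=> y _; rewrite lee_fin mulr_ge0 ?powR_ge0//.
    exact: (pk_ge0 (dphase_kernelP sp0 spt tsp al1 nu0 L1 be0 AB)).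
  - by move=> y _; rewrite lee_fin mulr_ge0.
  - by apply: subsetC; exact: subset_eballr.
  by move=> y yr; rewrite lee_fin kernel_tail_density.
rewrite integralZl_fin//; last by apply: measurableC; exact: measurable_eball.
apply: (@le_trans _ _ (((8 / 3) `^ (n%:R + t * p))%:E * tail a b s t p u x0 (r / 2) r)%E).
  by rewrite lee_wpmul2l ?lee_fin//; exact: tx.
rewrite tailE -EFinM lee_fin -!mulrA ler_wpM2l// !mulrA; apply: (le_trans gT).
rewrite ler_wpM2l ?mulr_ge0 ?(ltW H0)//; first by have := be0; have := L1; lra.
by apply: ge0_ler_powR; rewrite ?nnegrE ?(ltW pm1)// (le_trans g0).
Qed.

End growth_function.

(** * The local estimate for weak solutions *)

Section local_estimate.
Context (R : realType) (n : nat).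
Hypothesis n0 : (0 < n)%N.
Local Notation mu := (lebesgue_rV R n).
Variables (s t p nu L al be : R).
Hypotheses (s0 : 0 < s) (st : s < t) (t1 : t < 1) (p1 : 1 < p).
Hypotheses (nu0 : 0 < nu) (nu1 : nu <= 1) (L1 : 1 <= L) (al0 : 0 < al) (al1 : al <= 1).
Hypotheses (tsal : (t - s) * p <= al) (be0 : 0 <= be).

Let p0 : 0 < p. Proof. exact: lt_trans p1. Qed.
Let sp0 : 0 < s * p. Proof. exact: mulr_gt0. Qed.
Let spt : s * p <= t * p. Proof. by rewrite ler_pM2r// ltW. Qed.
Let tp : t * p < p. Proof. by rewrite gtr_pMl. Qed.
Let tsp : t * p - s * p <= al. Proof. by rewrite -mulrBl. Qed.

Definition local_size (a b : 'rV[R]_n -> 'rV[R]_n -> R) (u : 'rV[R]_n -> R)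
    (x0 : 'rV[R]_n) (r : R) : R :=
  ((fine (mu (eball x0 r)))^-1 * \int[mu]_(x in eball x0 r) (`|u x| `^ p)) `^ p^-1
  + g_ball_inv a b s t p x0 r (fine (tail a b s t p u x0 (r / 2) r)).

Let eball_vol_gt0 (x0 : 'rV[R]_n) (r : R) : 0 < r -> 0 < fine (mu (eball x0 r)).
Proof.
move=> r0; rewrite -/(vol _) -lte_fin -eball_volE.
apply: lt_le_trans (eball_vol_ge n0 x0 r0).
by rewrite lte_fin mulr_gt0 ?exprn_gt0// !divr_gt0// ltr0n.
Qed.

(** The volume of the ball is at most 2^n r^n; as 2^n <= (2^n)^p, this factor can be put inside the
    power. *)
Let average_arith (V J r N : R) : 0 < r -> 0 < V -> V <= 2 ^+ n * r ^+ n -> 0 <= J ->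
  (V^-1 * J) `^ p^-1 <= N -> J <= (2 ^+ n * N) `^ p * r ^+ n.
Proof.
move=> r0 V0 VV J0 avN; have av0 : 0 <= V^-1 * J by rewrite mulr_ge0// invr_ge0 ltW.
have N0 : 0 <= N by apply: le_trans avN; exact: powR_ge0.
have : V^-1 * J <= N `^ p.
  rewrite -[leLHS](powRr1 av0) -(mulVf (lt0r_neq0 p0)) powRrM.
  by apply: ge0_ler_powR; rewrite ?nnegrE ?powR_ge0 ?(ltW p0).
rewrite ler_pdivrMl// => /le_trans; apply.
apply: (@le_trans _ _ (2 ^+ n * r ^+ n * N `^ p)).
  by rewrite ler_wpM2r ?powR_ge0.
have two1 : 1 <= 2 ^+ n :> R by rewrite exprn_ege1// ler1n.
rewrite powRM ?exprn_ge0// mulrAC ler_wpM2r ?exprn_ge0 ?(ltW r0)// ler_wpM2r ?powR_ge0//.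
by apply: le1r_powR => //; exact: ltW.
Qed.

Let average_le (u v : 'rV[R]_n -> R) (Omega : set 'rV[R]_n) (x0 : 'rV[R]_n) (r N : R) :
  {ae mu, forall x, u x = v x} -> (\int[mu]_(x in Omega) (`|v x| `^ p)%:E < +oo)%E ->
  0 < r -> eball x0 r `<=` Omega ->
  ((fine (mu (eball x0 r)))^-1 * \int[mu]_(x in eball x0 r) (`|u x| `^ p)) `^ p^-1 <= N ->
  (\int[mu]_(x in eball x0 r) (`|v x| `^ p)%:E <= ((2 ^+ n * N) `^ p * r ^+ n)%:E)%E.
Proof.
move=> uv vI r0 x0O.
have vB : (\int[mu]_(x in eball x0 r) (`|u x| `^ p)%:E =
           \int[mu]_(x in eball x0 r) (`|v x| `^ p)%:E)%E.
  by apply: ae_eq_integral_gen; apply: filterS uv => x ->.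
have I0 : (0 <= \int[mu]_(x in eball x0 r) (`|v x| `^ p)%:E)%E.
  by apply: integral_ge0 => x _; rewrite lee_fin powR_ge0.
have Ifin : (\int[mu]_(x in eball x0 r) (`|v x| `^ p)%:E < +oo)%E.
  by apply: le_lt_trans vI; apply: ge0_subset_integral_gen.
rewrite /Rintegral vB; set I := (\int[mu]_(x in _) _)%E in I0 Ifin *.
have [J JE] : exists J, I = J%:E.
  by exists (fine I); apply/esym/fineK; rewrite (ge0_fin_numE I0); exact: Ifin.
rewrite JE/= lee_fin; apply: (average_arith r0 (eball_vol_gt0 x0 r0)).
  by rewrite -/(vol _) -lee_fin -eball_volE; apply: eball_vol_le; exact: ltW.
by rewrite -lee_fin -JE.
Qed.

(** [N] is strictly above the bracket of the statement, so that it is positive even if the bracket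
    is 0. One version [v] serves all balls, as a single representative is needed at the end. *)
Lemma local_estimate : exists ga C : R, [/\ 0 < ga, ga < 1, 0 < C &
  forall (Omega : set 'rV[R]_n) (Ksp Ktp a b : 'rV[R]_n -> 'rV[R]_n -> R)
    (u : 'rV[R]_n -> R),
  open Omega ->
  measurable_symmetric Ksp -> measurable_symmetric Ktp ->
  measurable_symmetric a -> measurable_symmetric b ->
  (forall x y, 0 <= a x y) -> (forall x y, 0 <= b x y) ->
  kernel_bounds nu L s p Ksp -> kernel_bounds nu L t p Ktp ->
  sum_bounds nu L a b -> holder_coefficient al be b ->
  tail_space a b s t p u -> weak_solution a b Ksp Ktp s t p Omega u ->
  exists2 v : 'rV[R]_n -> R, {ae mu, forall x, u x = v x} &
  forall x0 r, 0 < r -> r <= 1 -> eball x0 r `<=` Omega ->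
  0 <= local_size a b u x0 r /\
  forall N, local_size a b u x0 r < N ->
  forall z, eball x0 (r / 2) z -> exists2 c, `|c| <= C * N &
    forall rho, 0 < rho -> rho <= r / 32 ->
    {ae mu, forall x, eball z rho x -> `|v x - c| <= C * N * (rho / r) `^ ga}].
Proof.
have La0 := dphase_upper_gt0 L1 be0; have la0 := dphase_lower_gt0 nu0 be0.
have nuL : nu <= L by exact: le_trans L1.
have CE0 := caccioppoli_cst_gt0 p nu0 nuL.
have Th0 : 0 <= (8 / 3) `^ (n%:R + t * p) * (L + 2 * be + 1).
  by rewrite mulr_ge0 ?powR_ge0//; have := be0; have := L1; lra.
have Lb1 : 1 <= 1 + 2 * be by rewrite lerDl mulr_ge0.
have [ga [C [ga0 ga1 C0 loc]]] :=
  local_oscillation n0 sp0 spt tp p1 la0 La0 CE0 Th0 Lb1.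
have two0 : 0 < 2 ^+ n :> R by rewrite exprn_gt0.
have two1 : 1 <= 2 ^+ n :> R by rewrite exprn_ege1// ler1n.
exists ga, (C * 2 ^+ n); split => //; first exact: mulr_gt0.
move=> Omega Ksp Ktp a b u oO mKs mKt ma mb a0 b0 Ks Kt ab hb [mu_u _ tailu] wu.
have mO := open_rV_measurable oO.
have [A [B [AB abAB]]] := coefficient_versions nu1 L1 al0 be0 ma mb a0 b0 ab hb.
have [K mK KE] := kernel_version ma mb mKs mKt.
have [v mv uv] := lebesgue_measurable_version mu_u.
have Kk := dphase_kernelP sp0 spt tsp al1 nu0 L1 be0 AB.
have Kae := kernel_version_bounds (rc_A0 AB) (rc_B0 AB) abAB KE Ks Kt.
have vI := version_integral uv wu.1.
have vE := version_energy abAB uv wu.1.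
have wv := version_weak_form abAB KE uv wu.
have HM x : dphase_scale (s * p) (t * p) B x 1 <= 1 + L := dphase_scale1 (s * p) (t * p) AB x.
have EI := caccioppoli sp0 spt tp p1 La0 nu0 nuL Kk mK Kae mO mv vI vE HM wv.
have mNv : measurable_fun setT (fun x => - v x) by exact: measurableT_comp.
have vNI : (\int[mu]_(x in Omega) (`|- v x| `^ p)%:E < +oo)%E.
  by under eq_integral do rewrite normrN.
have vNE : (kernel_energy p (dphase_kernel (s * p) (t * p) A B) Omega (fun x => (- v x)%R) <
  +oo)%E.
  by rewrite kernel_energyN.
have EIN := caccioppoli sp0 spt tp p1 La0 nu0 nuL Kk mK Kae mO mNv vNI vNE HM (weak_formN wv).
exists v => // x0 r r0 r1 x0O.
have tail_fin : (tail a b s t p u x0 (r / 2) r < +oo)%E.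
  by apply: tailu => //; rewrite divr_gt0.
have tail0 : 0 <= fine (tail a b s t p u x0 (r / 2) r).
  exact: fine_ge0 (tail_version_ge0 n0 s t p AB abAB x0 r0 uv).
have [g0 _] := g_ball_invP n0 s0 st p1 tsal al1 nu0 L1 be0 AB abAB x0 r0 r1 tail0.
split; first by rewrite addr_ge0// powR_ge0.
move=> N sN z x0z.
have gN : g_ball_inv a b s t p x0 r (fine (tail a b s t p u x0 (r / 2) r)) < N.
  by apply: le_lt_trans sN; rewrite lerDr powR_ge0.
have N0 : 0 < N by exact: le_lt_trans gN.
have N2 : 0 < 2 ^+ n * N by exact: mulr_gt0.
have NN : N <= 2 ^+ n * N by rewrite ler_peMl// ltW.
have near_ball z' r3 : enorm (z' - x0) + r3 < r -> eball z' r3 `<=` Omega.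
  by move=> zr; apply: subset_trans x0O; apply: subset_eball; exact: ltW.
have [|||||c cN osc] := loc _ _ Kk v x0 r (2 ^+ n * N) mv r0 r1 N2 _ _ _ _ _ z x0z.
- by move=> y xy; exact: (dphase_scale_near spt tsp al1 be0 AB).
- by move=> z' r3 _ /near_ball z'O; exact: EI.
- by move=> z' r3 _ /near_ball z'O; exact: EIN.
- apply: (average_le uv vI r0 x0O); apply: le_trans (ltW sN).
  by rewrite lerDl.
- apply: (tail_version_le n0 s0 st p1 tsal al1 nu0 L1 be0 AB abAB r0 r1 uv mv tail_fin).
  exact: le_trans (ltW gN) NN.
exists c; first by rewrite -mulrA.
by move=> rho rho0 rho32; rewrite -[C * _ * N]mulrA; exact: osc.
Qed.

End local_estimate.

(** * The Hoelder continuous representative *)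

Section essential_value.
Context (R : realType) (n : nat).
Hypothesis n0 : (0 < n)%N.
Local Notation mu := (lebesgue_rV R n).
Implicit Types (x y z : 'rV[R]_n) (U : set 'rV[R]_n).

Lemma nbhs_eball z (r : R) : 0 < r -> nbhs z (eball z r).
Proof.
move=> r0; have m0 : 0 < n%:R + 1 :> R by rewrite ltr_wpDl.
apply/nbhs_ballP; exists (r / (n%:R + 1)); first exact: divr_gt0.
move=> y [_ zy]; rewrite /eball/=.
apply: (@le_lt_trans _ _ (n%:R * (r / (n%:R + 1)))).
  apply: enorm_le_coord; first by rewrite divr_ge0 ?ltW.
  by move=> i; rewrite !mxE distrC; exact/ltW/zy.
by rewrite mulrA ltr_pdivrMr// mulrC ltr_pM2l// ltrDl.
Qed.

Lemma open_eball U z : open U -> U z -> exists2 r : R, 0 < r <= 1 & eball z r `<=` U.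
Proof.
move=> oU Uz; have /nbhs_ballP[e/= e0 eU] : nbhs z U by exact: open_nbhs_nbhs.
exists (Num.min e 1); first by rewrite lt_min e0 ltr01/= ge_min lexx orbT.
move=> y; rewrite /eball/= lt_min => /andP[ye _]; apply: eU.
split => // i j; rewrite (ord1 i) /ball/= distrC.
by have := coord_le_enorm (y - z) j; rewrite !mxE => /le_lt_trans; apply.
Qed.

Lemma rational_eball z (rho : R) : 0 < rho -> exists (q : 'rV[rat]_n) (m : nat),
  eball (\row_i ratr (q ord0 i)) (m.+1%:R^-1) z /\
  eball (\row_i ratr (q ord0 i)) (m.+1%:R^-1) `<=` eball z rho.
Proof.
move=> rho0; have rho2 : 0 < rho / 2 by rewrite divr_gt0.
pose m := Num.truncn (rho / 2)^-1.
have mrho : m.+1%:R^-1 < rho / 2 by rewrite invf_plt ?posrE// truncnS_gt.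
have n1 : 0 < n%:R + 1 :> R by rewrite ltr_wpDl.
have m0 : 0 < m.+1%:R^-1 :> R by rewrite invr_gt0.
have e0 : 0 < m.+1%:R^-1 / (n%:R + 1) :> R by exact: divr_gt0.
have /choice[q qz] (i : 'I_n) : exists q : rat,
    `|z ord0 i - ratr q| < m.+1%:R^-1 / (n%:R + 1).
  have lt : z ord0 i < z ord0 i + m.+1%:R^-1 / (n%:R + 1) by rewrite ltrDl.
  have [q] := rat_in_itvoo lt; rewrite in_itv/= => /andP[xq qx].
  by exists q; rewrite distrC gtr0_norm ?subr_gt0// ltrBlDl.
exists (\row_i q i), m; set Q := \row_i _.
have zQ : enorm (z - Q) < m.+1%:R^-1.
  apply: (@le_lt_trans _ _ (n%:R * (m.+1%:R^-1 / (n%:R + 1)))).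
    apply: enorm_le_coord; first exact: ltW.
    by move=> i; rewrite !mxE; exact/ltW/qz.
  by rewrite mulrA ltr_pdivrMr// mulrC ltr_pM2l// ltrDl.
split=> //; apply: subset_eball; rewrite enormC (splitr rho).
by apply: lerD; apply: ltW => //; exact: lt_trans mrho.
Qed.

(** Countably many rational balls on which [P] holds almost everywhere cover [U]. No measurability
    of [P] or [U] enters. *)
Lemma ae_local U (P : 'rV[R]_n -> Prop) :
  (forall z, U z -> exists2 rho : R, 0 < rho & {ae mu, forall x, eball z rho x -> P x}) ->
  {ae mu, forall x, U x -> P x}.
Proof.
move=> loc.
pose D (c : 'rV[rat]_n * nat) : set 'rV[R]_n :=
  eball (\row_i ratr (c.1 ord0 i)) (c.2.+1%:R^-1).
have /ae_foralln : forall k : nat, {ae mu, forall x,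
    if unpickle k is Some c then {ae mu, forall y, D c y -> P y} -> D c x -> P x else True}.
  move=> k; case: unpickle => [c|]; last exact: aeW.
  have [h|nh] := pselect {ae mu, forall y, D c y -> P y}; first by apply: filterS h => x hx _.
  exact: aeW.
apply: filterS => x all Ux; have [rho rho0 aeP] := loc _ Ux.
have [q [m [Dx sub]]] := rational_eball x rho0.
have := all (pickle (q, m)); rewrite pickleK; apply => //.
by apply: filterS aeP => y yP Dy; apply: yP; exact: sub.
Qed.

(* Defined through null sets only, so that it does not depend on the radius of the
   ball on which the oscillation has been estimated; [0] is the junk value. *)
Definition ess_value (v : 'rV[R]_n -> R) z : R :=
  xget 0 [set c | forall e : R, 0 < e ->
    exists2 rho : R, 0 < rho & {ae mu, forall x, eball z rho x -> `|v x - c| <= e}].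

(** Two candidates would both be within a third of their distance from [v] at a common point of a
    small ball. *)
Lemma ess_valueE (v : 'rV[R]_n -> R) z (c B ga r : R) : 0 <= B -> 0 < ga -> 0 < r ->
  (forall rho, 0 < rho -> rho <= r ->
    {ae mu, forall x, eball z rho x -> `|v x - c| <= B * rho `^ ga}) ->
  ess_value v z = c.
Proof.
move=> B0 ga0 r0 osc; apply: xget_unique => /= [e e0|c' cc'].
  have [rho /andP[rho0 rhor] rhoe] := exists_small_powR B0 e0 ga0 r0.
  exists rho => //; apply: filterS (osc rho rho0 rhor) => x vx zx.
  exact: le_trans (vx zx) rhoe.
apply/eqP; rewrite -subr_eq0 -normr_le0 leNgt; apply/negP => d0.
have e0 : 0 < `|c' - c| / 3 by rewrite divr_gt0.
have [rho /andP[rho0 rhor] rhoe] := exists_small_powR B0 e0 ga0 r0.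
have [rho' rho'0 ae'] := cc' _ e0.
have m0 : 0 < Num.min rho rho' by rewrite lt_min rho0.
have : {ae mu, forall x, eball z (Num.min rho rho') x ->
    `|v x - c| <= `|c' - c| / 3 /\ `|v x - c'| <= `|c' - c| / 3}.
  apply: filterS2 (osc rho rho0 rhor) ae' => x vx vx' zx; split.
    apply: le_trans rhoe; apply: vx; apply: subset_eballr zx.
    by rewrite ge_min lexx.
  by apply: vx'; apply: subset_eballr zx; rewrite ge_min lexx orbT.
move=> /(ae_eball_ex n0 m0)[x _ [a1 a2]].
have := ler_distD (v x) c' c; rewrite (distrC c' (v x)); move: d0 a1 a2; lra.
Qed.

Lemma holder_seminorm_le (ga D : R) U (f : 'rV[R]_n -> R) :
  (forall x y, U x -> U y -> `|f x - f y| <= D * enorm (x - y) `^ ga) ->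
  (holder_seminorm ga U f <= D%:E)%E.
Proof.
move=> fD; apply: ge_ereal_sup => _ [x [y [Ux Uy xy ->]]].
by rewrite lee_fin ler_pdivrMr ?fD// powR_gt0// enorm_gt0.
Qed.

(** Lets [N] tend to the bracket itself, which the strict inequality of [local_estimate]
    excludes. *)
Let le_scaled (X c M : R) : 0 <= c -> (forall N, M < N -> X <= c * N) -> X <= c * M.
Proof.
move=> c0 h; rewrite leNgt; apply/negP => lt.
have c1 : 0 < 2 * (c + 1) by rewrite mulr_gt0// ltr_wpDl.
have d0 : 0 < (X - c * M) / (2 * (c + 1)) by rewrite divr_gt0// subr_gt0.
have := h (M + (X - c * M) / (2 * (c + 1))); rewrite ltrDl => /(_ d0).
rewrite leNgt => /negP; apply.
rewrite mulrDr mulrA -ltrBrDl ltr_pdivrMr// mulrC.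
rewrite ltr_pM2l ?subr_gt0//; lra.
Qed.

Variables (Omega : set 'rV[R]_n) (v : 'rV[R]_n -> R).
Variables (size : 'rV[R]_n -> R -> R) (ga C : R).
Hypotheses (oO : open Omega) (ga0 : 0 < ga) (ga1 : ga < 1) (C0 : 0 < C).
Hypothesis estimate : forall x0 r, 0 < r -> r <= 1 -> eball x0 r `<=` Omega ->
  0 <= size x0 r /\
  forall N, size x0 r < N ->
  forall z, eball x0 (r / 2) z -> exists2 c, `|c| <= C * N &
    forall rho, 0 < rho -> rho <= r / 32 ->
    {ae mu, forall x, eball z rho x -> `|v x - c| <= C * N * (rho / r) `^ ga}.

Lemma ess_value_close x0 (r N : R) z : 0 < r -> r <= 1 -> eball x0 r `<=` Omega ->
  size x0 r < N -> eball x0 (r / 2) z ->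
  `|ess_value v z| <= C * N /\
  forall rho, 0 < rho -> rho <= r / 32 ->
    {ae mu, forall x, eball z rho x -> `|v x - ess_value v z| <= C * N * (rho / r) `^ ga}.
Proof.
move=> r0 r1 x0O sN x0z; have [s0 est] := estimate r0 r1 x0O.
have [c cN osc] := est N sN z x0z.
have N0 : 0 < N by exact: le_lt_trans sN.
have -> : ess_value v z = c; last by split.
have r32 : 0 < r / 32 by rewrite divr_gt0.
apply: (@ess_valueE _ _ _ (C * N / r `^ ga) ga (r / 32)) => //.
  by rewrite divr_ge0 ?powR_ge0// mulr_ge0 ?ltW.
move=> rho rho0 rhor; apply: filterS (osc rho rho0 rhor) => x /[apply].
by rewrite powR_div ?(ltW rho0) ?(ltW r0)// mulrA mulrAC.
Qed.

Let close_sum2 (c E W X Y Z : R) : 0 <= c -> 0 <= E -> X <= Y + Z ->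
  Y <= c * W -> Z <= c * W -> W <= 2 * E -> X <= 128 * c * E.
Proof.
move=> c0 E0 XYZ YW ZW /(ler_wpM2l c0) WE.
have cE : 0 <= c * E by exact: mulr_ge0.
have := lerD YW ZW; rewrite mulrCA in WE; rewrite -mulrA.
by move: XYZ WE cE; move: (c * W) (c * E) => w e; lra.
Qed.

(** Close points are compared through [v] at a common point of a ball of radius their distance,
    distant ones through the bound on both values. The latter case gives the constant: 128 = 2 *
    64. *)
Lemma ess_value_holder x0 (r : R) z z' : 0 < r -> r <= 1 -> eball x0 r `<=` Omega ->
  eball x0 (r / 2) z -> eball x0 (r / 2) z' ->
  `|ess_value v z - ess_value v z'| <=
    128 * C * (enorm (z - z') / r) `^ ga * size x0 r.
Proof.
move=> r0 r1 x0O x0z x0z'; apply: le_scaled => [|N sN].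
  by rewrite mulr_ge0 ?powR_ge0// mulr_ge0// ltW.
have [s0 _] := estimate r0 r1 x0O; have N0 : 0 < N by exact: le_lt_trans sN.
have CN0 : 0 < C * N by exact: mulr_gt0.
have [zN oscz] := ess_value_close r0 r1 x0O sN x0z.
have [z'N oscz'] := ess_value_close r0 r1 x0O sN x0z'.
have [->|zz'] := eqVneq z z'.
  by rewrite subrr normr0 !mulr_ge0 ?powR_ge0// ltW.
have d0 := enorm_gt0 zz'.
have q0 : 0 <= enorm (z - z') / r by rewrite divr_ge0 ?enorm_ge0// ltW.
rewrite [leRHS](_ : _ = 128 * (C * N) * (enorm (z - z') / r) `^ ga); last by ring.
(* The radius used is twice the distance, so that the ball around z' covers the ball around z; it
   must not exceed r/32. *)
have [dr|rd] := leP (2 * enorm (z - z')) (r / 32); last first.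
  apply: (@le_trans _ _ (2 * (C * N))).
    by apply: (le_trans (ler_normB _ _)); rewrite mulr_natl mulr2n; exact: lerD.
  rewrite [leRHS](_ : _ = 2 * (C * N) * (64 * (enorm (z - z') / r) `^ ga)); last by ring.
  rewrite ler_peMr//; first by rewrite mulr_ge0// ltW.
  apply: (@le_trans _ _ ((64 * (enorm (z - z') / r)) `^ ga)).
    rewrite powR_ge1 ?(ltW ga0)// mulrA ler_pdivlMr// mul1r.
    by move: rd; lra.
  by rewrite powRM// ler_wpM2r ?powR_ge0// ler1_powR ?ler1n// ltW.
have D0 : 0 < 2 * enorm (z - z') by exact: mulr_gt0.
have : {ae mu, forall x, eball z (enorm (z - z')) x ->
    `|v x - ess_value v z| <= C * N * (2 * enorm (z - z') / r) `^ ga /\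
    `|v x - ess_value v z'| <= C * N * (2 * enorm (z - z') / r) `^ ga}.
  apply: filterS2 (oscz _ D0 dr) (oscz' _ D0 dr) => x vz vz' zx; split.
    by apply: vz; apply: subset_eballr zx; rewrite ler_peMl ?ler1n// ltW.
  by apply: vz'; apply: subset_eball zx; rewrite mulr_natl mulr2n.
move=> /(ae_eball_ex n0 d0)[x _ []]; rewrite (distrC (v x)) => a1 a2.
have a3 : (2 * enorm (z - z') / r) `^ ga <= 2 * (enorm (z - z') / r) `^ ga.
  by rewrite -mulrA powRM// ler_wpM2r ?powR_ge0// ler1_powR ?ler1n// ltW.
exact: (close_sum2 (ltW CN0) (powR_ge0 _ _)
  (ler_distD (v x) (ess_value v z) (ess_value v z')) a1 a2 a3).
Qed.

Let close_sum (S c E T m X Y Z : R) : 0 <= S -> 0 <= c -> 0 <= T -> E <= T ->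
  X <= Y + Z -> 129 * (c * (S + 1)) * T <= m ->
  Y <= c * (S + 1) * T -> Z <= 128 * c * E * S -> X <= m.
Proof.
move=> S0 c0 T0 ET XYZ Tm YT ZE.
have ES : 128 * c * S * E <= 128 * c * S * T by rewrite ler_wpM2l// !mulr_ge0.
have cT : 0 <= c * T by exact: mulr_ge0.
apply: (le_trans XYZ); apply: le_trans Tm.
rewrite [leRHS](_ : _ = c * (S + 1) * T + (128 * c * S * T + 128 * (c * T))); last by ring.
apply: lerD => //; apply: (le_trans ZE).
rewrite [leLHS](_ : _ = 128 * c * S * E); last by ring.
by apply: (le_trans ES); rewrite lerDl mulr_ge0.
Qed.

(** For each m the two functions differ by at most 1/(m+1) almost everywhere near each point z:
    [v x] is close to the value at z, and that value to the one at x. Countably many m suffice. *)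
Lemma ess_value_ae : {ae mu, forall x, Omega x -> ess_value v x = v x}.
Proof.
have approx (m : nat) : {ae mu, forall x, Omega x -> `|v x - ess_value v x| <= m.+1%:R^-1}.
  apply: ae_local => z Oz; have [r /andP[r0 r1] zO] := open_eball oO Oz.
  have [s0 _] := estimate r0 r1 zO.
  have r20 : 0 < r / 2 by rewrite divr_gt0.
  have sN : size z r < size z r + 1 by rewrite ltrDl.
  have zz : eball z (r / 2) z by exact: eball_center.
  have [_ osc] := ess_value_close r0 r1 zO sN zz.
  (* 129 adds 1 for the distance from [v x] to the value at z and 128 from the Hoelder bound. *)
  have B0 : 0 <= 129 * (C * (size z r + 1)).
    by rewrite !mulr_ge0 ?addr_ge0// ltW.
  have m0 : 0 < m.+1%:R^-1 :> R by rewrite invr_gt0.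
  have t0 : 0 < 32^-1 :> R by rewrite invr_gt0.
  have [h /andP[h0 h32] hB] := exists_small_powR B0 m0 ga0 t0.
  have hr0 : 0 < h * r by exact: mulr_gt0.
  have hr : h * r <= r / 32 by rewrite mulrC ler_pM2l.
  exists (h * r) => //; apply: filterS (osc _ hr0 hr) => x vx zx.
  have {}vx := vx zx; rewrite mulfK ?gt_eqF// in vx.
  have zx2 : eball z (r / 2) x.
    apply: subset_eballr zx; apply: (le_trans hr).
    by rewrite ler_pM2l// lef_pV2 ?posrE ?ler_nat.
  have near_pow : (enorm (z - x) / r) `^ ga <= h `^ ga.
    rewrite ge0_ler_powR ?nnegrE ?divr_ge0 ?enorm_ge0 ?(ltW ga0) ?(ltW h0) ?(ltW r0)//.
    by rewrite ler_pdivrMr// enormC ltW.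
  exact: (close_sum s0 (ltW C0) (powR_ge0 _ _) near_pow
    (ler_distD (ess_value v z) (v x) (ess_value v x)) hB vx
    (ess_value_holder r0 r1 zO zz zx2)).
apply: filterS (ae_foralln approx) => x all Ox; apply/eqP.
rewrite eq_sym -subr_eq0 -normr_le0 leNgt; apply/negP => d0.
have := all (Num.truncn `|v x - ess_value v x|^-1) Ox.
by rewrite leNgt invf_plt ?posrE// truncnS_gt.
Qed.

(** Compactness gives one integer that serves as bound, as Hoelder constant, and as inverse scale
    below which the Hoelder bound holds. Pairs of [K] further apart are handled by the bound on the
    values. *)
Lemma ess_value_holder_loc : holder_loc ga Omega (ess_value v).
Proof.
move=> K cK KO; pose V := ess_value v.
pose P (i : nat) (x : 'rV[R]_n) := `|V x| <= i%:R /\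
  forall y, enorm (x - y) < i.+1%:R^-1 -> `|V x - V y| <= i%:R * enorm (x - y) `^ ga.
have /compact_near_coveringP cov := cK.
have [i iP] : exists i, K `<=` P i.
  apply: (@filter_ex _ (\oo : set_system nat)).
  have covP := cov nat (\oo : set_system nat) P _.
  apply: covP => z Kz; have [r /andP[r0 r1] zO] := open_eball oO (KO _ Kz).
  have [s0 _] := estimate r0 r1 zO.
  have sN : size z r < size z r + 1 by rewrite ltrDl.
  have r40 : 0 < r / 4 by rewrite divr_gt0.
  have r42 : r / 4 <= r / 2 by rewrite ler_pM2l// lef_pV2 ?posrE ?ler_nat.
  (* The summands dominate, in order, the values, the Hoelder constant, and the inverse of the
     radius within which both points stay in the half ball. *)
  pose B := C * (size z r + 1) + 128 * C * size z r / r `^ ga + (r / 4)^-1.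
  exists (eball z (r / 4), [set i | (Num.truncn B).+1 <= i]%N) => /=.
    by split; [exact: nbhs_eball|exact: nbhs_infty_ge].
  move=> [x i] [/= zx iB].
  have c1 : 0 <= C * (size z r + 1) by rewrite mulr_ge0 ?addr_ge0// ltW.
  have c2 : 0 <= 128 * C * size z r / r `^ ga.
    by rewrite divr_ge0 ?powR_ge0// !mulr_ge0// ltW.
  have c3 : 0 < (r / 4)^-1 by rewrite invr_gt0.
  have Bi : B <= i%:R.
    by apply: (le_trans (ltW (truncnS_gt B))); rewrite ler_nat.
  have zx2 : eball z (r / 2) x by exact: subset_eballr zx.
  have [xN _] := ess_value_close r0 r1 zO sN zx2.
  split; first by apply: (le_trans xN); move: Bi; rewrite /B; lra.
  move=> y xy; have ir : i.+1%:R^-1 <= r / 4.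
    rewrite invf_ple ?posrE// -natr1; move: Bi; rewrite /B; lra.
  have zy2 : eball z (r / 2) y.
    move: zx; rewrite /eball/= => zx.
    apply: (le_lt_trans (ler_enormB y x z)); rewrite (enormC y x).
    rewrite (_ : r / 2 = r / 4 + r / 4); last by field.
    by apply: ltrD => //; exact: lt_le_trans ir.
  apply: (le_trans (ess_value_holder r0 r1 zO zx2 zy2)).
  rewrite powR_div ?enorm_ge0 ?(ltW r0)//.
  rewrite [leLHS](_ : _ = 128 * C * size z r / r `^ ga * enorm (x - y) `^ ga); last by ring.
  by rewrite ler_wpM2r ?powR_ge0//; move: Bi; rewrite /B; lra.
have i0 : 0 <= i%:R :> R by exact: ler0n.
apply: (@le_lt_trans _ _ (i%:R + 2 * i%:R * i.+1%:R `^ ga)%:E); last exact: ltry.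
apply: holder_seminorm_le => x y Kx Ky.
have [[xi xy] [yi _]] := (iP _ Kx, iP _ Ky).
have e0 : 0 <= enorm (x - y) `^ ga by exact: powR_ge0.
have p0 : 0 <= 2 * i%:R * i.+1%:R `^ ga * enorm (x - y) `^ ga :> R.
  by rewrite !mulr_ge0 ?powR_ge0.
have p1 : 0 <= i%:R * enorm (x - y) `^ ga by exact: mulr_ge0.
rewrite mulrDl; have [d|d] := ltP (enorm (x - y)) (i.+1%:R^-1).
  by apply: (le_trans (xy _ d)); rewrite lerDl.
apply: (@le_trans _ _ (2 * i%:R)).
  by apply: (le_trans (ler_normB _ _)); rewrite mulr_natl mulr2n; exact: lerD.
apply: (@le_trans _ _ (2 * i%:R * i.+1%:R `^ ga * enorm (x - y) `^ ga)); last by rewrite lerDr.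
rewrite -mulrA ler_peMr ?mulr_ge0// -powRM ?enorm_ge0//.
by rewrite powR_ge1 ?(ltW ga0)// -ler_pdivrMl// mulr1.
Qed.

End essential_value.

(** * Hoelder regularity of weak solutions, read off the representative [ess_value] *)

Theorem theorem1p3 (R : realType) (n : nat) (s t p nu L alpha balpha : R) :
  (0 < n)%N ->
  0 < s -> s < t -> t < 1 -> 1 < p ->
  0 < nu -> nu <= 1 -> 1 <= L ->
  0 < alpha -> alpha <= 1 -> (t - s) * p <= alpha -> 0 <= balpha ->
  exists gamma c : R,
    [/\ 0 < gamma, gamma < 1, 0 < c &
    forall (Omega : set 'rV[R]_n) (Ksp Ktp a b : 'rV[R]_n -> 'rV[R]_n -> R)
           (u : 'rV[R]_n -> R),
      bounded_domain Omega ->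
      measurable_symmetric Ksp -> measurable_symmetric Ktp ->
      measurable_symmetric a -> measurable_symmetric b ->
      (forall x y, 0 <= a x y) -> (forall x y, 0 <= b x y) ->
      kernel_bounds nu L s p Ksp -> kernel_bounds nu L t p Ktp ->
      sum_bounds nu L a b ->
      holder_coefficient alpha balpha b ->
      energy_space a b s t p Omega u ->
      tail_space a b s t p u ->
      weak_solution a b Ksp Ktp s t p Omega u ->
      exists v : 'rV[R]_n -> R,
        [/\ {ae lebesgue_rV R n, forall x, Omega x -> v x = u x},
            holder_loc gamma Omega v &
            forall R0 : R, 0 < R0 -> R0 < 1 ->
              balpha * (2 * R0) `^ alpha <= nu / 8 ->
            forall (x0 : 'rV[R]_n) (r : R), 0 < r -> r <= R0 ->
              compactly_contained (eball x0 r) Omega ->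
              (holder_seminorm gamma (eball x0 (r / 2)) v <=
               (c * r `^ (- gamma) *
                (((fine (lebesgue_rV R n (eball x0 r)))^-1 *
                    \int[lebesgue_rV R n]_(x in eball x0 r) (`|u x| `^ p))
                   `^ p^-1
                 + g_ball_inv a b s t p x0 r
                     (fine (tail a b s t p u x0 (r / 2) r))))%:E)%E]].
Proof.
move=> n0 s0 st t1 p1 nu0 nu1 L1 al0 al1 tsal be0.
have [ga [C [ga0 ga1 C0 est]]] :=
  local_estimate n0 s0 st t1 p1 nu0 nu1 L1 al0 al1 tsal be0.
exists ga, (128 * C); split => //; first exact: mulr_gt0.
move=> Omega Ksp Ktp a b u [_ oO _ _] mKs mKt ma mb a0 b0 Ks Kt ab hb _ tu wu.
have {est} [v uv est] := est Omega Ksp Ktp a b u oO mKs mKt ma mb a0 b0 Ks Kt ab hb tu wu.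
exists (ess_value v); split.
- by apply: filterS2 uv (ess_value_ae n0 oO ga0 ga1 C0 est) => x ->.
- exact: (ess_value_holder_loc n0 oO ga0 ga1 C0 est).
move=> R0 R00 R01 _ x0 r r0 rR0 [_ x0O].
have r1 : r <= 1 by exact: le_trans rR0 (ltW R01).
have {}x0O : eball x0 r `<=` Omega by exact: subset_trans (@subset_closure _ _) x0O.
apply: holder_seminorm_le => x y xx xy.
apply: (le_trans (ess_value_holder n0 ga0 ga1 C0 est r0 r1 x0O xx xy)).
rewrite powR_div ?enorm_ge0 ?(ltW r0)// /local_size [r `^ (- ga)]powRN.
by rewrite le_eqVlt; apply/orP; left; apply/eqP; ring.
Qed.
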